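(* Let $N\ge 3$, let $\Xi\ni 0$ be a discretization of $\mathbb{R}^N$, let $A\in \dot C^1(\mathbb{R}^N,\Lambda_1)$, and let $(u_k)_{k\in\mathbb{N}}$ be a bounded sequence in $H^{1,2}_A(\mathbb{R}^N)$, already replaced by a (renamed) subsequence for which there are $v^{(n)}\in H^{1,2}_{\mathrm{loc}}(\mathbb{R}^N)$ (with $v^{(0)}\in H_A^{1,2}(\mathbb{R}^N)$) and $(y^{(n)}_k)_{k\in\mathbb{N}}\subset\Xi$, $n\in\mathbb{N}$, with $y^{(0)}_k=0$, giving a profile decomposition of $(u_k)$ in the sense defined in the context, and for which, for every $n\ge1$, the potential at infinity $A^{(n)}_\infty$ relative to $(y^{(n)}_k)_{k\in\mathbb{N}}$ is defined as the limit, uniform on bounded sets, of $A_{y^{(n)}_k}(\cdot+y^{(n)}_k)$ as $k\to\infty$; put $A^{(0)}_\infty=A$. Then $$\int_{\mathbb{R}^N}|u_k|^p\,dx\longrightarrow\sum_{n=0}^\infty\int_{\mathbb{R}^N}|v^{(n)}|^p\,dx\quad\text{as }k\to\infty,\qquad \text{for all } p\in(2,2^* ),$$ $$\sum_{n=0}^\infty\int_{\mathbb{R}^N}|v^{(n)}|^2\,dx\le\liminf_{k\to\infty}\int_{\mathbb{R}^N}|u_k|^2\,dx,$$ and $$\sum_{n=0}^\infty E_{A^{(n)}_\infty}(v^{(n)})\le\liminf_{k\to\infty}E_A(u_k).$$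
   Context: Functions are complex valued, $\mathbf{i}$ is the imaginary unit, $\mathbb{N}$ starts from $0$, and $2^*=\frac{2N}{N-2}$. A magnetic potential $A=(A_1,\dots,A_N)$ is a real 1-form on $\mathbb{R}^N$ (identified with a vector field; $\Lambda_1$ denotes 1-forms). $\dot C^1(\mathbb{R}^N,\Lambda_1)$ is the space of $C^1$ 1-forms with uniformly bounded first derivatives. Set $\nabla_A u=(\nabla+\mathbf{i}A)u$, $E_A(u)=\int_{\mathbb{R}^N}|\nabla_A u|^2dx$; $\dot H^{1,2}_A(\mathbb{R}^N)$ is the completion of $C_0^\infty(\mathbb{R}^N)$ in the norm $E_A(u)^{1/2}$, and $H^{1,2}_A(\mathbb{R}^N)=\dot H^{1,2}_A(\mathbb{R}^N)\cap L^2(\mathbb{R}^N)$ with the intersection norm. A discretization of $\mathbb{R}^N$ is a set $\Xi\subset\mathbb{R}^N$ with $0\in\Xi$, $\inf_{x,y\in\Xi,\,x\neq y}|x-y|>0$, and such that for some $\rho>0$ the balls $\{B_\rho(x)\}_{x\in\Xi}$ form a covering of $\mathbb{R}^N$ of uniformly finite multiplicity. Magnetic shifts: for $y\in\mathbb{R}^N$, $y\ne 0$, let $$\varphi_y(x)=c_y-\sum_{n=1}^N\int_{y_n}^{x_n}A_n(y_1,\dots,y_{n-1},t,x_{n+1},\dots,x_N)\,dt,$$ where $c_y\in\mathbb{R}$ is an arbitrarily fixed constant, and let $\varphi_0\equiv 0$. The magnetic shift is $(g_yu)(x)=e^{\mathbf{i}\varphi_y(x)}u(x-y)$, with inverse $(g_y^{-1}v)(x)=e^{-\mathbf{i}\varphi_y(x+y)}v(x+y)$;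 $g_0$ is the identity. The corrected potential is $A_y=A+\nabla\varphi_y$. Potential at infinity: for a sequence $Y=(y_k)$ with $|y_k|\to\infty$, after passing to a renamed subsequence, $A_{y_k}(\cdot+y_k)$ converges uniformly on bounded sets to a Lipschitz 1-form $A^{(Y)}_\infty$, called the magnetic potential at infinity relative to (the subsequence) $Y$; $E_{A_\infty^{(Y)}}$ is the corresponding energy at infinity. Profile decomposition: with $g^{(n)}_k:=g_{y^{(n)}_k}$, the data $v^{(n)}$, $(y_k^{(n)})$ satisfy: (i) $(g^{(n)}_k)^{-1}u_k\rightharpoonup v^{(n)}$ weakly in $H^{1,2}_{\mathrm{loc}}(\mathbb{R}^N)$ for every $n$; (ii) $|y^{(n)}_k-y^{(m)}_k|\to\infty$ for $n\neq m$; (iii) $u_k-\sum_{n=0}^\infty g^{(n)}_kv^{(n)}\to0$ in $L^p(\mathbb{R}^N)$ for all $p\in(2,2^* )$; (iv) $\sum_n|v^{(n)}(\cdot-y^{(n)}_k)|$ converges in $H^{1,2}(\mathbb{R}^N)$ and $\sum_n g^{(n)}_kv^{(n)}$ converges in $H^{1,2}_{\mathrm{loc}}(\mathbb{R}^N)$, unconditionally in $n$ and uniformly in $k$; (v) $g_{y_k}^{-1}u_k\rightharpoonup0$ in $H^{1,2}_{\mathrm{loc}}(\mathbb{R}^N)$ for every sequence $(y_k)$ in $\mathbb{R}^N$ with $|y_k-y^{(n)}_k|\to\infty$ for all $n$. *)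

(* Defs.v *)
From HB Require Import structures.
From mathcomp Require Import all_boot all_order all_algebra finmap.
From mathcomp Require Import complex.
From mathcomp Require Import all_classical all_reals all_analysis.
Set Implicit Arguments.
Unset Strict Implicit.
Unset Printing Implicit Defensive.
Import Order.TTheory GRing.Theory Num.Theory.
Import numFieldNormedType.Exports.
Local Open Scope classical_set_scope.
Local Open Scope card_scope.
Local Open Scope complex_scope.
Local Open Scope ring_scope.

(* Borel sigma-algebra of 'rV[R]_n, generated by the coordinates. *)

Definition measure_rV_display : measure_display.
Proof. exact: default_measure_display. Qed.

Section measurable_rV.
Context {R : realType}.
Variable n : nat.

Let coors : 'I_n -> 'rV[R]_n -> measurableTypeR R := fun i x => x ord0 i.

Let rV_set0 : g_sigma_preimage coors set0.
Proof. exact: sigma_algebra0. Qed.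

Let rV_setC A : g_sigma_preimage coors A -> g_sigma_preimage coors (~` A).
Proof. exact: sigma_algebraC. Qed.

Let rV_bigcup (F : _^nat) : (forall i, g_sigma_preimage coors (F i)) ->
  g_sigma_preimage coors (\bigcup_i (F i)).
Proof. exact: sigma_algebra_bigcup. Qed.

HB.instance Definition _ := @isMeasurable.Build measure_rV_display
  'rV[R]_n (g_sigma_preimage coors) rV_set0 rV_setC rV_bigcup.

Lemma measurable_coor_rV (i : 'I_n) :
  measurable_fun [set: 'rV[R]_n] (coors i).
Proof.
move=> _ Y mY; rewrite setTI; apply: sub_sigma_algebra => /=.
rewrite -bigcup_seq/=; exists i => /=; first by rewrite mem_index_enum.
by exists Y => //; rewrite setTI.
Qed.

Lemma measurable_fun_rVP d (T : measurableType d) (f : T -> 'rV[R]_n) :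
  (forall i, measurable_fun [set: T] (coors i \o f)) ->
  measurable_fun [set: T] f.
Proof.
move=> mf.
suff H : g_sigma_preimage (fun i => coors i \o f) `<=` measurable.
  by move=> _ A mA; apply: H; rewrite g_sigma_preimage_comp; exists A.
apply: smallest_sub; first exact: sigma_algebra_measurable.
rewrite -bigcup_seq; apply: bigcup_sub => i Ii.
by move=> A [B mB <-]; exact: mf.
Qed.

End measurable_rV.

Section cons_rV.
Context {R : realType}.
Variable n : nat.

Definition cons_rV (p : measurableTypeR R * 'rV[R]_n) : 'rV[R]_n.+1 :=
  \row_i oapp (fun j => p.2 ord0 j) (p.1 : R) (unlift ord0 i).

Definition uncons_rV (x : 'rV[R]_n.+1) : measurableTypeR R * 'rV[R]_n :=
  (x ord0 ord0, \row_j x ord0 (lift ord0 j)).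

Lemma cons_rVK : cancel cons_rV uncons_rV.
Proof.
move=> [a y]; rewrite /uncons_rV/cons_rV mxE unlift_none/=; congr pair.
by apply/rowP => j; rewrite !mxE liftK.
Qed.

Lemma measurable_cons_rV : measurable_fun setT cons_rV.
Proof.
apply: measurable_fun_rVP => i.
rewrite (_ : _ \o _ = fun p : measurableTypeR R * 'rV[R]_n =>
    oapp (fun j : 'I_n => p.2 ord0 j : measurableTypeR R) p.1
      (unlift ord0 i)); last by apply/funext => p /=; rewrite mxE.
case: unliftP => [j _|_] /=; last exact: measurable_fst.
apply: (measurableT_comp (measurable_coor_rV j)).
exact: measurable_snd.
Qed.

Lemma measurable_uncons_rV : measurable_fun setT uncons_rV.
Proof.
apply: measurable_fun_pair; first exact: (measurable_coor_rV ord0).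
apply: measurable_fun_rVP => j.
rewrite (_ : _ \o _ = fun x : 'rV[R]_n.+1 => x ord0 (lift ord0 j)).
  exact: (measurable_coor_rV (lift ord0 j)).
by apply/funext => x /=; rewrite mxE.
Qed.

Variable mu : {sigma_finite_measure set 'rV[R]_n -> \bar R}.

Definition cons_measure : set 'rV[R]_n.+1 -> \bar R :=
  pushforward (lebesgue_measure \x mu)%E cons_rV.

HB.instance Definition _ := Measure.copy cons_measure
  (measure_function_pushforward__canonical__measure_function_Measure
     (lebesgue_measure \x mu)%E measurable_cons_rV).

Let cons_measure_sigma_finite : sigma_finite setT cons_measure.
Proof.
have /sigma_finiteP[F [TF ndF Foo]] := sigma_finiteT (@lebesgue_measure R).
have /sigma_finiteP[G [TG ndG Goo]] := sigma_finiteT mu.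
exists (fun k => uncons_rV @^-1` (F k `*` G k)).
  rewrite -preimage_bigcup (_ : \bigcup_k _ = setT) ?preimage_setT//.
  rewrite -subTset => -[a b] _ /=.
  have : setT a by []; rewrite TF => -[i _ Fia].
  have : setT b by []; rewrite TG => -[j _ Gjb].
  exists (maxn i j) => //; split.
  - by move: a Fia; exact/subsetPset/ndF/leq_maxl.
  - by move: b Gjb; exact/subsetPset/ndG/leq_maxr.
move=> k; have [mF Fk] := Foo k; have [mG Gk] := Goo k; split.
  rewrite -[X in measurable X]setTI.
  by apply: measurable_uncons_rV => //; exact: measurableX.
rewrite /cons_measure /pushforward -comp_preimage.
rewrite (_ : uncons_rV \o cons_rV = id) ?preimage_id; last first.
  by apply/funext => p /=; rewrite cons_rVK.
by rewrite product_measure1E// lte_mul_pinfty// ge0_fin_numE.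
Qed.

HB.instance Definition _ := Measure_isSigmaFinite.Build _ _ _ cons_measure
  cons_measure_sigma_finite.

End cons_rV.

Fixpoint lebesgue_rV {R : realType} (n : nat) :
    {sigma_finite_measure set 'rV[R]_n -> \bar R} :=
  if n is m.+1 then cons_measure (lebesgue_rV m) else dirac (0 : 'rV[R]_0).

Lemma lebesgue_rV_setX {R : realType} (n : nat)
    (A : 'I_n -> set (measurableTypeR R)) : (forall i, measurable (A i)) ->
  lebesgue_rV n [set x | forall i, A i (x ord0 i)] =
  (\prod_(i < n) lebesgue_measure (A i))%E.
Proof.
elim: n A => [|n IH] A mA.
  rewrite big_ord0 /= diracE (_ : _ \in _) //.
  by rewrite inE/=; case.
rewrite big_ord_recl -IH//.
rewrite [LHS]/= /cons_measure /pushforward -product_measure1E//.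
  congr (_ _); apply/seteqP; split => [[a b]/= H|[a b] /= [Ha Hb] i].
    split; first by have := H ord0; rewrite mxE unlift_none.
    by move=> i; have := H (lift ord0 i); rewrite mxE liftK.
  by rewrite mxE; case: unliftP => [j ->|->] //=; exact: Hb.
rewrite (_ : (fun x => _) = \bigcap_(i in [set: 'I_n])
    ((fun x : 'rV[R]_n => x ord0 i) @^-1` A (lift ord0 i))); last first.
  by apply/seteqP; split => x /= H i => [_|]; exact: H.
apply: fin_bigcap_measurable => // i _.
by rewrite -[X in measurable X]setTI; exact: measurable_coor_rV.
Qed.

Section magnetic.
Context {R : realType} {N : nat}.
Local Notation E := 'rV[R]_N.
Local Notation C := R[i].
Local Notation mu := (@lebesgue_rV R N).
Implicit Types (x y : E) (D : set E) (u v w : E -> C) (A B : E -> E).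

(* The library norm of 'rV[R]_N is the sup norm. *)
Definition enorm x : R := Num.sqrt (\sum_(i < N) x ord0 i ^+ 2).

Definition eball x (r : R) : set E := [set z | enorm (z - x) < r].

Definition cabs (z : C) : R := ComplexField.Normc.normc z.

Definition cis (t : R) : C := cos t +i* sin t.

Definition discretization (Xi : set E) : Prop :=
  [/\ Xi 0,
      exists2 d : R, 0 < d &
        forall x y, Xi x -> Xi y -> x <> y -> d <= enorm (x - y) &
      exists2 rho : R, 0 < rho &
        \bigcup_(xi in Xi) eball xi rho = setT /\
        exists m : nat, forall x,
          [set xi | Xi xi /\ eball xi rho x]%classic #<= `I_m].

Definition e_ (i : 'I_N) : E := delta_mx ord0 i.

Definition partial (i : 'I_N) (f : E -> R) : E -> R := fun x => 'D_(e_ i) f x.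

Fixpoint Ck (k : nat) (f : E -> R) : Prop :=
  if k is k'.+1 then
    forall i, (forall x, derivable f x (e_ i)) /\ Ck k' (partial i f)
  else continuous f.

Definition Cc_infty u : Prop :=
  (forall k, Ck k (fun x => complex.Re (u x))) /\
  (forall k, Ck k (fun x => complex.Im (u x))) /\
  compact (closure [set x | u x != 0]).

Definition cpartial (i : 'I_N) u : E -> C := fun x =>
  partial i (fun z => complex.Re (u z)) x +i*
  partial i (fun z => complex.Im (u z)) x.

Definition dotC1 A : Prop :=
  [/\ forall x, differentiable A x,
      continuous (fun x => 'J A x) &
      exists M : R, forall x, `|'J A x| <= M].

Definition cmeasurable u : Prop :=
  measurable_fun setT (fun x => complex.Re (u x)) /\
  measurable_fun setT (fun x => complex.Im (u x)).

Definition cintegral u : C :=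
  (\int[mu]_x complex.Re (u x)) +i* (\int[mu]_x complex.Im (u x)).

Definition intpow (p : R) u : \bar R := (\int[mu]_x (cabs (u x) `^ p)%:E)%E.

Definition sqL2 D u : \bar R := (\int[mu]_(x in D) (cabs (u x) ^+ 2)%:E)%E.

Definition loc_integrable u : Prop :=
  cmeasurable u /\
  forall r : R, (\int[mu]_(x in eball 0 r) (cabs (u x))%:E < +oo)%E.

Definition is_wgrad u (G : 'I_N -> E -> C) : Prop :=
  [/\ loc_integrable u, forall i, loc_integrable (G i) &
      forall phi, Cc_infty phi -> forall i,
        cintegral (fun x => u x * cpartial i phi x) =
        - cintegral (fun x => G i x * phi x)].

Definition has_wgrad u : Prop := exists G, is_wgrad u G.

Definition wgrad u : 'I_N -> E -> C :=
  if pselect (has_wgrad u) is left h then projT1 (cid h) else fun _ _ => 0.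

Definition mgrad A u : 'I_N -> E -> C :=
  fun i x => wgrad u i x + (0 +i* A x ord0 i) * u x.

(* +oo when the distributional gradient is not a function; otherwise well
   defined since weak gradients are a.e. unique. *)
Definition energy D A u : \bar R :=
  if `[< has_wgrad u >] then
    (\int[mu]_(x in D) (\sum_(i < N) cabs (mgrad A u i x) ^+ 2)%R%:E)%E
  else +oo%E.

Definition sqH1 D u : \bar R := (energy D (fun=> 0%R) u + sqL2 D u)%E.

Definition H1 u : Prop := cmeasurable u /\ (sqH1 setT u < +oo)%E.

Definition H1loc u : Prop :=
  cmeasurable u /\ forall r : R, (sqH1 (eball 0 r) u < +oo)%E.

Definition crit_exp : R := 2 * N%:R / (N%:R - 2).

(* For N >= 3 the completion of C_0^infty in the norm E_A^{1/2} embeds into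
   L^{2*} by the diamagnetic and Sobolev inequalities, which realizes its
   elements as functions. *)
Definition dotHA A u : Prop :=
  cmeasurable u /\
  exists phi : nat -> E -> C,
    [/\ forall j, Cc_infty (phi j),
        energy setT A (fun x => phi j x - u x) @[j --> \oo] --> 0%E &
        intpow crit_exp (fun x => phi j x - u x) @[j --> \oo] --> 0%E].

Definition HA A u : Prop := dotHA A u /\ (sqL2 setT u < +oo)%E.

Definition sqHA A u : \bar R := (energy setT A u + sqL2 setT u)%E.

(* Continuous linear functionals on the Frechet space H1loc, whose topology is
   given by the directed family of the norms of H^{1,2}(eball 0 r). *)
Definition H1loc_dual (l : (E -> C) -> C) : Prop :=
  (forall (a : C) u v, H1loc u -> H1loc v ->
     l (fun x => a * u x + v x) = a * l u + l v) /\
  exists r M : R, forall u, H1loc u ->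
    ((cabs (l u) ^+ 2)%:E <= M%:E * sqH1 (eball 0 r) u)%E.

Definition weak_cvg_H1loc (w : nat -> E -> C) v : Prop :=
  [/\ forall k, H1loc (w k), H1loc v &
      forall l, H1loc_dual l ->
        cabs (l (w k) - l v) @[k --> \oo] --> (0 : R)].

Definition unif_uncond_cvg (sq : (E -> C) -> \bar R)
    (f : nat -> nat -> E -> C) (S : nat -> E -> C) : Prop :=
  forall eps : R, 0 < eps -> exists F0 : {fset nat},
    forall F : {fset nat}, (F0 `<=` F)%fset -> forall k,
      (sq (fun x => \sum_(n <- F) f n k x - S k x)%R < eps%:E)%E.

Definition unif_uncond_cvg_H1 (f : nat -> nat -> E -> C)
    (S : nat -> E -> C) : Prop :=
  [/\ forall n k, H1 (f n k), forall k, H1 (S k) &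
      unif_uncond_cvg (sqH1 setT) f S].

Definition unif_uncond_cvg_H1loc (f : nat -> nat -> E -> C)
    (S : nat -> E -> C) : Prop :=
  [/\ forall n k, H1loc (f n k), forall k, H1loc (S k) &
      forall r : R, unif_uncond_cvg (sqH1 (eball 0 r)) f S].

Definition oriented_integral (f : R -> R) (a b : R) : R :=
  if a <= b then \int[lebesgue_measure]_(t in `[a, b]) f t
  else - \int[lebesgue_measure]_(t in `[b, a]) f t.

(* (y_1, ..., y_{n-1}, t, x_{n+1}, ..., x_N) *)
Definition splice y x (n : 'I_N) (t : R) : E :=
  \row_j (if (j < n)%N then y ord0 j else if j == n then t else x ord0 j).

Definition phase A (c : E -> R) y x : R :=
  if y == 0 then 0
  else c y - \sum_(n < N)
    oriented_integral (fun t => A (splice y x n t) ord0 n)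
      (y ord0 n) (x ord0 n).

Definition mshift A (c : E -> R) y u : E -> C :=
  fun x => cis (phase A c y x) * u (x - y).

Definition mshift_inv A (c : E -> R) y v : E -> C :=
  fun x => cis (- phase A c y (x + y)) * v (x + y).

Definition corrected_potential A (c : E -> R) y : E -> E :=
  fun x => A x + \row_i partial i (phase A c y) x.

Definition potential_at_infinity A (c : E -> R) (Y : nat -> E) B : Prop :=
  lipschitz B /\
  forall r eps : R, 0 < eps ->
    \forall k \near \oo, forall x, enorm x <= r ->
      enorm (corrected_potential A c (Y k) (x + Y k) - B x) < eps.

Record profile_decomposition A (c : E -> R) (u : nat -> E -> C)
    (v : nat -> E -> C) (y : nat -> nat -> E) : Prop := {
  pd_weak_limits : forall n,
    weak_cvg_H1loc (fun k => mshift_inv A c (y n k) (u k)) (v n) ;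
  pd_separation : forall n m, n <> m ->
    enorm (y n k - y m k) @[k --> \oo] --> +oo ;
  pd_abs_series : exists S,
    unif_uncond_cvg_H1 (fun n k x => (cabs (v n (x - y n k)))%:C) S ;
  pd_series : exists S,
    unif_uncond_cvg_H1loc (fun n k => mshift A c (y n k) (v n)) S /\
    forall p : R, 2 < p -> p < crit_exp ->
      intpow p (fun x => u k x - S k x) @[k --> \oo] --> 0%E ;
  pd_vanishing : forall Y : nat -> E,
    (forall n, enorm (Y k - y n k) @[k --> \oo] --> +oo) ->
    weak_cvg_H1loc (fun k => mshift_inv A c (Y k) (u k)) (fun=> 0) }.

End magnetic.

(* Main.v *)
Require Import Defs.
From mathcomp Require Import all_boot all_order all_algebra finmap.
From mathcomp Require Import complex ring lra.
From mathcomp Require Import all_classical all_reals all_analysis measurable_realfun.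
Set Implicit Arguments.
Unset Strict Implicit.
Unset Printing Implicit Defensive.
Import Order.TTheory GRing.Theory Num.Theory.
Import numFieldNormedType.Exports.
Local Open Scope classical_set_scope.
Local Open Scope ring_scope.

(** Everything rests on the observation that the profiles live in balls whose
    centres move infinitely far apart, so that quantities which are sums over
    space split into sums over profiles.

    For the two inequalities, the integral of [g ^ 2] is the supremum over test
    functions [phi] of the integral of [2 g phi - phi ^ 2]
    ([sqr_dual_test]), so it is lower semicontinuous under convergence against
    test functions, and already a ball of large radius carries almost all of
    it. Weak convergence in H1loc of the shifted functions
    [mshift_inv A c (y n k) (u k)] gives that convergence for the L2 norms. For
    the energies it must be proved for the shifted magnetic gradients: by gauge
    covariance ([gauge_covariance]) these are expressed through the shifted
    functions and the corrected potentials, which converge locally uniformly to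
    the potential at infinity. The balls around [y n k] are eventually
    disjoint, so the lower bounds obtained for finitely many profiles add up
    ([lsc_disjoint_balls], [lsc_profiles]). Gauge covariance holds because the
    phase is continuously differentiable, which is a computation with integrals
    of the potential along coordinate segments ([is_derive_path_integral]).

    For the convergence of the p-th moments, the remainder of the decomposition
    tends to 0 in L^p, so only the sum of the shifted profiles matters. The sum
    of the moduli of the profiles converges in H1, uniformly in [k]; by a
    subcritical Sobolev inequality ([sobolev_small]) its tails are small in L^p
    ([profile_tail]), which reduces the question to finitely many profiles.
    Truncated to balls, these have disjoint supports once [k] is large, and
    then the p-th moment of their sum is exactly the sum of their p-th moments
    ([moment_truncated_sum]). Errors are propagated by the elementary
    inequality [(a + b) ^ p <= (1 + t) a ^ p + C b ^ p] ([powRD_almost]).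

    Weak gradients are only used through two facts: an L2 bound on the
    increments of the function ([wderiv_translation]), from which the Sobolev
    inequality follows by estimating the measure of superlevel sets, and the
    validity of integration by parts against continuously differentiable
    functions of bounded support ([wderiv_C1]). *)


(** * Boxes and translations for Lebesgue measure *)

Section measure_theory_rV.
Context {R : realType} {N : nat}.
Local Notation E := 'rV[R]_N.
Local Notation mu := (@lebesgue_rV R N).
Implicit Types (x y z h a b : E).

Lemma measurable_box (A : 'I_N -> set (measurableTypeR R)) :
  (forall i, measurable (A i)) -> measurable [set x : E | forall i, A i (x ord0 i)].
Proof.
move=> mA; rewrite (_ : [set x | _] = \bigcap_(i in [set: 'I_N])
    ((fun x : E => x ord0 i) @^-1` A i)); last first.
  by apply/seteqP; split => x /= H i => [_|]; exact: H.
apply: fin_bigcap_measurable => // i _.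
by rewrite -[X in measurable X]setTI; exact: measurable_coor_rV.
Qed.

Definition ocbox a b : set E := [set x | forall i, x ord0 i \in `]a ord0 i, b ord0 i]].

Lemma measurable_ocbox a b : measurable (ocbox a b).
Proof. by apply: (@measurable_box (fun i => [set` `]a ord0 i, b ord0 i]])) => i. Qed.

Lemma ocboxI a b a' b' : ocbox a b `&` ocbox a' b' =
  ocbox (\row_i Num.max (a ord0 i) (a' ord0 i)) (\row_i Num.min (b ord0 i) (b' ord0 i)).
Proof.
apply/seteqP; split => x /=.
- move=> [H H'] i; have := H i; have := H' i.
  rewrite !in_itv/= !mxE gt_max le_min.
  by move=> /andP[-> ->] /andP[-> ->].
- move=> H; split=> i; have := H i;
    by rewrite !in_itv/= !mxE gt_max le_min => /andP[/andP[? ?] /andP[? ?]]; apply/andP.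
Qed.

Definition cube (m : R) : set E := ocbox (const_mx (- m)) (const_mx m).

Lemma bigcup_cube : \bigcup_(m : nat) cube m%:R = setT.
Proof.
rewrite -subTset => x _; have mx := archi_boundP (normr_ge0 x).
exists (Num.bound `|x|) => // i; rewrite in_itv/= !mxE.
have : `|x ord0 i| < (Num.bound `|x|)%:R.
  apply: le_lt_trans mx; rewrite [leRHS]mx_normrE.
  exact: (@le_bigmax _ _ _ 0%R (fun ij : 'I_1 * 'I_N => `|x ij.1 ij.2|) (ord0, i)).
by rewrite ltr_norml => /andP[-> /ltW].
Qed.

Definition ocboxes : set (set E) := [set B | exists a b, B = ocbox a b].

Lemma ocboxes_setI : setI_closed ocboxes.
Proof. by move=> _ _ [a [b ->]] [a' [b' ->]]; rewrite ocboxI; do 2 eexists. Qed.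

(** Boxes are stable under intersection and generate the Borel sets, so two
    measures agree as soon as they agree on boxes. *)
Lemma measurable_rVE : (measurable : set (set E)) = <<s ocboxes >>.
Proof.
apply/seteqP; split; last first.
  apply: smallest_sub; first exact: sigma_algebra_measurable.
  by move=> _ [a [b ->]]; exact: measurable_ocbox.
apply: smallest_sub; first exact: smallest_sigma_algebra.
rewrite -bigcup_seq; apply: bigcup_sub => i _ _ [B mB <-]; rewrite setTI.
have [S0 SC SU] := smallest_sigma_algebra [set: E] ocboxes.
pose H := [set B : set (measurableTypeR R) |
  <<s ocboxes >> ((fun x : E => x ord0 i) @^-1` B)].
suff : <<s (@ocitv R) >> `<=` H by apply; exact: mB.
apply: smallest_sub.
- split=> [|D HD|F HF]; rewrite /H/=.
  + by rewrite preimage_set0.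
  + by rewrite setTD preimage_setC -setTD; exact: SC.
  + by rewrite preimage_bigcup; exact: SU.
- move=> _ [[c d] _ <-]; rewrite /H/=.
  rewrite (_ : _ @^-1` _ = \bigcup_(m : nat)
     ocbox (\row_j if j == i then c else - m%:R) (\row_j if j == i then d else m%:R)).
    apply: SU => m; apply: sub_gen_smallest; do 2 eexists; reflexivity.
  apply/seteqP; split => [x /= xcd|x [m _ /(_ i)]]; last by rewrite /= !mxE eqxx.
  have : setT x by []; rewrite -bigcup_cube => -[m _ xm].
  exists m => // j; rewrite !mxE; case: eqVneq => [->//|_].
  by have := xm j; rewrite !mxE.
Qed.

Lemma lebesgue_ocbox a b : (forall i, a ord0 i <= b ord0 i) ->
  mu (ocbox a b) = (\prod_(i < N) (b ord0 i - a ord0 i))%:E.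
Proof.
move=> ab; rewrite (lebesgue_rV_setX (A := fun i => [set` `]a ord0 i, b ord0 i]]))//.
rewrite -prodEFin; apply: eq_bigr => i _; rewrite lebesgue_measure_itv/= lte_fin.
by have := ab i; rewrite le_eqVlt => /predU1P[->|->]; rewrite ?ltxx ?subrr ?EFinD.
Qed.

Lemma lebesgue_ocbox0 a b : ~ (forall i, a ord0 i <= b ord0 i) -> ocbox a b = set0.
Proof.
move=> ab; rewrite -subset0 => x abx; apply: ab => i.
by have := abx i; rewrite in_itv/= => /andP[/ltW ax]; exact: le_trans.
Qed.

Lemma lebesgue_cube_lty (m : R) : (mu (cube m) < +oo)%E.
Proof.
have [H|H] := pselect (forall i, (const_mx (- m) : E) ord0 i <= (const_mx m : E) ord0 i).
  by rewrite /cube lebesgue_ocbox// ltry.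
by rewrite /cube lebesgue_ocbox0// measure0.
Qed.

Lemma measurable_shift h : measurable_fun setT (fun x : E => x + h).
Proof.
apply: measurable_fun_rVP => i.
rewrite (_ : _ \o _ = fun x : E => (x ord0 i : measurableTypeR R) + h ord0 i); last first.
  by apply/funext => x /=; rewrite mxE.
by apply: measurable_funD => //; exact: measurable_coor_rV.
Qed.

Definition shift_measure h : {measure set E -> \bar R} :=
  measure_function_pushforward__canonical__measure_function_Measure mu (measurable_shift h).

(** A translated box has the same side lengths, and boxes determine the measure. *)
Lemma lebesgue_shift h A : measurable A ->
  pushforward mu (fun x : E => x + h) A = mu A.
Proof.
move=> mA; apply/esym.
apply: (measure_unique ocboxes (fun m : nat => cube m%:R)
  measurable_rVE ocboxes_setI _ bigcup_cube mu
  (shift_measure h)) => //.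
- by move=> m; do 2 eexists.
- move=> _ [a [b ->]]; transitivity (mu (ocbox (a - h) (b - h))); last first.
    congr (mu _); apply/seteqP; split => x /= H i; have := H i; rewrite !in_itv/= !mxE => /andP[? ?];
      apply/andP; split; lra.
  have [ab|ab] := pselect (forall i, a ord0 i <= b ord0 i).
    rewrite lebesgue_ocbox; last by move=> i; rewrite !mxE lerD2r.
    apply: etrans (lebesgue_ocbox ab) _.
    by congr (_%:E); apply: eq_bigr => i _; rewrite !mxE; ring.
  rewrite (lebesgue_ocbox0 ab) lebesgue_ocbox0 ?measure0// => H; apply: ab => i.
  by have := H i; rewrite !mxE lerD2r.
- by move=> k; exact: lebesgue_cube_lty.
Qed.

Lemma ge0_integral_shift h (f : E -> \bar R) : measurable_fun setT f ->
  (forall x, (0 <= f x)%E) -> (\int[mu]_x f (x + h)%R = \int[mu]_x f x)%E.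
Proof.
move=> mf f0.
have := @ge0_integral_pushforward _ _ _ _ R _ (measurable_shift h) mu setT f measurableT mf (fun y _ => f0 y).
rewrite preimage_setT => <-; transitivity (\int[shift_measure h]_y f y)%E => //.
apply: (eq_measure_integral (m1 := shift_measure h) mu) => A mA _; exact: lebesgue_shift.
Qed.

Lemma measurable_fun_shift d (T : measurableType d) h (f : E -> T) :
  measurable_fun setT f -> measurable_fun setT (fun x => f (x + h)).
Proof. by move=> mf; apply: (measurableT_comp mf); exact: measurable_shift. Qed.

Lemma integrable_shift h (f : E -> R) : mu.-integrable setT (EFin \o f) ->
  mu.-integrable setT (EFin \o (fun x => f (x + h))).
Proof.
move=> /integrableP[/measurable_EFinP mf fy]; apply/integrableP; split.
  by apply/measurable_EFinP; exact: measurable_fun_shift.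
rewrite [ltLHS](ge0_integral_shift h (f := fun x => (`|(f x)%:E|)%E))//.
by apply: measurableT_comp => //; exact/measurable_EFinP.
Qed.

(** Positive and negative parts are translated separately, so that the two sides
    also agree when the integral takes its default value. *)
Lemma Rint_shift h (f : E -> R) : measurable_fun setT f ->
  \int[mu]_x f (x + h) = \int[mu]_x f x.
Proof.
move=> mf; have mF : measurable_fun setT (EFin \o f) by exact/measurable_EFinP.
rewrite /Rintegral integralE [in RHS]integralE; congr (fine (_ - _)%E).
- rewrite -(ge0_integral_shift h (measurable_funepos mF) (fun x => funepos_ge0 _ x)).
  by apply: eq_integral => x _; rewrite !funeposE.
- rewrite -(ge0_integral_shift h (measurable_funeneg mF) (fun x => funeneg_ge0 _ x)).
  by apply: eq_integral => x _; rewrite !funenegE.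
Qed.

Lemma Rintegral_shift h (f : E -> R) : mu.-integrable setT (EFin \o f) ->
  \int[mu]_x f (x + h) = \int[mu]_x f x.
Proof. by move=> /integrableP[/measurable_EFinP mf _]; exact: Rint_shift. Qed.

Lemma normr_coor x i : `|x ord0 i| <= `|x|.
Proof.
rewrite [leRHS]mx_normrE.
exact: (@le_bigmax _ _ _ 0%R (fun ij : 'I_1 * 'I_N => `|x ij.1 ij.2|) (ord0, i)).
Qed.

Lemma normr_rV_le x (r : R) : 0 <= r -> (forall i, `|x ord0 i| <= r) -> `|x| <= r.
Proof.
move=> r0 H; rewrite [leLHS]mx_normrE; apply/bigmax_leP; split => // -[k i] _ /=.
by rewrite ord1.
Qed.

Lemma normr_rV_lt x (r : R) : 0 < r -> (forall i, `|x ord0 i| < r) -> `|x| < r.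
Proof.
move=> r0 H; rewrite [ltLHS]mx_normrE; apply/bigmax_ltP; split => // -[k i] _ /=.
by rewrite ord1.
Qed.

(** An open set is the union of the countably many rational cubes inside it. *)
Lemma open_measurable_rV (U : set E) : open U -> measurable U.
Proof.
move=> oU.
pose B (qm : 'rV[rat]_N * nat) : set E :=
  [set x : E | forall i, ball (ratr (qm.1 ord0 i) : R) qm.2.+1%:R^-1 (x ord0 i)].
have -> : U = \bigcup_(qm in [set: 'rV[rat]_N * nat]) (if `[< B qm `<=` U >] then B qm else set0).
  apply/seteqP; split => [x Ux|x [qm _]]; last by case: asboolP => // + Bx; exact.
  have /nbhs_ballP[e /= e0 xeU] : nbhs x U by exact: open_nbhs_nbhs.
  have [m me] : exists m, m.+1%:R^-1 < e / 2 :> R.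
    have := near_infty_natSinv_lt (PosNum (divr_gt0 e0 (ltr0n R 2))).
    by case=> m _ /(_ m (leqnn _)) /=; exists m.
  have /choice[q qP] : forall i, exists q : rat, ratr q \in `]x ord0 i - m.+1%:R^-1, x ord0 i + m.+1%:R^-1[.
    by move=> i; have /rat_in_itvoo[q ?] : x ord0 i - m.+1%:R^-1 < x ord0 i + m.+1%:R^-1 :> R;
      [rewrite ltrBlDr -addrA ltrDl addr_gt0// invr_gt0|exists q].
  exists (\row_i q i, m) => //; case: asboolP => [_|].
    move=> i; rewrite /ball/= mxE; have := qP i; rewrite in_itv/= => /andP[? ?].
    by rewrite ltr_distl; apply/andP.
  case=> z /= Bz; apply: xeU; rewrite mx_norm_ball /ball_ /=.
  apply: normr_rV_lt => // i; rewrite !mxE.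
  have := qP i; have := Bz i; rewrite /ball/= mxE in_itv/= => /[swap] /andP[].
  move: (m.+1%:R^-1 : R) me => d de; move: (ratr (q i) : R) => r ? ? + .
  rewrite !ltr_norml => /andP[? ?]; apply/andP; split; lra.
apply: countable_bigcupT_measurable => // qm; case: asboolP => // _.
by apply: (@measurable_box (fun i => ball (ratr (qm.1 ord0 i) : R) qm.2.+1%:R^-1)) => i; exact: measurable_ball.
Qed.

Lemma continuous_measurable_rV (f : E -> R) : continuous f -> measurable_fun setT f.
Proof.
move=> /continuousP cf; apply: (measurability _ (RGenOpens.measurableE R)).
move=> _ [_ [a [b ->] <-]]; rewrite setTI; apply: open_measurable_rV.
by apply: cf; exact: interval_open.
Qed.

End measure_theory_rV.

(** * Directional derivatives and smooth functions *)

Section directional_derivatives.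
Context {R : realType}.

Lemma is_derive_line (V : normedModType R) (f : V -> R) (x v : V) (s d : R) :
  is_derive (s *: v + x) v f d -> is_derive s 1 (fun t : R => f (t *: v + x)) d.
Proof.
have E : (fun h : R => h^-1 *: ((f \o shift (s *: v + x)) (h *: v) - f (s *: v + x)))
   = (fun h : R => h^-1 *: (((fun t : R => f (t *: v + x)) \o shift s) (h *: 1) - f (s *: v + x))).
  by apply/funext => h; rewrite /= scalerDl addrA [h%:A]mulr1.
case; rewrite /derivable /derive /= => cf fd.
by apply: DeriveDef; rewrite /derivable /derive /= -E.
Qed.

(** A directional derivative is an ordinary derivative along a line, which
    reduces its calculus to one real variable. *)
Lemma is_derive_from_line (V : normedModType R) (f : V -> R) (x v : V) (d : R) :
  is_derive (0 : R) (1 : R) (fun t : R => f (t *: v + x)) d -> is_derive x v f d.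
Proof.
have E : (fun h : R => h^-1 *: ((f \o shift x) (h *: v) - f x))
   = (fun h : R => h^-1 *: (((fun t : R => f (t *: v + x)) \o shift 0) (h *: 1) - f (0 *: v + x))).
  by apply/funext => h; rewrite /= addr0 scale0r add0r [h%:A]mulr1.
case; rewrite /derivable /derive /= => cf fd.
by apply: DeriveDef; rewrite /derivable /derive /= E.
Qed.

Lemma is_derive_shift_rV (V : normedModType R) (f : V -> R) (x v z : V) (d : R) :
  is_derive (x + z) v f d -> is_derive x v (fun y => f (y + z)) d.
Proof.
have E : (fun h : R => h^-1 *: ((f \o shift (x + z)) (h *: v) - f (x + z)))
   = (fun h : R => h^-1 *: (((fun t => f (t + z)) \o shift x) (h *: v) - f (x + z))).
  by apply/funext => h; rewrite /= addrA.
case; rewrite /derivable /derive /= => cf fd.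
by apply: DeriveDef; rewrite /derivable /derive /= -E.
Qed.

Lemma is_derive_comp_line (V : normedModType R) (g : R -> R) (f : V -> R) (x v : V) (d e : R) :
  is_derive (f x) 1 g e -> is_derive x v f d -> is_derive x v (g \o f) (e * d).
Proof.
move=> ge fd; apply: is_derive_from_line.
have := @is_derive1_comp R g (fun t : R => f (t *: v + x)) 0 e d.
rewrite scale0r add0r => -/(_ ge); apply.
by apply: is_derive_line; rewrite scale0r add0r.
Qed.

(** The mean value inequality, for which only the derivative in the direction of
    the segment matters. *)
Lemma le_increment_line (V : normedModType R) (f df : V -> R) (x v : V) (t L : R) :
  (forall s : R, is_derive (s *: v + x) v f (df (s *: v + x))) ->
  (forall s : R, `|s| <= `|t| -> `|df (s *: v + x)| <= L) ->
  `|f (t *: v + x) - f x| <= L * `|t|.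
Proof.
move=> fd dL.
pose g (s : R) := f (s *: v + x).
have gd (s : R) : is_derive s 1 g (df (s *: v + x)) by apply: is_derive_line.
have cg A : {within A, continuous g}.
  apply: continuous_subspaceT => s.
  by apply: differentiable_continuous; apply/derivable1_diffP; case: (gd s).
have g0 : f x = g 0 by rewrite /g scale0r add0r.
rewrite g0 -/(g t); have [t0|t0] := leP 0 t.
  have [s st ->] := @MVT_segment R g (fun s => df (s *: v + x)) 0 t t0 (fun x _ => gd x) (cg _).
  rewrite subr0 normrM ler_wpM2r// dL//.
  by move: st; rewrite in_itv/= => /andP[s0 st]; rewrite !ger0_norm.
have [s st E] := @MVT_segment R g (fun s => df (s *: v + x)) t 0 (ltW t0) (fun x _ => gd x) (cg _).
rewrite distrC E sub0r normrM normrN ler_wpM2r// dL//.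
by move: st; rewrite in_itv/= => /andP[s0 st]; rewrite !ler0_norm// ?lerN2// ltW.
Qed.

End directional_derivatives.

Section continuity.
Context {R : realType} {T : topologicalType}.

Lemma continuous_add (V : normedModType R) (f g : T -> V) :
  continuous f -> continuous g -> continuous (fun x => f x + g x).
Proof. by move=> cf cg x; exact: (cvgD (cf x) (cg x)). Qed.

Lemma continuous_mul (f g : T -> R) :
  continuous f -> continuous g -> continuous (fun x => f x * g x).
Proof. by move=> cf cg x; exact: (cvgM (cf x) (cg x)). Qed.

Lemma continuous_sub (V : normedModType R) (f g : T -> V) :
  continuous f -> continuous g -> continuous (fun x => f x - g x).
Proof. by move=> cf cg x; exact: (cvgB (cf x) (cg x)). Qed.

End continuity.

Lemma continuous_shift (R : realType) (V : normedModType R) (z : V) : continuous (fun x => x + z).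
Proof. apply: (@continuous_add R V V id (cst z)); first by move=> x; exact: cvg_id. exact: cst_continuous. Qed.

Section smooth_functions.
Context {R : realType} {N : nat}.
Local Notation E := 'rV[R]_N.
Implicit Types (f g : E -> R) (x y z : E).

Definition smooth f := forall k, Ck k f.

Lemma smooth_continuous f : smooth f -> continuous f.
Proof. by move=> /(_ 0%N). Qed.

Lemma smooth_is_derive f i x : smooth f -> is_derive x (e_ i) f (partial i f x).
Proof. by move=> /(_ 1%N)/(_ i)[/(_ x) df _]; apply: derivableP. Qed.

Lemma smooth_partial f i : smooth f -> smooth (partial i f).
Proof. by move=> sf k; have [] := sf k.+1 i. Qed.

Lemma partialE f i x d : is_derive x (e_ i) f d -> partial i f x = d.
Proof. by move=> [_ <-]. Qed.

Lemma CkS k f (df : 'I_N -> E -> R) : (forall i x, is_derive x (e_ i) f (df i x)) ->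
  (forall i, Ck k (df i)) -> Ck k.+1 f.
Proof.
move=> fd dfk i; split=> [x|]; first by case: (fd i x).
by rewrite (_ : partial i f = df i); [exact: dfk|apply/funext => x; exact: partialE].
Qed.

Lemma CkD k f g : Ck k f -> Ck k g -> Ck k (fun x => f x + g x).
Proof.
elim: k f g => [f g|k IH f g fk gk].
  exact: continuous_add.
apply: (@CkS _ _ (fun i x => partial i f x + partial i g x)) => [i x|i].
  by apply: is_deriveD; apply: derivableP; [have [] := fk i|have [] := gk i].
by apply: IH; [have [] := fk i|have [] := gk i].
Qed.

Lemma smoothD f g : smooth f -> smooth g -> smooth (fun x => f x + g x).
Proof. by move=> sf sg k; exact: CkD. Qed.

Lemma smoothM f g : smooth f -> smooth g -> smooth (fun x => f x * g x).
Proof.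
move=> sf sg k; elim: k f g sf sg => [f g sf sg x|k IH f g sf sg].
  exact: (continuous_mul (smooth_continuous sf) (smooth_continuous sg)).
apply: (@CkS _ _ (fun i x => f x * partial i g x + g x * partial i f x)) => [i x|i].
  by apply: is_deriveM; exact: smooth_is_derive.
by apply: CkD; apply: IH => //; exact: smooth_partial.
Qed.

Lemma smooth_cst (c : R) : smooth (fun=> c).
Proof.
move=> k; elim: k c => [c x|k IH c]; first exact: cst_continuous.
by apply: (@CkS _ _ (fun _ _ => 0)) => i; exact: IH.
Qed.

Lemma smoothZ (c : R) f : smooth f -> smooth (fun x => c * f x).
Proof. by move=> sf; apply: smoothM => //; exact: smooth_cst. Qed.

Lemma smooth_shift z f : smooth f -> smooth (fun x => f (x + z)).
Proof.
move=> sf k; elim: k f sf => [f sf x|k IH f sf].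
  apply: (@continuous_comp _ _ _ (fun x => x + z) f); last exact: smooth_continuous.
  exact: continuous_shift.
apply: (@CkS _ _ (fun i x => partial i f (x + z))) => [i x|i].
  by apply: is_derive_shift_rV; exact: smooth_is_derive.
by apply: IH; exact: smooth_partial.
Qed.

Lemma smooth_prod (I : Type) (s : seq I) (F : I -> E -> R) :
  (forall i, smooth (F i)) -> smooth (fun x => \prod_(i <- s) F i x).
Proof.
move=> sF; elim: s => [|i s IH].
  rewrite (_ : (fun x => _) = fun=> 1); first exact: smooth_cst.
  by apply/funext => x; rewrite big_nil.
rewrite (_ : (fun x => _) = fun x => F i x * \prod_(i <- s) F i x); first exact: smoothM.
by apply/funext => x; rewrite big_cons.
Qed.

(** All successive derivatives are listed at once: smoothness of composites then
    needs no closed form for the iterated derivatives. *)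
Definition derivative_chain (F : nat -> R -> R) :=
  forall (k : nat) (s : R), is_derive s 1 (F k) (F k.+1 s).

Lemma is_derive_coor x i j : is_derive x (e_ j) (fun y : E => y ord0 i) ((i == j)%:R).
Proof.
apply: is_derive_from_line.
rewrite (_ : (fun t => _) = fun t : R => t * (i == j)%:R + x ord0 i); last first.
  by apply/funext => t; rewrite /e_ !mxE eqxx /= eq_sym.
have H1 : is_derive (0 : R) (1 : R) (fun t : R => t * (i == j)%:R) (i == j)%:R.
  have := @is_deriveM R R (fun t : R => t) (fun=> (i == j)%:R) 0 1 1 0
    (is_derive_id _ _) (is_derive_cst _ _ _).
  by rewrite scaler0 add0r /GRing.scale/= mulr1.
have := @is_deriveD R R R (fun t : R => t * (i == j)%:R) (fun=> x ord0 i) 0 1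
  (i == j)%:R 0 H1 (is_derive_cst _ _ _).
by rewrite addr0.
Qed.

Lemma smooth_comp_coor F i : derivative_chain F -> smooth (fun x => F 0%N (x ord0 i)).
Proof.
suff H k n : derivative_chain F -> Ck k (fun x : E => F n (x ord0 i)) by move=> dF k; exact: H.
move=> dF; elim: k n => [n x|k IH n].
  apply: (@continuous_comp _ _ _ (fun x : E => x ord0 i) (F n)).
    exact: coord_continuous.
  by apply: differentiable_continuous; apply/derivable1_diffP; case: (dF n (x ord0 i)).
apply: (@CkS _ _ (fun j x => (i == j)%:R * F n.+1 (x ord0 i))) => [j x|j].
  rewrite mulrC; apply: (@is_derive_comp_line _ _ (F n) (fun x : E => x ord0 i)) => //.
  exact: is_derive_coor.
case: eqP => _; last by rewrite (_ : (fun x => _) = fun=> 0) ?mul0r//;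
  [exact: smooth_cst|apply/funext => x; rewrite mul0r].
by rewrite (_ : (fun x => _) = fun x => F n.+1 (x ord0 i)) //; apply/funext => x; rewrite mul1r.
Qed.

End smooth_functions.

(** * Smooth functions of bounded support *)

Section flat_function.
Context {R : realType}.
Implicit Types (P : {poly R}) (s t : R).

(** The functions [P (1/s) exp (- 1/s)], extended by 0 to [s <= 0], form a class
    closed under differentiation. *)
Definition flat P s : R := if 0 < s then P.[s^-1] * expR (- s^-1) else 0.

Lemma horner_expRN_bounded P : exists2 C : R, 0 <= C &
  forall t, 0 <= t -> `|P.[t]| * expR (- t) <= C.
Proof.
have mono n t : 0 <= t -> t ^+ n * expR (- t) <= n`!%:R.
  move=> t0; rewrite expRN ler_pdivrMr ?expR_gt0//.
  case: n => [|n]; first by rewrite expr0 fact0 mul1r -expR0 ler_expR.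
  have f0 : 0 < (n.+1)`!%:R :> R by rewrite ltr0n fact_gt0.
  rewrite -ler_pdivrMl// mulrC; apply: le_trans (expR_ge1Dxn n t0).
  by rewrite lerDr.
exists (\sum_(i < size P) `|P`_i| * i`!%:R).
  by apply: sumr_ge0 => i _; rewrite mulr_ge0.
move=> t t0; rewrite horner_coef.
apply: (@le_trans _ _ ((\sum_(i < size P) `|P`_i| * t ^+ i) * expR (- t))).
  rewrite ler_wpM2r ?expR_ge0//; apply: le_trans (ler_norm_sum _ _ _) _.
  by apply: ler_sum => i _; rewrite normrM [ `|t ^+ i|]ger0_norm// exprn_ge0.
rewrite mulr_suml; apply: ler_sum => i _.
by rewrite -mulrA ler_wpM2l// mono.
Qed.

(** A quadratic bound gives derivative 0 at the point where the two branches of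
    the definition meet. *)
Lemma flat_quadratic P : exists2 C : R, 0 <= C & forall s, `|flat P s| <= C * s ^+ 2.
Proof.
have [C C0 PC] := horner_expRN_bounded (P * 'X^2).
exists C => // s; rewrite /flat; case: ifPn => [s0|_]; last first.
  by rewrite normr0 mulr_ge0// sqr_ge0.
have /PC : 0 <= s^-1 by rewrite invr_ge0 ltW.
rewrite hornerM hornerXn normrM [ `|s^-1 ^+ 2|]ger0_norm ?exprn_ge0 ?invr_ge0 ?(ltW s0)//.
rewrite -mulrA (mulrC (_ ^+ 2)) mulrA exprVn ler_pdivrMr ?exprn_gt0//.
by rewrite normrM [ `|expR _|]ger0_norm ?expR_ge0.
Qed.

Definition flat_deriv P := (P - P^`()) * 'X^2.

Lemma is_derive_flat P s : is_derive s 1 (flat P) (flat (flat_deriv P) s).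
Proof.
have [s0|s0|->] := ltgtP s 0.
- rewrite [flat (flat_deriv P) s]/flat ltNge (ltW s0)/=; apply: (@near_eq_is_derive _ _ _ (fun=> 0)).
    have : \forall x \near s, x < 0 by exact: lt_nbhsl.
    by apply: filterS => x x0; rewrite /flat ltNge (ltW x0).
- rewrite [flat (flat_deriv P) s]/flat s0; apply: (@near_eq_is_derive R R R (fun x : R => P.[x^-1] * expR (- x^-1))).
    have : \forall x \near s, 0 < x by exact: lt_nbhsr.
    by apply: filterS => x x0; rewrite /flat x0.
  have s00 : s != 0 by rewrite gt_eqF.
  have Hi : is_derive s 1 (fun x : R => x^-1) (- s ^- 2).
    by have := is_deriveV s00 (is_derive_id s 1); rewrite /GRing.scale/= mulr1.
  have H1 : is_derive s 1 (fun x : R => P.[x^-1]) (P^`().[s^-1] * (- s ^- 2)).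
    exact: (@is_derive1_comp R (horner P) (fun x : R => x^-1) s).
  have H2 : is_derive s 1 (fun x : R => expR (- x^-1)) (expR (- s^-1) * (s ^- 2)).
    apply: (@is_derive1_comp R expR (fun x : R => - x^-1) s).
    rewrite -[s ^- 2]opprK; exact: is_deriveN.
  apply: (is_derive_eq (is_deriveM H1 H2)).
  rewrite /flat_deriv hornerM hornerXn hornerD hornerN exprVn.
  rewrite -![_ *: _]/(_ * _); ring.
- rewrite [flat (flat_deriv P) 0]/flat ltxx; have [C C0 PC] := flat_quadratic P.
  have f0 : flat P 0 = 0 by rewrite /flat ltxx.
  suff H : (fun h : R => h^-1 *: ((flat P \o shift 0) (h *: 1) - flat P 0)) @ 0^' --> (0 : R).
    by apply: DeriveDef; [apply/cvg_ex; exists 0|apply/cvg_lim].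
  have C1 : 0 < C + 1 by rewrite ltr_wpDl.
  apply/cvgr0Pnorm_le => e e0; near=> h.
  have h0 : h != 0 by near: h; exact: nbhs_dnbhs_neq.
  rewrite /= f0 subr0 addr0 [h%:A]mulr1 normrM normfV ler_pdivrMl ?normr_gt0//.
  apply: le_trans (PC _) _; rewrite -real_normK ?num_real// expr2 mulrCA.
  rewrite ler_wpM2l//; apply: (@le_trans _ _ ((C + 1) * `|h|)).
    by rewrite ler_wpM2r// lerDl.
  rewrite -ler_pdivlMl// mulrC; near: h.
  by apply: dnbhs0_le; rewrite divr_gt0.
Unshelve. all: end_near. Qed.

End flat_function.

Section test_functions.
Context {R : realType} {N : nat}.
Local Notation E := 'rV[R]_N.
Implicit Types (f g phi : E -> R) (x y z a b : E).

Definition fl (s : R) : R := flat 1 s.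

Lemma flE s : fl s = if 0 < s then expR (- s^-1) else 0.
Proof. by rewrite /fl /flat hornerC; case: ifP => // _; rewrite mul1r. Qed.

Lemma fl_ge0 s : 0 <= fl s.
Proof. by rewrite flE; case: ifP => // _; exact: expR_ge0. Qed.

Lemma fl_le1 s : fl s <= 1.
Proof.
rewrite flE; case: ifP => // s0.
by rewrite expR_le1 oppr_le0 invr_ge0 ltW.
Qed.

Lemma fl_eq0 s : s <= 0 -> fl s = 0.
Proof. by rewrite flE leNgt => /negbTE ->. Qed.

Lemma fl_cvg1 (u : nat -> R) : u n @[n --> \oo] --> +oo -> fl (u n) @[n --> \oo] --> (1 : R).
Proof.
move=> uoo; rewrite (_ : 1 = expR (- 0)); last by rewrite oppr0 expR0.
have u0 : \forall n \near \oo, 0 < u n by move/cvgryPgt : uoo; exact.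
apply: (@cvg_trans _ ((fun n => expR (- (u n)^-1)) @ \oo)).
  by apply: near_eq_cvg; apply: filterS u0 => n un0; rewrite flE un0.
have H : (- (u n)^-1) @[n --> \oo] --> (- 0 : R) by apply: cvgN; apply/gtr0_cvgV0.
exact: (cvg_comp _ _ H (@continuous_expR R (- 0))).
Qed.

Definition affine_chain (m c : R) (F : nat -> R -> R) (k : nat) (s : R) : R :=
  m ^+ k * F k (m * s + c).

Lemma affine_chainP m c F : derivative_chain F -> derivative_chain (affine_chain m c F).
Proof.
move=> dF k s; rewrite /affine_chain.
have H : is_derive s 1 (fun s : R => m * s + c) m.
  have H1 := is_deriveZ m (is_derive_id s (1 : R)).
  apply: (is_derive_eq (is_deriveD H1 (is_derive_cst c s 1))).
  by rewrite addr0 [_ *: _]mulr1.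
have := is_deriveZ (m ^+ k) (@is_derive1_comp R (F k) (fun s : R => m * s + c) s _ _ (dF k _) H).
move=> /is_derive_eq; apply; rewrite -[_ *: _]/(_ * _) exprS; ring.
Qed.

Lemma flat_chain : derivative_chain (fun k => flat (iter k flat_deriv (1 : {poly R}))).
Proof. by move=> k s; exact: is_derive_flat. Qed.

Lemma smooth_fl_coor m c i : smooth (fun x : E => fl (m * x ord0 i + c)).
Proof.
have := @smooth_comp_coor R N _ i (affine_chainP m c flat_chain).
by congr smooth; apply/funext => x; rewrite /affine_chain expr0 mul1r.
Qed.

Definition test phi := smooth phi /\ exists r : R, forall x, r < `|x| -> phi x = 0.

(** A smooth approximation of the indicator of a half-open box. For large [m] the
    first factor tends to the indicator of [x_i > a_i]. In the second one the
    argument has leading term [m ^ 2 (b_i - x_i)], which decides the limit when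
    [x_i] differs from [b_i]; at [x_i = b_i] it equals [m.+1] and still diverges,
    so that the end point belongs to the limiting box. *)
Definition bump (a b : E) (m : nat) : E -> R := fun x =>
  \prod_(i < N) (fl (m.+1%:R * (x ord0 i - a ord0 i)) *
    fl (m.+1%:R ^+ 2 * (b ord0 i - x ord0 i) + m.+1%:R)).

Lemma bump_ge0 a b m x : 0 <= bump a b m x.
Proof. by apply: prodr_ge0 => i _; rewrite mulr_ge0 ?fl_ge0. Qed.

Lemma bump_le1 a b m x : bump a b m x <= 1.
Proof.
apply: (@le_trans _ _ (\prod_(i < N) (1 : R))); last by rewrite big1_eq.
apply: ler_prod => i _; rewrite mulr_ge0 ?fl_ge0//=.
by rewrite mulr_ile1 ?fl_ge0 ?fl_le1.
Qed.

Lemma smooth_bump a b m : smooth (bump a b m).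
Proof.
apply: smooth_prod => i; apply: smoothM.
  have := smooth_fl_coor m.+1%:R (- (m.+1%:R * a ord0 i)) i.
  by congr smooth; apply/funext => x; congr fl; ring.
have := smooth_fl_coor (- m.+1%:R ^+ 2) (m.+1%:R ^+ 2 * b ord0 i + m.+1%:R) i.
by congr smooth; apply/funext => x; congr fl; ring.
Qed.

Lemma notin_ocbox a b x : ~ ocbox a b x ->
  exists i, (x ord0 i <= a ord0 i) || (b ord0 i < x ord0 i).
Proof.
move=> abx; apply: contrapT => /forallNP H; apply: abx => i.
by have /negP := H i; rewrite negb_or -ltNge -leNgt in_itv/=.
Qed.

Lemma bump_eq0 a b m x : ~ ocbox a (b + const_mx 1) x -> bump a b m x = 0.
Proof.
move=> /notin_ocbox; case=> i; rewrite !mxE => ab.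
apply/eqP; rewrite prodf_seq_eq0; apply/hasP; exists i; first by rewrite mem_index_enum.
apply/eqP => /=; have m0 : 0 < m.+1%:R :> R by [].
case/orP : ab => [xa|bx].
  by rewrite fl_eq0 ?mul0r// pmulr_rle0// subr_le0.
rewrite [X in _ * X]fl_eq0 ?mulr0// expr2 -mulrA -[X in _ + X]mulr1 -mulrDr pmulr_rle0//.
have m1 : 1 <= m.+1%:R :> R by rewrite ler1n.
by move: (m.+1%:R : R) m1 => M M1; nra.
Qed.

Lemma bump_cvg a b x : bump a b m x @[m --> \oo] --> (\1_(ocbox a b) x : R).
Proof.
have moo : (m.+1%:R : R) @[m --> \oo] --> +oo.
  by rewrite (cvg_shiftS (fun m => m%:R : R)); exact: cvgr_idn.
have [abx|abx] := pselect (ocbox a b x).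
  rewrite indicE mem_set// (_ : true%:R = \prod_(i < N) (1 : R)); last by rewrite big1_eq.
  apply: cvg_big => [|i _]; first exact: mul_continuous.
  have := abx i; rewrite in_itv/= => /andP[ax xb].
  have H1 : fl (m.+1%:R * (x ord0 i - a ord0 i)) @[m --> \oo] --> (1 : R).
    have xa : 0 < x ord0 i - a ord0 i by rewrite subr_gt0.
    apply: fl_cvg1; apply/cvgryPge => A; move/cvgryPge : moo => /(_ (A / (x ord0 i - a ord0 i))).
    by apply: filterS => m; rewrite ler_pdivrMr.
  have H2 : fl (m.+1%:R ^+ 2 * (b ord0 i - x ord0 i) + m.+1%:R) @[m --> \oo] --> (1 : R).
    apply: fl_cvg1; apply: (ger_cvgy _ moo); near=> m.
    by rewrite lerDr mulr_ge0 ?sqr_ge0 ?subr_ge0.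
  by have H := cvgM H1 H2; rewrite mulr1 in H; exact: H.
rewrite indicE memNset//=.
suff : \forall m \near \oo, bump a b m x = 0.
  by move=> H; apply: (@cvg_trans _ ((fun=> 0) @ \oo)); [apply: near_eq_cvg; apply: filterS H => m ->|exact: cvg_cst].
move: abx => /notin_ocbox; case=> i ab.
have : \forall m \near \oo, (b ord0 i - x ord0 i < 0 -> (b ord0 i - x ord0 i)^-1 * -1 <= m.+1%:R).
  by move/cvgryPge : moo => /(_ ((b ord0 i - x ord0 i)^-1 * -1)); apply: filterS => m + _.
apply: filterS => m mP.
apply/eqP; rewrite prodf_seq_eq0; apply/hasP; exists i; first by rewrite mem_index_enum.
apply/eqP => /=; have m0 : 0 < m.+1%:R :> R by [].
case/orP : ab => [xa|bx].
  by rewrite fl_eq0 ?mul0r// pmulr_rle0// subr_le0.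
have bx0 : b ord0 i - x ord0 i < 0 by rewrite subr_lt0.
rewrite [X in _ * X]fl_eq0 ?mulr0// expr2 -mulrA -[X in _ + X]mulr1 -mulrDr pmulr_rle0//.
by move: (mP bx0); rewrite ler_ndivrMl// => H; rewrite -lerBrDr sub0r mulrC.
Unshelve. all: end_near. Qed.

Lemma ocbox_bounded a b : exists r : R, forall x, ocbox a b x -> `|x| <= r.
Proof.
exists (`|a| + `|b|) => x abx; apply: normr_rV_le => [|i]; first by rewrite addr_ge0.
have := abx i; rewrite in_itv/= => /andP[ax xb].
have := normr_coor a i; have := normr_coor b i.
have := normr_ge0 a; have := normr_ge0 b.
move: `|a| `|b| => c d; rewrite !ler_norml => ? ? /andP[? ?] /andP[? ?].
by apply/andP; split; lra.
Qed.

Lemma test_bump a b m : test (bump a b m).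
Proof.
split; first exact: smooth_bump.
have [r rP] := ocbox_bounded a (b + const_mx 1).
exists r => x rx; apply: bump_eq0 => /rP; lra.
Qed.

(** The profile of the mollifiers, positive exactly inside the cube of half-side [d]. *)
Definition hat (d : R) : E -> R := fun x =>
  \prod_(i < N) (fl (1 * x ord0 i + d) * fl (-1 * x ord0 i + d)).

Lemma hat_ge0 d x : 0 <= hat d x.
Proof. by apply: prodr_ge0 => i _; rewrite mulr_ge0 ?fl_ge0. Qed.

Lemma hat_eq0 d x : 0 < d -> d <= `|x| -> hat d x = 0.
Proof.
move=> d0 dx; suff [i ix] : exists i, d <= `|x ord0 i|.
  apply/eqP; rewrite prodf_seq_eq0; apply/hasP; exists i; first by rewrite mem_index_enum.
  apply/eqP => /=; move: ix; rewrite ler_normr => /orP[ix|ix].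
    by rewrite [X in _ * X]fl_eq0 ?mulr0//; lra.
  by rewrite fl_eq0 ?mul0r//; lra.
apply: contrapT => /forallNP H; move: dx; apply/negP; rewrite -ltNge.
by apply: normr_rV_lt => // i; rewrite ltNge; apply/negP/H.
Qed.

Lemma test_hat d : 0 < d -> test (hat d).
Proof.
move=> d0; split; last by exists d => x /ltW; exact: hat_eq0.
by apply: smooth_prod => i; apply: smoothM; exact: smooth_fl_coor.
Qed.

End test_functions.

(** * Integrals of real functions and local integrability *)

Lemma Rdominated_cvg (R : realType) d (T : measurableType d) (m : {measure set T -> \bar R})
    (F : nat -> T -> R) (f g : T -> R) :
  (forall n, measurable_fun setT (F n)) ->
  (forall x, F n x @[n --> \oo] --> f x) -> m.-integrable setT (EFin \o g) ->
  (forall n x, `|F n x| <= g x) ->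
  m.-integrable setT (EFin \o f) /\ \int[m]_x F n x @[n --> \oo] --> \int[m]_x f x.
Proof.
move=> mF Ff gi Fg.
have mf : measurable_fun setT f by apply: measurable_fun_cvg mF _ => x _; exact: Ff.
have [fi _ Fcvg] : [/\ m.-integrable setT (EFin \o f),
    (\int[m]_x `|(F n x)%:E - (f x)%:E|)%E @[n --> \oo] --> 0%E &
    (\int[m]_x (F n x)%:E)%E @[n --> \oo] --> (\int[m]_x (f x)%:E)%E].
  apply: (@dominated_convergence _ _ _ m setT measurableT (fun n => EFin \o F n)
    (EFin \o f) (EFin \o g)) => //.
  - by move=> n; exact/measurable_EFinP.
  - exact/measurable_EFinP.
  - by apply: aeW => x _; apply/cvg_EFin => //; [exact: nearW|exact: Ff].
  - by apply: aeW => x n _; rewrite /= lee_fin.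
split => //; apply: fine_cvg; rewrite fineK//; exact: integrable_fin_num.
Qed.

Section real_integrals.
Context {R : realType} {N : nat}.
Local Notation E := 'rV[R]_N.
Local Notation mu := (@lebesgue_rV R N).
Implicit Types (f g phi psi : E -> R) (x y z a b : E).

Definition intg f := mu.-integrable setT (EFin \o f).

Lemma intg_measurable f : intg f -> measurable_fun setT f.
Proof. by case/integrableP => /measurable_EFinP. Qed.

Lemma intgD f g : intg f -> intg g -> intg (fun x => f x + g x).
Proof. by move=> fi gi; exact: (integrableD measurableT fi gi). Qed.

Lemma intgB f g : intg f -> intg g -> intg (fun x => f x - g x).
Proof. by move=> fi gi; exact: (integrableB measurableT fi gi). Qed.

Lemma intgZ (c : R) f : intg f -> intg (fun x => c * f x).
Proof. by move=> fi; exact: (integrableZl measurableT c fi). Qed.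

Lemma intgN f : intg f -> intg (fun x => - f x).
Proof. by move=> /(intgZ (-1)); under eq_fun do rewrite mulN1r. Qed.

Lemma intg_norm f : intg f -> intg (fun x => `|f x|).
Proof. by move=> /integrable_norm. Qed.

Lemma intg_le f g : measurable_fun setT f -> (forall x, `|f x| <= g x) ->
  intg g -> intg f.
Proof.
move=> mf fg gi; apply: (le_integrable measurableT) gi => [|x _].
  exact/measurable_EFinP.
by rewrite /= lee_fin (le_trans (fg x))// ler_norm.
Qed.

Lemma RintD f g : intg f -> intg g ->
  \int[mu]_x (f x + g x) = \int[mu]_x f x + \int[mu]_x g x.
Proof. by move=> fi gi; exact: RintegralD. Qed.

Lemma RintB f g : intg f -> intg g ->
  \int[mu]_x (f x - g x) = \int[mu]_x f x - \int[mu]_x g x.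
Proof. by move=> fi gi; exact: RintegralB. Qed.

Lemma RintZ (c : R) f : intg f -> \int[mu]_x (c * f x) = c * \int[mu]_x f x.
Proof. by move=> fi; exact: RintegralZl. Qed.

Lemma RintN f : intg f -> \int[mu]_x (- f x) = - \int[mu]_x f x.
Proof. by move=> fi; under eq_fun do rewrite -mulN1r; rewrite RintZ// mulN1r. Qed.

Lemma le_Rint f g : intg f -> intg g -> (forall x, f x <= g x) ->
  \int[mu]_x f x <= \int[mu]_x g x.
Proof. by move=> fi gi fg; exact: le_Rintegral. Qed.

Lemma Rint_ge0 f : (forall x, 0 <= f x) -> 0 <= \int[mu]_x f x.
Proof. by move=> f0; apply: Rintegral_ge0. Qed.

Lemma normr_Rint f : intg f -> `|\int[mu]_x f x| <= \int[mu]_x `|f x|.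
Proof. by move=> fi; exact: le_normr_Rintegral. Qed.

Lemma EFin_Rint f : intg f -> (\int[mu]_x f x)%:E = (\int[mu]_x (f x)%:E)%E.
Proof. by move=> fi; rewrite /Rintegral fineK//; exact: integrable_fin_num. Qed.

Lemma ge0_intgP f : measurable_fun setT f -> (forall x, 0 <= f x) ->
  (\int[mu]_x (f x)%:E < +oo)%E -> intg f.
Proof.
move=> mf f0 fy; apply/integrableP; split; first exact/measurable_EFinP.
by under eq_integral => x _ do rewrite /= ger0_norm//.
Qed.

Lemma Rint_dominated_cvg (F : nat -> E -> R) f g :
  (forall n, measurable_fun setT (F n)) ->
  (forall x, F n x @[n --> \oo] --> f x) -> intg g ->
  (forall n x, `|F n x| <= g x) ->
  intg f /\ \int[mu]_x F n x @[n --> \oo] --> \int[mu]_x f x.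
Proof. exact: Rdominated_cvg. Qed.

Lemma nnint_monotone_cvg (F : nat -> E -> R) f : (forall J, measurable_fun setT (F J)) ->
  (forall J x, 0 <= F J x) -> (forall x J K, (J <= K)%N -> F J x <= F K x) ->
  (forall x, \forall J \near \oo, F J x = f x) ->
  (\int[mu]_x (F J x)%:E)%E @[J --> \oo] --> (\int[mu]_x (f x)%:E)%E.
Proof.
move=> mF F0 ndF Ff.
have -> : (\int[mu]_x (f x)%:E = \int[mu]_x limn (fun J => (F J x)%:E))%E.
  apply: eq_integral => x _; apply/esym/cvg_lim => //; apply: cvg_near_cst.
  by apply: filterS (Ff x) => J ->.
apply: cvg_monotone_convergence => //.
- by move=> J; exact/measurable_EFinP.
- by move=> J x _; rewrite lee_fin.
- by move=> x _ J K JK; rewrite lee_fin ndF.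
Qed.

Lemma intg_indic (D : set E) : measurable D -> (mu D < +oo)%E -> intg (\1_D).
Proof.
move=> mD Dy; apply: ge0_intgP => [|x|]; [exact: measurable_indic|by rewrite indicE ler0n|].
by rewrite integral_indic// setIT.
Qed.

Definition cball (r : R) : set E := [set x | `|x| <= r].

Lemma measurable_normr : measurable_fun setT (fun x : E => `|x|).
Proof. by apply: continuous_measurable_rV; exact: norm_continuous. Qed.

Lemma measurable_cball r : measurable (cball r).
Proof.
have -> : cball r = (fun x : E => `|x|) @^-1` `]-oo, r].
  by apply/seteqP; split => x; rewrite /cball/= in_itv.
by rewrite -[X in measurable X]setTI; apply: measurable_normr.
Qed.

Lemma cball_lty r : (mu (cball r) < +oo)%E.
Proof.
apply: (le_lt_trans _ (lebesgue_cube_lty (N := N) (`|r| + 1))).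
apply: le_measure; rewrite ?inE; [exact: measurable_cball|exact: measurable_ocbox|].
move=> x xr i; rewrite in_itv/= !mxE; have := le_trans (normr_coor x i) xr.
have := ler_norm r; move: `|r| => s rs; rewrite ler_norml => /andP[? ?].
by apply/andP; split; lra.
Qed.

Lemma intg_cball r : intg (\1_(cball r)).
Proof. by apply: intg_indic; [exact: measurable_cball|exact: cball_lty]. Qed.

Definition locint f := measurable_fun setT f /\
  forall r, intg (fun x => f x * \1_(cball r) x).

(** Bounded measurable functions of bounded support, bounded by a multiple of the
    indicator of a ball: exactly what is needed for the product with a locally
    integrable function to be integrable. *)
Definition bms psi := measurable_fun setT psi /\
  exists r C : R, forall x, `|psi x| <= C * \1_(cball r) x.

Lemma bmsP psi : measurable_fun setT psi -> (exists r : R, forall x, r < `|x| -> psi x = 0) ->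
  (exists C : R, forall x, `|psi x| <= C) -> bms psi.
Proof.
move=> mpsi [r rP] [C CP]; split => //; exists r, C => x.
rewrite indicE; have [xr|xr] := leP `|x| r; first by rewrite mem_set// mulr1.
by rewrite rP// normr0 memNset ?mulr0//= /cball/=; apply/negP; rewrite -ltNge.
Qed.

Lemma bms_supp psi : bms psi -> exists r : R, forall x, r < `|x| -> psi x = 0.
Proof.
move=> [_ [r [C H]]]; exists r => x rx; apply/eqP; rewrite -normr_le0.
apply: le_trans (H x) _; rewrite indicE memNset ?mulr0//= /cball/=.
by apply/negP; rewrite -ltNge.
Qed.

Lemma bms_bounded psi : bms psi -> exists C : R, forall x, `|psi x| <= C.
Proof.
move=> [_ [r [C H]]]; exists `|C| => x; apply: le_trans (H x) _.
by apply: le_trans (ler_norm _) _; rewrite normrM ler_piMr// indicE; case: (_ \in _); rewrite ?normr1 ?normr0.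
Qed.

Lemma locint_bms f psi : locint f -> bms psi -> intg (fun x => f x * psi x).
Proof.
move=> [mf fi] [mp [r [C pC]]].
apply: (@intg_le _ (fun x => C * `|f x * \1_(cball r) x|)).
- exact: measurable_funM.
- move=> x; rewrite !normrM mulrCA ler_wpM2l//.
  by rewrite [ `|\1__ _|]ger0_norm// indicE.
- by apply: intgZ; exact: intg_norm.
Qed.

Lemma locint1 : locint (fun=> 1).
Proof. by split => // r; under eq_fun do rewrite mul1r; exact: intg_cball. Qed.

Lemma bms_intg psi : bms psi -> intg psi.
Proof. by move=> /(locint_bms locint1); under eq_fun do rewrite mul1r. Qed.

Lemma bms_le psi g : measurable_fun setT psi -> (forall x, `|psi x| <= `|g x|) ->
  bms g -> bms psi.
Proof.
by move=> mp pg [_ [r [C gC]]]; split => //; exists r, C => x; exact: le_trans (pg x) (gC x).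
Qed.

Lemma bmsM f g : measurable_fun setT f -> (forall r, exists C : R, forall x, `|x| <= r -> `|f x| <= C) ->
  bms g -> bms (fun x => f x * g x).
Proof.
move=> mf fb [mg [r [C gC]]]; split; first exact: measurable_funM.
have [D fD] := fb r; exists r, (D * C) => x; rewrite normrM -mulrA.
have := gC x; rewrite indicE; have [xr|xr] := leP `|x| r.
  by rewrite mem_set// => gx; rewrite ler_pM// fD.
rewrite memNset ?mulr0//=; last by rewrite /cball/=; apply/negP; rewrite -ltNge.
by rewrite normr_le0 => /eqP ->; rewrite normr0 mulr0.
Qed.

Lemma bmsMbms f g : bms f -> bms g -> bms (fun x => f x * g x).
Proof.
move=> bf; apply: bmsM; first by case: bf.
by move=> r; have [C CP] := bms_bounded bf; exists C.
Qed.

Lemma bmsZ (c : R) g : bms g -> bms (fun x => c * g x).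
Proof. by apply: bmsM => // r; exists `|c|. Qed.

Lemma bms_norm g : bms g -> bms (fun x => `|g x|).
Proof.
move=> bg; apply: bms_le (bg); last by move=> x; rewrite normr_id.
by apply: measurableT_comp => //; case: bg.
Qed.

Lemma bmsD f g : bms f -> bms g -> bms (fun x => f x + g x).
Proof.
move=> bf bg; apply: bmsP; first by apply: measurable_funD; [case: bf|case: bg].
  have [r rP] := bms_supp bf; have [s sP] := bms_supp bg.
  by exists (Num.max r s) => x; rewrite gt_max => /andP[? ?]; rewrite rP// sP// addr0.
have [C CP] := bms_bounded bf; have [D DP] := bms_bounded bg.
by exists (C + D) => x; rewrite (le_trans (ler_normD _ _))// lerD.
Qed.

Lemma bmsN f : bms f -> bms (fun x => - f x).
Proof. by move=> /(bmsZ (-1)); under eq_fun do rewrite mulN1r. Qed.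

Lemma bmsB f g : bms f -> bms g -> bms (fun x => f x - g x).
Proof. by move=> bf bg; apply: bmsD => //; exact: bmsN. Qed.

Lemma bms_sqr f : bms f -> bms (fun x => f x ^+ 2).
Proof. by move=> bf; under eq_fun do rewrite expr2; exact: bmsMbms. Qed.

Lemma bms_indic (D : set E) r : measurable D -> D `<=` cball r -> bms (\1_D).
Proof.
move=> mD Dr; split; first exact: measurable_indic.
exists r, 1 => x; rewrite mul1r !indicE.
have [xD|xD] := boolP (x \in D); last by rewrite normr0 ler0n.
by rewrite mem_set ?normr1//; apply: Dr; rewrite -inE.
Qed.

Lemma bms_shift h f : bms f -> bms (fun x => f (x + h)).
Proof.
move=> bf; apply: bmsP; first by apply: measurable_fun_shift; case: bf.
  have [r rP] := bms_supp bf; exists (r + `|h|) => x xr; apply: rP.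
  have := ler_normB (x + h) h; rewrite addrK; lra.
by have [C CP] := bms_bounded bf; exists C.
Qed.

Lemma closed_cball (r : R) : closed (cball r : set E).
Proof.
have -> : cball r = (fun x : E => `|x|) @^-1` [set t | t <= r] by [].
apply: closed_comp; first by move=> x _; exact: norm_continuous.
exact: closed_le.
Qed.

Lemma compact_cball (r : R) : compact (cball r : set E).
Proof.
apply: bounded_closed_compact; last exact: closed_cball.
by exists r; split; [exact: num_real|move=> M rM x /= xr; rewrite (le_trans xr)// ltW].
Qed.

Lemma continuous_bounded_cball f r : continuous f -> exists C : R, forall x, `|x| <= r -> `|f x| <= C.
Proof.
move=> cf.
have : compact (f @` cball r).
  by apply: continuous_compact; [exact: continuous_subspaceT|exact: compact_cball].
move=> /compact_bounded [M [_ MP]]; exists (M + 1) => x xr.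
by apply: (MP (M + 1)); [rewrite ltrDl|exists x].
Qed.

Lemma continuous_bms f : continuous f -> (exists r : R, forall x, r < `|x| -> f x = 0) -> bms f.
Proof.
move=> cf fr; apply: bmsP => //; first exact: continuous_measurable_rV.
have [r rP] := fr; have [C CP] := continuous_bounded_cball r cf.
exists `|C| => x; have [xr|xr] := leP `|x| r; last by rewrite rP// normr0.
by rewrite (le_trans (CP x xr))// ler_norm.
Qed.

Lemma test_bms phi : test phi -> bms phi.
Proof. by move=> [sp pr]; apply: continuous_bms => //; exact: smooth_continuous. Qed.

Lemma continuous_locint f : continuous f -> locint f.
Proof.
move=> cf; split => [|r]; first exact: continuous_measurable_rV.
apply: bms_intg; apply: bmsM.
- exact: continuous_measurable_rV.
- by move=> s; exact: continuous_bounded_cball.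
- by apply: (@bms_indic _ r) => //; exact: measurable_cball.
Qed.

Lemma bms_locint f : bms f -> locint f.
Proof.
move=> bf; split => [|r]; first by case: bf.
apply: bms_intg; apply: bmsMbms => //.
by apply: (@bms_indic _ r) => //; exact: measurable_cball.
Qed.

Lemma locintD f g : locint f -> locint g -> locint (fun x => f x + g x).
Proof.
move=> [mf fi] [mg gi]; split => [|r]; first exact: measurable_funD.
by under eq_fun do rewrite mulrDl; exact: intgD.
Qed.

Lemma locintM f g : measurable_fun setT f ->
  (forall r, exists C : R, forall x, `|x| <= r -> `|f x| <= C) ->
  locint g -> locint (fun x => f x * g x).
Proof.
move=> mf fb [mg gi]; split => [|r]; first exact: measurable_funM.
have := locint_bms (conj mg gi) (bmsM mf fb (bms_indic (measurable_cball r) (@subset_refl _ _))).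
by congr intg; apply/funext => x; ring.
Qed.

End real_integrals.

(** * Density of test functions and the dual form of the L2 norm *)

Section density.
Context {R : realType} {N : nat}.
Local Notation E := 'rV[R]_N.
Local Notation mu := (@lebesgue_rV R N).
Implicit Types (f g phi psi : E -> R) (x y z a b : E).

Lemma testD phi psi : test phi -> test psi -> test (fun x => phi x + psi x).
Proof.
move=> [sp [r rP]] [sq [s sP]]; split; first exact: smoothD.
by exists (Num.max r s) => x; rewrite gt_max => /andP[? ?]; rewrite rP// sP// addr0.
Qed.

Lemma testZ (c : R) phi : test phi -> test (fun x => c * phi x).
Proof.
by move=> [sp [r rP]]; split; [exact: smoothZ|exists r => x xr; rewrite rP ?mulr0].
Qed.

Lemma test0 : test (fun _ : E => 0 : R).
Proof. by split; [exact: smooth_cst|exists 0]. Qed.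

Section closure.
Variables (w : E -> R) (w_loc : locint w).

(** One quantity controls both errors made when a test function replaces [h]: in
    the pairing with [w] and in the L2 norm. *)
Definition dist_w (h : E -> R) : R := \int[mu]_x (`|w x| * `|h x| + h x ^+ 2).

Lemma locint_norm : locint (fun x => `|w x|).
Proof.
case: w_loc => mw wi; split => [|r]; first exact: measurableT_comp.
have := intg_norm (wi r); congr intg; apply/funext => x.
by rewrite normrM [ `|\1__ _|]ger0_norm// indicE.
Qed.

Lemma dist_w_intg h : bms h -> intg (fun x => `|w x| * `|h x| + h x ^+ 2).
Proof.
move=> bh; apply: intgD; last by apply: bms_intg; exact: bms_sqr.
by apply: (locint_bms locint_norm); exact: bms_norm.
Qed.

Definition approximable psi := bms psi /\
  forall eps : R, 0 < eps -> exists2 phi, test phi & dist_w (fun x => psi x - phi x) <= eps.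

Lemma test_approximable phi : test phi -> approximable phi.
Proof.
move=> tp; split; first exact: test_bms.
move=> e e0; exists phi => //; rewrite /dist_w.
under eq_Rintegral do rewrite subrr normr0 mulr0 expr0n addr0.
by rewrite Rintegral_cst// mul0r ltW.
Qed.

Lemma dist_wD h k : bms h -> bms k -> dist_w (fun x => h x + k x) <= 2 * (dist_w h + dist_w k).
Proof.
move=> bh bk; rewrite /dist_w -RintD; [|exact: dist_w_intg..].
rewrite -RintZ; last by apply: intgD; exact: dist_w_intg.
apply: le_Rint; first by apply: dist_w_intg; exact: bmsD.
  by apply: intgZ; apply: intgD; exact: dist_w_intg.
have ineq (W u v : R) : 0 <= W ->
    W * `|u + v| + (u + v) ^+ 2 <= 2 * (W * `|u| + u ^+ 2 + (W * `|v| + v ^+ 2)).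
  move=> W0; have H1 := ler_wpM2l W0 (ler_normD u v).
  have H2 : 0 <= W * `|u| by rewrite mulr_ge0.
  have H3 : 0 <= W * `|v| by rewrite mulr_ge0.
  have H4 := sqr_ge0 (u - v).
  rewrite mulrDr in H1; nra.
by move=> x; exact: ineq.
Qed.

Lemma approximableD f g : approximable f -> approximable g -> approximable (fun x => f x + g x).
Proof.
move=> [bf af] [bg ag]; split; first exact: bmsD.
move=> e e0; have e4 : 0 < e / 4 by lra.
have [p tp fp] := af _ e4; have [q tq gq] := ag _ e4.
exists (fun x => p x + q x); first exact: testD.
have := @dist_wD (fun x => f x - p x) (fun x => g x - q x)
  (bmsB bf (test_bms tp)) (bmsB bg (test_bms tq)).
rewrite (_ : (fun x => f x - p x + _) = (fun x => f x + g x - (p x + q x))); first by lra.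
by apply/funext => x; ring.
Qed.

Lemma approximableZ (c : R) f : approximable f -> approximable (fun x => c * f x).
Proof.
move=> [bf af]; split; first exact: bmsZ.
move=> e e0; have c0 : 0 < 1 + `|c| + c ^+ 2 by rewrite ltr_wpDr ?sqr_ge0// ltr_wpDr.
have [p tp fp] := af (e / (1 + `|c| + c ^+ 2)) (divr_gt0 e0 c0).
exists (fun x => c * p x); first exact: testZ.
apply: (@le_trans _ _ ((1 + `|c| + c ^+ 2) * dist_w (fun x => f x - p x))); last first.
  by rewrite mulrC -ler_pdivlMr.
have bfp := bmsB bf (test_bms tp).
rewrite /dist_w -RintZ; last exact: dist_w_intg.
apply: le_Rint; first by apply: dist_w_intg; apply: bmsB; apply: bmsZ => //; exact: test_bms.
  by apply: intgZ; exact: dist_w_intg.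
move=> x; rewrite -mulrBr normrM exprMn mulrDr; apply: lerD.
  rewrite mulrCA ler_wpM2r ?mulr_ge0//; have := sqr_ge0 c; lra.
by rewrite ler_wpM2r ?sqr_ge0//; have := normr_ge0 c; lra.
Qed.

(** Dominated convergence makes [dist_w] small along the sequence. *)
Lemma approximable_lim (F : nat -> E -> R) psi (r C : R) :
  (forall n, approximable (F n)) -> (forall x, F n x @[n --> \oo] --> psi x) ->
  (forall n x, `|F n x| <= C * \1_(cball r) x) -> approximable psi.
Proof.
move=> aF Fpsi FC.
have mpsi : measurable_fun setT psi.
  by apply: (@measurable_fun_cvg _ _ _ _ F) => [n|x _]; [case: (aF n) => -[]|exact: Fpsi].
have psiC x : `|psi x| <= C * \1_(cball r) x.
  have : `|F n x| @[n --> \oo] --> `|psi x| by apply: cvg_norm; exact: Fpsi.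
  move=> /cvgrPdist_lt H; apply/ler_addgt0Pr => e e0.
  have [n _ /(_ n (leqnn _)) /=] := H _ e0; rewrite ltr_norml => /andP[_ ?].
  by have := FC n x; lra.
have bpsi : bms psi by split => //; exists r, C.
split => // e e0.
have bcst : bms (fun x => 2 * C * \1_(cball r) x).
  by apply: bmsZ; apply: (@bms_indic _ _ _ r) => //; exact: measurable_cball.
have H : dist_w (fun x => psi x - F n x) @[n --> \oo] --> (0 : R).
  have [||||_ HH] := @Rint_dominated_cvg _ _ (fun n x => `|w x| * `|psi x - F n x| + (psi x - F n x) ^+ 2)
    (fun=> 0) (fun x => `|w x| * `|2 * C * \1_(cball r) x| + (2 * C * \1_(cball r) x) ^+ 2).
  - by move=> n; have /dist_w_intg/intg_measurable := bmsB bpsi (proj1 (aF n)).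
  - move=> x; have H1 : psi x - F n x @[n --> \oo] --> (0 : R).
      by rewrite -(subrr (psi x)); apply: cvgB; [exact: cvg_cst|exact: Fpsi].
    have H2 : `|psi x - F n x| @[n --> \oo] --> (0 : R) by rewrite -(@normr0 _ R); exact: cvg_norm.
    have H3 := cvgD (cvgM (cvg_cst (`|w x|)) H2) (cvgM H1 H1).
    by rewrite !mulr0 addr0 in H3; exact: H3.
  - exact: dist_w_intg.
  - move=> n x.
    have h1 : `|psi x - F n x| <= `|2 * C * \1_(cball r) x|.
      apply: le_trans (ler_norm _); rewrite (le_trans (ler_normB _ _))//.
      by have := psiC x; have := FC n x; lra.
    rewrite [leLHS]ger0_norm; last by apply: addr_ge0; [exact: mulr_ge0|exact: sqr_ge0].
    apply: lerD; first by rewrite ler_wpM2l.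
    by rewrite -[leLHS]real_normK ?num_real// -[leRHS]real_normK ?num_real// lerXn2r ?nnegrE.
  - by rewrite Rintegral_cst// mul0r in HH.
have e4 : 0 < e / 4 by lra.
move/cvgr0Pnorm_lt : H => /(_ _ e4) [n _ /(_ n (leqnn _)) /= Hn].
have [p tp Fp] := (proj2 (aF n)) _ e4.
exists p => //; rewrite (_ : (fun x => _) = (fun x => (psi x - F n x) + (F n x - p x))); last first.
  by apply/funext => x; ring.
apply: le_trans (dist_wD (bmsB bpsi (proj1 (aF n))) (bmsB (proj1 (aF n)) (test_bms tp))) _.
move: Hn; rewrite [ltLHS]ger0_norm; last first.
  by apply: Rint_ge0 => x; apply: addr_ge0; [exact: mulr_ge0|exact: sqr_ge0].
by rewrite -/(dist_w (fun x => psi x - F n x)); lra.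
Qed.

Lemma approximable_ocbox a b : approximable (\1_(ocbox a b)).
Proof.
have [r rP] := ocbox_bounded a (b + const_mx 1).
apply: (@approximable_lim (bump a b) _ r 1).
- by move=> n; apply: test_approximable; exact: test_bump.
- exact: bump_cvg.
- move=> n x; rewrite mul1r indicE; have [xr|xr] := boolP (x \in cball r).
    by rewrite ger0_norm ?bump_ge0// bump_le1.
  rewrite bump_eq0 ?normr0//= => /rP xr'; move/negP : xr; apply.
  by rewrite inE.
Qed.

(** The measurable sets with this property form a lambda-system containing the
    boxes, which generate the Borel sets and are stable under intersection. *)
Lemma approximable_indic_cube (m : R) (D : set E) : measurable D ->
  approximable (\1_(D `&` cube m)).
Proof.
move=> mD; pose H := [set D : set E | approximable (\1_(D `&` cube m))].
have [r rP] := ocbox_bounded (const_mx (- m) : E) (const_mx m).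
suff : <<s ocboxes >> `<=` H by apply; rewrite -measurable_rVE.
apply: lambda_system_subset => //; first exact: ocboxes_setI; last first.
  move=> _ [a [b ->]]; rewrite /H/= /cube ocboxI; exact: approximable_ocbox.
split => //.
- by rewrite /H/= setTI; exact: approximable_ocbox.
- move=> A B BA HA HB; rewrite /H/=.
  rewrite (_ : \1__ = (fun x => \1_(A `&` cube m) x + (-1) * \1_(B `&` cube m) x :> R)).
    by apply: approximableD => //; exact: approximableZ.
  apply/funext => x; rewrite !indicE setDE !in_setI in_setC.
  have [xB|xB] := boolP (x \in B).
    have -> : x \in A by rewrite inE; apply: BA; rewrite -inE.
    by rewrite /= mulN1r subrr.
  by rewrite /= mulr0 addr0 andbT.
- move=> F ndF HF; rewrite /H/=.
  apply: (@approximable_lim (fun n => \1_(F n `&` cube m)) _ r 1) => //.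
  + move=> x; rewrite [X in _ --> X]indicE in_setI.
    have [xF|xF] := boolP (x \in \bigcup_n F n).
      move: xF; rewrite inE => -[n _ Fn].
      apply: (@cvg_trans _ ((fun=> (x \in cube m)%:R : R) @ \oo)); last exact: cvg_cst.
      apply: near_eq_cvg; exists n => // k /= nk; rewrite indicE in_setI (_ : x \in F k = true)//.
      by apply: mem_set; move/subsetPset : (ndF _ _ nk); apply.
    apply: (@cvg_trans _ ((fun=> 0 : R) @ \oo)); last exact: cvg_cst.
    apply: near_eq_cvg; exists 0%N => // k _; rewrite indicE in_setI.
    case: (boolP (x \in F k)) => // xk; move/negP : xF; case; rewrite inE; exists k => //.
    by rewrite -inE.
  + move=> n x; rewrite mul1r !indicE in_setI.
    have [xm|xm] := boolP (x \in cube m); last by rewrite andbF normr0 ler0n.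
    rewrite (_ : x \in cball r)/=; first by case: (x \in _); rewrite ?normr1 ?normr0.
    by rewrite inE; apply: rP; rewrite -inE.
Qed.

Lemma approximable_sum (I : Type) (s : seq I) (F : I -> E -> R) :
  (forall i, approximable (F i)) -> approximable (fun x => \sum_(i <- s) F i x).
Proof.
move=> aF; elim: s => [|i s IH].
  by under eq_fun do rewrite big_nil; apply: test_approximable; exact: test0.
by under eq_fun do rewrite big_cons; exact: approximableD.
Qed.

Import HBNNSimple.

Lemma ge0_bms_approximable psi : bms psi -> (forall x, 0 <= psi x) -> approximable psi.
Proof.
move=> bpsi p0; have mp : measurable_fun setT (EFin \o psi).
  by apply/measurable_EFinP; case: bpsi.
have [mpsi [r [C rC]]] := bpsi.
pose G := nnsfun_approx measurableT mp.
have Gle n x : G n x <= psi x.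
  have H := @cvg_nnsfun_approx _ _ _ _ measurableT _ mp (fun y _ => p0 y) x I.
  rewrite -lee_fin; apply: (cvge_to_ge H); exists n => // k /= nk; rewrite lee_fin.
  by have /lefP := @nd_nnsfun_approx _ _ _ _ measurableT _ mp _ _ nk; exact.
have G0 n x : 0 <= G n x by exact: fun_ge0.
apply: (@approximable_lim (fun n => G n) _ r C).
- move=> n.
  rewrite (_ : (G n : E -> R) = fun x => \sum_(t <- fset_set (range (G n)))
      (t * \1_((G n @^-1` [set t]) `&` cube (r + 1)) x)).
    apply: approximable_sum => t; apply: approximableZ; apply: approximable_indic_cube.
    exact: measurable_sfunP.
  apply/funext => x; rewrite fimfunE fsbig_finite//=; apply: eq_bigr => t _.
  have [->|t0] := eqVneq t 0; first by rewrite !mul0r.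
  congr (_ * _); rewrite !indicE in_setI; have [|//] := boolP (x \in G n @^-1` [set t]).
  rewrite inE/= => Gt; rewrite mem_set// => i.
  have /(_ x) := rC; rewrite indicE; have [xr _|xr] := boolP (x \in cball r).
    move: xr; rewrite inE /cball/= => xr; rewrite in_itv/= !mxE.
    have := le_trans (normr_coor x i) xr; rewrite ler_norml => /andP[? ?].
    by apply/andP; split; lra.
  rewrite mulr0 normr_le0 => /eqP px0; exfalso; move/eqP : t0; apply; rewrite -Gt.
  by apply/eqP; rewrite eq_le G0 andbT -px0 Gle.
- move=> x; have := @cvg_nnsfun_approx _ _ _ _ measurableT _ mp (fun y _ => p0 y) x I.
  by move/fine_cvgP => [_]; exact.
- move=> n x; rewrite ger0_norm; first exact: le_trans (Gle n x) (le_trans (ler_norm _) (rC x)).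
  exact: G0.
Qed.

Lemma bms_approximable psi : bms psi -> approximable psi.
Proof.
move=> bpsi.
rewrite (_ : psi = fun x => Num.max (psi x) 0 + (-1) * Num.max (- psi x) 0); last first.
  apply/funext => x; rewrite mulN1r; have [p0|p0] := leP 0 (psi x).
    by rewrite max_r ?oppr_le0// subr0.
  by rewrite max_l ?add0r ?opprK// oppr_ge0 ltW.
have mpsi : measurable_fun setT psi by case: bpsi.
apply: approximableD; last apply: approximableZ.
  apply: ge0_bms_approximable => [|x]; last by rewrite le_max lexx orbT.
  apply: bms_le bpsi; first exact: measurable_maxr.
  by move=> x; rewrite ger0_norm ?le_max ?lexx ?orbT// ge_max ler_norm normr_ge0.
apply: ge0_bms_approximable => [|x]; last by rewrite le_max lexx orbT.
apply: bms_le bpsi; first by apply: measurable_maxr => //; exact: measurable_funN.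
by move=> x; rewrite ger0_norm ?le_max ?lexx ?orbT// ge_max normr_ge0 -normrN ler_norm.
Qed.

End closure.

(** The integral of [g ^ 2], finite or not, is the supremum of the integrals of
    [2 g phi - phi ^ 2]. The supremum is taken over expressions that are affine
    in [g], hence continuous under convergence against test functions. *)
Lemma sqr_dual_test (g : E -> R) (c : R) : locint g ->
  (c%:E < \int[mu]_x (g x ^+ 2)%:E)%E ->
  exists2 phi, test phi & c < \int[mu]_x (2 * (g x * phi x) - phi x ^+ 2).
Proof.
move=> lg cg.
(* cut [g] off in height and in space, then approximate by a test function *)
pose K n : set E := [set x | `|g x| <= n%:R] `&` cball n%:R.
have mg : measurable_fun setT g by case: lg.
have mK n : measurable (K n).
  apply: measurableI; last exact: measurable_cball.
  have -> : [set x | `|g x| <= n%:R] = (fun x => `|g x|) @^-1` `]-oo, n%:R].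
    by apply/seteqP; split => x /=; rewrite in_itv.
  by rewrite -[X in measurable X]setTI; apply: measurableT_comp.
pose psi n x := g x * \1_(K n) x.
have bpsi n : bms (psi n).
  split; first by apply: measurable_funM => //; exact: measurable_indic.
  exists n%:R, n%:R => x; rewrite /psi !indicE in_setI normrM.
  have [xg|xg] := boolP (x \in [set x | `|g x| <= n%:R]); last by rewrite normr0 mulr0 mulr_ge0.
  rewrite /= (@ger0_norm _ (_%:R))// ler_wpM2r//.
  by move: xg; rewrite inE.
have [n cn] : exists n, c < \int[mu]_x (psi n x ^+ 2).
  have H : (\int[mu]_x (psi n x ^+ 2)%:E)%E @[n --> \oo] --> (\int[mu]_x (g x ^+ 2)%:E)%E.
    apply: nnint_monotone_cvg => [m|m x|x m k mk|x]; last 1 first.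
    - exists (maxn (Num.bound `|g x|) (Num.bound `|x|)) => // m /=.
      rewrite geq_max => /andP[gm xm]; rewrite /psi indicE in_setI !mem_set ?mulr1//=.
        by rewrite /cball/= (le_trans (ltW (archi_boundP (normr_ge0 x))))// ler_nat.
      by rewrite (le_trans (ltW (archi_boundP (normr_ge0 (g x)))))// ler_nat.
    - by apply: measurable_funX; case: (bpsi m).
    - exact: sqr_ge0.
    - rewrite /psi !exprMn ler_wpM2l ?sqr_ge0//.
      rewrite !indicE lerXn2r ?nnegrE ?ler0n// ler_nat.
      have [xm|//] := boolP (x \in K m).
      rewrite (_ : x \in K k = true)//; apply: mem_set; move: xm; rewrite inE => -[/= gm xm].
      by split; rewrite /cball/= ?(le_trans gm) ?(le_trans xm)// ler_nat.
  apply: contrapT => /forallNP cn; move: cg; apply/negP; rewrite -leNgt.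
  apply: (cvge_to_le H); apply: nearW => n; rewrite -EFin_Rint.
    by rewrite lee_fin leNgt; apply/negP; exact: cn.
  by apply: bms_intg; exact: bms_sqr.
set I := \int[mu]_x (psi n x ^+ 2) in cn.
have e0 : 0 < (I - c) / 8 by lra.
have [_ /(_ _ e0) [phi tphi phie]] := bms_approximable lg (bpsi n).
exists phi => //.
have bp := bms_norm (bmsB (bpsi n) (test_bms tphi)).
have i1 := dist_w_intg lg (bmsB (bpsi n) (test_bms tphi)).
have i2 : intg (fun x => psi n x ^+ 2) by apply: bms_intg; exact: bms_sqr.
have i3 : intg (fun x => g x * phi x) by apply: locint_bms => //; exact: test_bms.
have i4 : intg (fun x => phi x ^+ 2) by apply: bms_intg; apply: bms_sqr; exact: test_bms.
apply: (@lt_le_trans _ _ (I - 4 * dist_w g (fun x => psi n x - phi x))); first lra.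
rewrite /I /dist_w -RintZ// -RintB//; last exact: intgZ.
apply: le_Rint; [by apply: intgB => //; exact: intgZ|by apply: intgB => //; exact: intgZ|].
move=> x; rewrite /psi.
have : \1_(K n) x = 0 :> R \/ \1_(K n) x = 1 :> R.
  by rewrite indicE; case: (_ \in _); [right|left].
move=> [] ->; rewrite ?mulr0 ?mulr1 ?sub0r ?normrN.
  have := ler_norm (- (g x * phi x)); rewrite normrN normrM expr0n sqrrN /=.
  have := sqr_ge0 (phi x); have := mulr_ge0 (normr_ge0 (g x)) (normr_ge0 (phi x)); lra.
have := mulr_ge0 (normr_ge0 (g x)) (normr_ge0 (g x - phi x)).
have -> : 2 * (g x * phi x) - phi x ^+ 2 = g x ^+ 2 - (g x - phi x) ^+ 2 by ring.
have := sqr_ge0 (g x - phi x); lra.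
Qed.

End density.

(** * Integration by parts and mollification *)

Section sequential.
Context {R : realType}.

Lemma is_derive_seq (V : normedModType R) (f : V -> R) (x v : V) (d : R) (h : nat -> R) :
  is_derive x v f d -> (forall n, h n != 0) -> h n @[n --> \oo] --> (0 : R) ->
  (h n)^-1 * (f (h n *: v + x) - f x) @[n --> \oo] --> d.
Proof.
move=> [cf fd] h0 hcvg.
have /(cvgr_dnbhsP (fun t : R => t^-1 *: (f (t *: v + x) - f x)) 0 d) H :
   (fun t : R => t^-1 *: (f (t *: v + x) - f x)) @ 0^' --> d.
  by rewrite -fd /derive; exact: cf.
exact: H.
Qed.

Lemma is_derive_seqP (V : normedModType R) (f : V -> R) (x v : V) (d : R) :
  (forall h : nat -> R, (forall n, h n != 0) -> h n @[n --> \oo] --> (0 : R) ->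
  (h n)^-1 * (f (h n *: v + x) - f x) @[n --> \oo] --> d) -> is_derive x v f d.
Proof.
move=> H.
have Hd : (fun t : R => t^-1 *: (f (t *: v + x) - f x)) @ 0^' --> d.
  by apply/cvgr_dnbhsP => u [u0 ucvg]; exact: H.
by apply: DeriveDef; [apply/cvg_ex; exists d|apply/cvg_lim].
Qed.

(** Sequences suffice to test continuity, which makes dominated convergence
    applicable to integrals depending on a parameter. *)
Lemma continuous_seqP (V : normedModType R) (f : V -> R) (x : V) :
  (forall u : nat -> V, u n @[n --> \oo] --> x -> f (u n) @[n --> \oo] --> f x) ->
  {for x, continuous f}.
Proof.
move=> H; apply/cvgrPdist_lt => e e0; apply: contrapT => /= nH.
have /choice[u uP] : forall n : nat, exists y : V, `|x - y| < n.+1%:R^-1 /\ ~ (`|f x - f y| < e).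
  move=> n; apply: contrapT => /forallNP ny; apply: nH.
  apply/nbhs_ballP; exists n.+1%:R^-1; first by rewrite /= invr_gt0.
  move=> y xy /=; apply: contrapT => fy; apply: (ny y); split => //.
  by move: xy; rewrite -ball_normE.
have ux : u n @[n --> \oo] --> x.
  apply/cvgrPdist_lt => d d0.
  have := near_infty_natSinv_lt (PosNum d0); apply: filterS => n /= nd.
  exact: lt_trans (proj1 (uP n)) nd.
have /cvgrPdist_lt/(_ _ e0) [n _ /(_ n (leqnn _))] := H u ux.
exact: (proj2 (uP n)).
Qed.

Lemma cvg_seq_norm_bounded (V : normedModType R) (u : nat -> V) (l : V) :
  u n @[n --> \oo] --> l -> exists B : R, forall n, `|u n| <= B.
Proof.
move=> ul; have /cvg_seq_bounded [M [_ MP]] : cvgn u by apply/cvg_ex; exists l.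
by exists (M + 1) => n; apply: (MP (M + 1)); rewrite ?ltrDl.
Qed.

End sequential.

Section integration_by_parts.
Context {R : realType} {N : nat}.
Local Notation E := 'rV[R]_N.
Local Notation mu := (@lebesgue_rV R N).
Implicit Types (f g phi psi : E -> R) (x y z a b : E).

Lemma normr_e_ (i : 'I_N) (t : R) : `|t *: (e_ i : E)| <= `|t|.
Proof.
apply: normr_rV_le => // j; rewrite /e_ !mxE eqxx/=.
by case: eqP => _; rewrite ?mulr1 ?mulr0 ?normr0.
Qed.

Lemma supp_derive (f df : E -> R) (v : E) (r : R) :
  (forall x, is_derive x v f (df x)) -> (forall x, r < `|x| -> f x = 0) ->
  forall x, r < `|x| -> df x = 0.
Proof.
move=> fd fr x xr.
have : is_derive x v f 0.
  apply: (@near_eq_is_derive _ _ _ (fun=> 0)).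
  have : \forall y \near x, r < `|y|.
    by have /cvgr_gt/(_ _ xr) := @norm_continuous R E x.
  by apply: filterS => y yr; rewrite fr.
by case: (fd x) => _ <- [_ <-].
Qed.

Lemma partial_test phi i : test phi -> test (partial i phi).
Proof.
move=> [sp [r rP]]; split; first exact: smooth_partial.
by exists r; apply: (@supp_derive phi _ (e_ i)) => // x; exact: smooth_is_derive.
Qed.

Lemma shift_test phi z : test phi -> test (fun x => phi (x + z)).
Proof.
move=> [sp [r rP]]; split; first exact: smooth_shift.
exists (r + `|z|) => x xr; apply: rP.
have := ler_normB (x + z) z; rewrite addrK; lra.
Qed.

(** By translation invariance the difference quotients of [psi] integrate to 0,
    and dominated convergence passes this on to the derivative. *)
Lemma Rint_derive0 (psi dpsi : E -> R) i : (forall x, is_derive x (e_ i) psi (dpsi x)) ->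
  bms psi -> bms dpsi -> \int[mu]_x dpsi x = 0.
Proof.
move=> dP bp bd.
pose h n : R := n.+1%:R^-1.
have h0 n : h n != 0 by rewrite /h invr_eq0.
have h1 n : `|h n| <= 1 by rewrite /h ger0_norm ?invr_ge0// invf_le1// ler1n.
have hcvg : h n @[n --> \oo] --> (0 : R) by exact: cvg_harmonic.
have [r rP] := bms_supp bp; have [L LP] := bms_bounded bd.
have ip := bms_intg bp.
have ips n : intg (fun x => psi (x + h n *: e_ i)) by exact: integrable_shift.
have mp : measurable_fun setT psi by case: bp.
have [||||_ H] := @Rint_dominated_cvg R N (fun n x => (h n)^-1 * (psi (x + h n *: e_ i) - psi x))
  dpsi (fun x => L * \1_(cball (r + 1)) x).
- move=> n; apply: measurable_funM => //; apply: measurable_funB => //.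
  exact: measurable_fun_shift.
- by move=> x; under eq_fun do rewrite [x + _]addrC; exact: is_derive_seq.
- by apply: intgZ; exact: intg_cball.
- move=> n x; rewrite normrM normfV ler_pdivrMl ?normr_gt0//.
  rewrite indicE; have [xr|xr] := leP `|x| (r + 1).
    rewrite mem_set// mulr1 mulrC [x + _]addrC.
    by apply: (@le_increment_line _ _ psi dpsi) => // s _; exact: LP.
  rewrite rP ?rP ?subrr ?normr0; last 2 first.
  - lra.
  - have := ler_normB (x + h n *: e_ i) (h n *: e_ i); rewrite addrK.
    have := le_trans (normr_e_ i (h n)) (h1 n); lra.
  by rewrite memNset ?mulr0//= /cball/=; apply/negP; rewrite -ltNge.
move/cvg_lim : H => <- //; rewrite (_ : (fun n => _) = fun=> 0) ?lim_cst//.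
apply/funext => n; rewrite RintZ; last exact: (intgB (ips n) ip).
by rewrite (RintB (ips n) ip) Rintegral_shift// subrr mulr0.
Qed.

(** A correlation rather than a convolution: [phi] enters through its translates
    without reflection. *)
Definition mol f phi : E -> R := fun x => \int[mu]_z (f z * phi (z - x)).

Section mollify.
Variables (f : E -> R) (f_loc : locint f).

Lemma mol_intg psi x : bms psi -> intg (fun z => f z * psi (z - x)).
Proof. by move=> bp; apply: locint_bms => //; exact: bms_shift. Qed.

Lemma mol_cvg (P : nat -> E -> R) psi (r C : R) :
  (forall n, measurable_fun setT (P n)) -> (forall x, P n x @[n --> \oo] --> psi x) ->
  (forall n x, `|P n x| <= C * \1_(cball r) x) ->
  \int[mu]_z (f z * P n z) @[n --> \oo] --> \int[mu]_z (f z * psi z).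
Proof.
move=> mP Pp PC; have [mf fi] := f_loc.
have [||||//] := @Rint_dominated_cvg R N (fun n z => f z * P n z)
  (fun z => f z * psi z) (fun z => C * `|f z * \1_(cball r) z|).
- by move=> n; exact: measurable_funM.
- by move=> x; apply: cvgM => //; exact: cvg_cst.
- by apply: intgZ; exact: intg_norm.
- move=> n x; rewrite !normrM mulrCA ler_wpM2l//.
  by rewrite [ `|\1__ _|]ger0_norm// indicE.
Qed.

Lemma continuous_mol phi : test phi -> continuous (mol f phi).
Proof.
move=> tp x; apply: continuous_seqP => u ux.
have bp := test_bms tp; have [r rP] := bms_supp bp; have [C CP] := bms_bounded bp.
have [B BP] := cvg_seq_norm_bounded ux.
apply: (@mol_cvg _ _ (r + B) C).
- by move=> n; apply: measurable_fun_shift; case: bp.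
- move=> z; have cp := smooth_continuous (proj1 tp).
  apply: (cvg_comp _ _ (_ : z - u n @[n --> \oo] --> z - x) (cp (z - x))).
  by apply: cvgB => //; exact: cvg_cst.
- move=> n z; rewrite indicE; have [zr|zr] := leP `|z| (r + B).
    by rewrite mem_set// mulr1.
  rewrite rP; last first.
    have := ler_normD (z - u n) (u n); rewrite subrK; have := BP n; lra.
  by rewrite normr0 memNset ?mulr0//= /cball/=; apply/negP; rewrite -ltNge.
Qed.

(** The derivative falls on [phi], so [mol f phi] is as smooth as [phi]. *)
Lemma is_derive_mol phi i x : test phi ->
  is_derive x (e_ i) (mol f phi) (mol f (fun z => - partial i phi z) x).
Proof.
move=> tp; apply: is_derive_seqP => h h0 hcvg.
have bp := test_bms tp; have [r rP] := bms_supp bp.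
have bd := test_bms (partial_test i tp); have [L LP] := bms_bounded bd.
have [B BP] := cvg_seq_norm_bounded hcvg.
have shiftE n z : z - (h n *: e_ i + x) = - h n *: e_ i + (z - x) :> E.
  by rewrite scaleNr opprD addrCA.
have -> : (fun n => (h n)^-1 * (mol f phi (h n *: e_ i + x) - mol f phi x)) =
  (fun n => \int[mu]_z (f z * ((h n)^-1 * (phi (z - (h n *: e_ i + x)) - phi (z - x))))).
  apply/funext => n; rewrite /mol -RintB; [|exact: mol_intg..].
  rewrite -RintZ; last by apply: intgB; exact: mol_intg.
  by apply: eq_Rintegral => z _; ring.
apply: (@mol_cvg _ _ (r + `|x| + B) L).
- move=> n; apply: measurable_funM => //; apply: measurable_funB;
    by apply: measurable_fun_shift; case: bp.
- move=> z.
  have hN0 n : - h n != 0 by rewrite oppr_eq0.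
  have hNcvg : - h n @[n --> \oo] --> (0 : R) by rewrite -(@oppr0 R); exact: cvgN.
  have H := is_derive_seq (smooth_is_derive i (z - x) (proj1 tp)) hN0 hNcvg.
  rewrite (_ : (fun n => _) = fun n => - ((- h n)^-1 * (phi (- h n *: e_ i + (z - x)) - phi (z - x)))).
    exact: cvgN H.
  by apply/funext => n; rewrite shiftE invrN mulNr opprK.
- move=> n z; rewrite normrM normfV ler_pdivrMl ?normr_gt0//.
  rewrite indicE; have [zr|zr] := leP `|z| (r + `|x| + B).
    rewrite mem_set// mulr1 mulrC.
    have := @le_increment_line _ _ phi (partial i phi) (z - x) (e_ i) (- h n) L
      (fun s => smooth_is_derive i _ (proj1 tp)) (fun s _ => LP _).
    by rewrite normrN shiftE.
  have hB := le_trans (normr_e_ i (h n)) (BP n).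
  rewrite rP ?rP ?subrr ?normr0; last 2 first.
  - have := ler_normD (z - x) x; rewrite subrK; have := normr_ge0 (h n); have := BP n; lra.
  - have := ler_normD (z - (h n *: e_ i + x)) (h n *: e_ i + x); rewrite subrK.
    have := ler_normD (h n *: e_ i) x; lra.
  by rewrite memNset ?mulr0//= /cball/=; apply/negP; rewrite -ltNge.
Qed.

Lemma testN phi : test phi -> test (fun x => - phi x).
Proof. by move=> /(testZ (-1)); under eq_fun do rewrite mulN1r. Qed.

Lemma smooth_mol phi : test phi -> smooth (mol f phi).
Proof.
move=> tp k; elim: k phi tp => [phi tp|k IH phi tp]; first exact: continuous_mol.
apply: (@CkS _ _ _ _ (fun i => mol f (fun z => - partial i phi z))) => [i x|i].
  exact: is_derive_mol.
by apply: IH; apply: testN; exact: partial_test.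
Qed.

Lemma test_mol phi : test phi -> (exists r : R, forall x, r < `|x| -> f x = 0) ->
  test (mol f phi).
Proof.
move=> tp [r rP]; split; first exact: smooth_mol.
have [s sP] := proj2 tp; exists (r + s) => x xrs.
rewrite /mol (_ : (fun z => _) = fun=> 0) ?Rintegral_cst ?mul0r//.
apply/funext => z; have [zr|zr] := leP `|z| r; last by rewrite rP ?mul0r.
rewrite sP ?mulr0//; have := ler_normB (z - x) z.
by rewrite addrAC subrr sub0r normrN; lra.
Qed.

End mollify.
End integration_by_parts.

(** * Weak derivatives *)

Section mollifier.
Context {R : realType} {N : nat}.
Local Notation E := 'rV[R]_N.
Local Notation mu := (@lebesgue_rV R N).
Implicit Types (f g phi psi : E -> R) (x y z a b : E).

Lemma Rint_hat_gt0 (d : R) : 0 < d -> 0 < \int[mu]_x hat d x.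
Proof.
move=> d0; pose m := \prod_(i < N) (expR (- (d / 2)^-1) * expR (- (d / 2)^-1)).
have m0 : 0 < m by apply: prodr_gt0 => i _; rewrite mulr_gt0 ?expR_gt0.
pose B : set E := ocbox (const_mx (- (d / 2))) (const_mx (d / 2)).
have fl_ge s : d / 2 <= s -> expR (- (d / 2)^-1) <= fl s.
  move=> ds; have s0 : 0 < s by apply: lt_le_trans ds; lra.
  rewrite flE s0 ler_expR lerN2 lef_pV2 ?posrE//; lra.
have hatB x : m * \1_B x <= hat d x.
  rewrite indicE; have [xB|xB] := boolP (x \in B); last by rewrite mulr0 hat_ge0.
  rewrite mulr1; apply: ler_prod => i _; rewrite mulr_ge0 ?expR_ge0//=.
  move: xB; rewrite inE => /(_ i); rewrite in_itv/= !mxE => /andP[? ?].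
  by rewrite ler_pM ?expR_ge0// fl_ge//; lra.
have mB : mu B = (d ^+ N)%:E.
  rewrite lebesgue_ocbox => [|i]; last by rewrite !mxE; lra.
  congr (_%:E); rewrite -[in RHS](card_ord N) -prodr_const.
  by apply: eq_bigr => i _; rewrite !mxE; lra.
have iB : intg (\1_B : E -> R).
  by apply: intg_indic; [exact: measurable_ocbox|rewrite mB ltry].
apply: (@lt_le_trans _ _ (\int[mu]_x (m * \1_B x))).
  rewrite RintZ//; apply: mulr_gt0 => //.
  rewrite /Rintegral integral_indic//; last exact: measurable_ocbox.
  by rewrite setIT [X in fine X](_ : _ = (d ^+ N)%:E)//= exprn_gt0.
by apply: le_Rint => //; [exact: intgZ|apply: bms_intg; apply: test_bms; exact: test_hat].
Qed.

Definition eta (n : nat) : E -> R := fun x =>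
  (\int[mu]_x hat n.+1%:R^-1 x)^-1 * hat n.+1%:R^-1 x.

Let d0 n : 0 < n.+1%:R^-1 :> R. Proof. by rewrite invr_gt0. Qed.

Lemma test_eta n : test (eta n).
Proof. by apply: testZ; exact: test_hat. Qed.

Lemma eta_ge0 n x : 0 <= eta n x.
Proof. by rewrite mulr_ge0 ?hat_ge0// invr_ge0 ltW// Rint_hat_gt0. Qed.

Lemma eta_eq0 n x : n.+1%:R^-1 <= `|x| -> eta n x = 0.
Proof. by move=> nx; rewrite /eta hat_eq0 ?mulr0. Qed.

Lemma Rint_eta n : \int[mu]_x eta n x = 1.
Proof.
rewrite RintZ ?mulVf ?gt_eqF ?Rint_hat_gt0//.
by apply: bms_intg; apply: test_bms; exact: test_hat.
Qed.

Lemma intg_eta n x : intg (fun z => eta n (z - x)).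
Proof. by apply: bms_intg; apply: bms_shift; apply: test_bms; exact: test_eta. Qed.

Lemma Rint_eta_shift n x : \int[mu]_z eta n (z - x) = 1.
Proof.
rewrite (Rintegral_shift (- x)) ?Rint_eta//.
by apply: bms_intg; apply: test_bms; exact: test_eta.
Qed.

Lemma mol_bounded f n (C : R) x : locint f -> (forall y, `|f y| <= C) -> `|mol f (eta n) x| <= C.
Proof.
move=> lf fC; have i1 : intg (fun z => f z * eta n (z - x)).
  by apply: mol_intg => //; apply: test_bms; exact: test_eta.
apply: le_trans (normr_Rint i1) _; rewrite -[leRHS]mulr1 -(Rint_eta_shift n x) -RintZ; last exact: intg_eta.
apply: le_Rint; [exact: intg_norm|by apply: intgZ; exact: intg_eta|].
by move=> z; rewrite normrM (ger0_norm (eta_ge0 _ _)) ler_wpM2r ?eta_ge0.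
Qed.

Lemma mol_eta_eq0 f n (r : R) x : (forall y, r < `|y| -> f y = 0) -> r + 1 < `|x| ->
  mol f (eta n) x = 0.
Proof.
move=> fr xr; rewrite /mol (_ : (fun z => _) = fun=> 0) ?Rintegral_cst ?mul0r//.
apply/funext => z; have [zr|zr] := leP `|z| r; last by rewrite fr ?mul0r.
rewrite eta_eq0 ?mulr0//; have := ler_normB (z - x) z.
rewrite addrAC subrr sub0r normrN.
have : n.+1%:R^-1 <= 1 :> R by rewrite invf_le1// ler1n.
by move: (n.+1%:R^-1) => e; lra.
Qed.

Lemma mol_eta_cvg f x : continuous f -> mol f (eta n) x @[n --> \oo] --> f x.
Proof.
move=> cf; apply/cvgrPdist_le => e e0.
have /nbhs_ballP [d /= dgt0 dP] : \forall y \near x, `|f x - f y| <= e.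
  by have /cvgrPdist_le/(_ _ e0) := cf x.
have := near_infty_natSinv_lt (PosNum dgt0); apply: filterS => n /= nd.
have lf := continuous_locint cf.
have i1 : intg (fun z => f z * eta n (z - x)).
  by apply: mol_intg => //; apply: test_bms; exact: test_eta.
have i2 : intg (fun z => f x * eta n (z - x)) by apply: intgZ; exact: intg_eta.
have -> : f x = \int[mu]_z (f x * eta n (z - x)).
  by rewrite RintZ ?Rint_eta_shift ?mulr1//; exact: intg_eta.
rewrite /mol -RintB//; apply: le_trans (normr_Rint (intgB i2 i1)) _.
rewrite -[leRHS]mulr1 -(Rint_eta_shift n x) -RintZ; last exact: intg_eta.
apply: le_Rint; [by apply: intg_norm; exact: intgB|by apply: intgZ; exact: intg_eta|].
move=> z; rewrite -mulrBl normrM (ger0_norm (eta_ge0 _ _)).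
have [zx|zx] := leP n.+1%:R^-1 `|z - x|; first by rewrite eta_eq0 ?mulr0.
rewrite ler_wpM2r ?eta_ge0//; apply: dP; rewrite -ball_normE /= distrC.
exact: lt_trans zx nd.
Qed.

End mollifier.

Section weak_derivatives.
Context {R : realType} {N : nat}.
Local Notation E := 'rV[R]_N.
Local Notation mu := (@lebesgue_rV R N).
Implicit Types (f g phi psi : E -> R) (x y z : E).

Definition wderiv (i : 'I_N) (f g : E -> R) := [/\ locint f, locint g &
  forall phi, test phi -> \int[mu]_x (f x * partial i phi x) = - \int[mu]_x (g x * phi x)].

(** The defining identity of a weak derivative extends from smooth to
    continuously differentiable test functions, by mollifying the latter. *)
Lemma wderiv_C1 i f g psi dpsi : wderiv i f g -> continuous psi -> continuous dpsi ->
  (forall x, is_derive x (e_ i) psi (dpsi x)) -> (exists r : R, forall x, r < `|x| -> psi x = 0) ->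
  \int[mu]_x (f x * dpsi x) = - \int[mu]_x (g x * psi x).
Proof.
move=> [lf lg fg] cp cd dP [r rP].
have dr := supp_derive dP rP.
have bp : bms psi by apply: continuous_bms => //; exists r.
have bd : bms dpsi by apply: continuous_bms => //; exists r.
have lp := bms_locint bp; have ld := bms_locint bd.
have molE n : partial i (mol psi (eta n)) = mol dpsi (eta n).
  apply/funext => x; rewrite (partialE (is_derive_mol lp i x (test_eta n))).
  have tz := shift_test (- x) (test_eta (R := R) (N := N) n).
  have dz z : is_derive z (e_ i) (fun z => eta n (z - x)) (partial i (eta n) (z - x)).
    by apply: is_derive_shift_rV; apply: smooth_is_derive; case: (test_eta (R := R) (N := N) n).
  have i1 : intg (fun z => psi z * partial i (eta n) (z - x)).
    by apply: mol_intg => //; apply: test_bms; apply: partial_test; exact: test_eta.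
  have i2 : intg (fun z => dpsi z * eta n (z - x)).
    by apply: mol_intg => //; apply: test_bms; exact: test_eta.
  have bt := test_bms tz.
  have H : \int[mu]_z (psi z * partial i (eta n) (z - x) + eta n (z - x) * dpsi z) = 0.
    apply: (@Rint_derive0 R N (fun z => psi z * eta n (z - x)) _ i).
    - by move=> z; apply: is_deriveM.
    - exact: bmsMbms.
    - apply: bmsD; apply: bmsMbms => //.
      by apply: bms_shift; apply: test_bms; apply: partial_test; exact: test_eta.
  have i2' : intg (fun z => eta n (z - x) * dpsi z) by under eq_fun do rewrite mulrC.
  rewrite RintD// in H; rewrite /mol.
  under eq_Rintegral do rewrite mulrN; under [in RHS]eq_Rintegral do rewrite mulrC.
  by rewrite RintN//; apply/eqP; rewrite eq_sym -subr_eq0 opprK addrC H.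
have molcvg h q : locint h -> continuous q -> (forall x, r < `|x| -> q x = 0) ->
    \int[mu]_x (h x * mol q (eta n) x) @[n --> \oo] --> \int[mu]_x (h x * q x).
  move=> lh cq qr; have bq : bms q by apply: continuous_bms => //; exists r.
  have lq := bms_locint bq; have [C CP] := bms_bounded bq.
  apply: (@mol_cvg _ _ _ lh _ _ (r + 1) C).
  - move=> n; apply: continuous_measurable_rV; apply: continuous_mol => //.
    exact: test_eta.
  - by move=> x; exact: mol_eta_cvg.
  - move=> n x; rewrite indicE; have [xr|xr] := leP `|x| (r + 1).
      by rewrite mem_set// mulr1 mol_bounded.
    rewrite (mol_eta_eq0 _ qr)// normr0 memNset ?mulr0//= /cball/=.
    by apply/negP; rewrite -ltNge.
have cvg1 := molcvg _ _ lf cd dr.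
have cvg2 := molcvg _ _ lg cp rP.
have EN : (fun n => \int[mu]_x (f x * mol dpsi (eta n) x)) =
    (fun n => - \int[mu]_x (g x * mol psi (eta n) x)).
  apply/funext => n; rewrite -fg ?molE//; apply: test_mol => //; first exact: test_eta.
  by exists r.
have <- := cvg_lim (@Rhausdorff R) cvg1; rewrite EN.
by apply: (cvg_lim (@Rhausdorff R)); exact: cvgN.
Qed.

Lemma locint_shift h f : locint f -> locint (fun x => f (x + h)).
Proof.
move=> lf; split => [|r]; first by apply: measurable_fun_shift; case: lf.
have bi : bms (fun x : E => \1_(cball r) (x - h)).
  by apply: bms_shift; apply: (@bms_indic _ _ _ r) => //; exact: measurable_cball.
have := integrable_shift h (locint_bms lf bi).
by rewrite /intg; congr integrable; apply/funext => x /=; rewrite addrK.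
Qed.

Lemma locintN f : locint f -> locint (fun x => - f x).
Proof.
move=> [mf fi]; split => [|r]; first exact: measurable_funN.
by under eq_fun do rewrite mulNr; exact: intgN.
Qed.

(** The L2 modulus of continuity of [f] is controlled by its weak derivative:
    by duality it is enough to test against smooth [phi], for which
    [s |-> \int f (phi (. - s e_i))] has derivative [\int g (phi (. - s e_i))]. *)
Lemma wderiv_translation i f g (t : R) : wderiv i f g ->
  (\int[mu]_x ((f (x + t *: e_ i) - f x) ^+ 2)%:E <= (t ^+ 2)%:E * \int[mu]_x (g x ^+ 2)%:E)%E.
Proof.
move=> [lf lg fg]; have [->|t0] := eqVneq t 0.
  under eq_integral do rewrite scale0r addr0 subrr expr0n.
  by rewrite integral0 expr0n mul0e.
have lft : locint (fun x => f (x + t *: e_ i) - f x).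
  by apply: locintD; [exact: locint_shift|exact: locintN].
have [gy|gy] := eqVneq (\int[mu]_x (g x ^+ 2)%:E)%E +oo%E.
  by rewrite gy gt0_muley ?leey// lte_fin exprn_even_gt0.
have mg : measurable_fun setT g by case: lg.
have ig : intg (fun x => g x ^+ 2).
  apply: ge0_intgP; [exact: measurable_funX|by move=> x; exact: sqr_ge0|].
  by rewrite lt_neqAle gy leey.
rewrite -[X in (_ * X)%E]EFin_Rint// -EFinM leNgt; apply/negP => /(sqr_dual_test lft) [phi tp].
apply/negP; rewrite -leNgt.
have bp := test_bms tp.
have bps s : bms (fun z => phi (z - s *: e_ i)) by exact: bms_shift.
have lft1 : locint (fun x => f (x + t *: e_ i)) by exact: locint_shift.
pose th (s : R) := mol f phi (s *: e_ i + 0).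
have E1 : \int[mu]_x ((f (x + t *: e_ i) - f x) * phi x) = th t - mol f phi 0.
  have i1 : intg (fun x => f (x + t *: e_ i) * phi x) by exact: locint_bms.
  have i2 : intg (fun x => f x * phi x) by exact: locint_bms.
  under eq_Rintegral do rewrite mulrBl.
  rewrite RintB// /th addr0; congr (_ - _).
    rewrite /mol -[RHS](Rintegral_shift (t *: e_ i)); last exact: locint_bms.
    by apply: eq_Rintegral => x _; rewrite addrK.
  by apply: eq_Rintegral => x _; rewrite subr0.
have ip2 : intg (fun x => phi x ^+ 2) by apply: bms_intg; exact: bms_sqr.
have ip : intg (fun x => (f (x + t *: e_ i) - f x) * phi x) by exact: locint_bms.
rewrite RintB//; last exact: intgZ.
rewrite RintZ// E1 lerBlDr.
have gbound s : 2 * `|t| * `|\int[mu]_z (g z * phi (z - s *: e_ i))| <=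
    t ^+ 2 * \int[mu]_x (g x ^+ 2) + \int[mu]_x (phi x ^+ 2).
  have i1 : intg (fun z => g z * phi (z - s *: e_ i)) by exact: locint_bms.
  have i2 : intg (fun z => phi (z - s *: e_ i) ^+ 2) by apply: bms_intg; exact: bms_sqr.
  rewrite -[X in _ + X](Rintegral_shift (- (s *: e_ i))) -?RintZ// -RintD//; last exact: intgZ.
  apply: (@le_trans _ _ (\int[mu]_z (2 * `|t| * `|g z * phi (z - s *: e_ i)|))).
    by rewrite RintZ; [rewrite ler_wpM2l ?normr_Rint ?mulr_ge0|exact: intg_norm].
  apply: le_Rint; [by apply: intgZ; exact: intg_norm|by apply: intgD => //; exact: intgZ|].
  move=> z; rewrite normrM; have := sqr_ge0 (`|t| * `|g z| - `|phi (z - s *: e_ i)|).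
  by rewrite sqrrB exprMn !real_normK ?num_real//; lra.
have gE s : mol f (fun z => - partial i phi z) (s *: e_ i + 0) =
    \int[mu]_z (g z * phi (z - s *: e_ i)).
  rewrite addr0 /mol; under eq_Rintegral do rewrite mulrN.
  have i1 : intg (fun z => f z * partial i phi (z - s *: e_ i)).
    by apply: mol_intg => //; apply: test_bms; exact: partial_test.
  have ts := shift_test (- (s *: e_ i)) tp.
  rewrite RintN//; apply: oppr_inj; rewrite opprK; apply: etrans (fg _ ts).
  apply: eq_Rintegral => z _; congr (_ * _); apply/esym; apply: partialE.
  by apply: is_derive_shift_rV; apply: smooth_is_derive; case: tp.
set A := t ^+ 2 * _ + _ in gbound *.
have t2 : 0 < 2 * `|t| by rewrite mulr_gt0// normr_gt0.
have H : `|th t - mol f phi 0| <= A / (2 * `|t|) * `|t|.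
  apply: (@le_increment_line _ _ (mol f phi) (mol f (fun z => - partial i phi z))) => [s|s _].
    exact: is_derive_mol.
  by rewrite gE ler_pdivlMr// mulrC.
have := le_trans (ler_norm _) H.
have -> : A / (2 * `|t|) * `|t| = A / 2.
  by rewrite invfM mulrA mulfVK// normr_eq0.
lra.
Qed.

End weak_derivatives.

(** * A subcritical Sobolev inequality *)

Section nonneg_integrals.
Context {R : realType} {N : nat}.
Local Notation E := 'rV[R]_N.
Local Notation mu := (@lebesgue_rV R N).
Implicit Types (f g : E -> R) (x y z h : E).

Lemma nnint_ge0 f : (forall x, 0 <= f x) -> (0 <= \int[mu]_x (f x)%:E)%E.
Proof. by move=> f0; apply: integral_ge0 => x _; rewrite lee_fin. Qed.

Lemma nnint_le f g : measurable_fun setT f -> measurable_fun setT g ->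
  (forall x, 0 <= f x) -> (forall x, f x <= g x) ->
  (\int[mu]_x (f x)%:E <= \int[mu]_x (g x)%:E)%E.
Proof.
move=> mf mg f0 fg; apply: ge0_le_integral => //.
- by move=> x _; rewrite lee_fin.
- exact/measurable_EFinP.
- exact/measurable_EFinP.
- by move=> x _; rewrite lee_fin.
Qed.

Lemma nnintD f g : measurable_fun setT f -> measurable_fun setT g ->
  (forall x, 0 <= f x) -> (forall x, 0 <= g x) ->
  (\int[mu]_x (f x + g x)%:E = \int[mu]_x (f x)%:E + \int[mu]_x (g x)%:E)%E.
Proof.
move=> mf mg f0 g0; under eq_integral do rewrite EFinD.
by apply: ge0_integralD => //;
  [move=> x _; rewrite lee_fin|exact/measurable_EFinP|move=> x _; rewrite lee_fin|exact/measurable_EFinP].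
Qed.

Lemma nnintZ (c : R) f : measurable_fun setT f -> (forall x, 0 <= f x) -> 0 <= c ->
  (\int[mu]_x (c * f x)%:E = c%:E * \int[mu]_x (f x)%:E)%E.
Proof.
move=> mf f0 c0; under eq_integral do rewrite EFinM.
by apply: ge0_integralZl_EFin => //; [move=> x _; rewrite lee_fin|exact/measurable_EFinP].
Qed.

Lemma nnint_shift h f : measurable_fun setT f -> (forall x, 0 <= f x) ->
  (\int[mu]_x (f (x + h))%:E = \int[mu]_x (f x)%:E)%E.
Proof.
move=> mf f0; apply: (ge0_integral_shift h (f := fun x => (f x)%:E)).
  exact/measurable_EFinP.
by move=> x; rewrite lee_fin.
Qed.

Lemma nnint_sum (I : Type) (s : seq I) (F : I -> E -> R) :
  (forall i, measurable_fun setT (F i)) -> (forall i x, 0 <= F i x) ->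
  (\int[mu]_x (\sum_(i <- s) F i x)%:E = \sum_(i <- s) \int[mu]_x (F i x)%:E)%E.
Proof.
move=> mF F0; under eq_integral do rewrite -sumEFin.
by apply: ge0_integral_sum => //; [move=> i; exact/measurable_EFinP|move=> i x _; rewrite lee_fin].
Qed.

Lemma nnint_indic (A : set E) : measurable A -> (\int[mu]_x (\1_A x : R)%:E = mu A)%E.
Proof. by move=> mA; rewrite integral_indic// setIT. Qed.

Definition superlevel f (l : R) : set E := [set x | l < f x].

Lemma measurable_gt f (l : R) : measurable_fun setT f -> measurable (superlevel f l).
Proof.
move=> mf; have -> : superlevel f l = f @^-1` `]l, +oo[.
  by apply/seteqP; split => x /=; rewrite in_itv/= andbT.
by rewrite -[X in measurable X]setTI; apply: mf.
Qed.

Lemma lebesgue_shift_preimage h (A : set E) : measurable A ->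
  mu [set x | A (x + h)] = mu A.
Proof. by move=> mA; exact: lebesgue_shift. Qed.

Lemma measurable_shift_preimage h (A : set E) : measurable A ->
  measurable [set x | A (x + h)].
Proof. by move=> mA; rewrite -[X in measurable X]setTI; apply: measurable_shift. Qed.

Lemma measurable_fun_powR f (p : R) : measurable_fun setT f -> measurable_fun setT (fun x => f x `^ p).
Proof. by move=> mf; exact: (measurableT_comp (measurable_powR p) mf). Qed.

Lemma powR_markov f (l p : R) : measurable_fun setT f -> (forall x, 0 <= f x) ->
  0 < l -> 0 <= p ->
  ((l `^ p)%:E * mu (superlevel f l) <= \int[mu]_x (f x `^ p)%:E)%E.
Proof.
move=> mf f0 l0 p0; have mS := measurable_gt l mf.
rewrite -nnint_indic// -nnintZ ?powR_ge0//.
apply: nnint_le => //.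
- by apply: measurable_funM => //; exact: measurable_indic.
- exact: measurable_fun_powR.
- by move=> x; rewrite mulr_ge0 ?powR_ge0.
- move=> x; rewrite indicE; have [|_] := boolP (x \in _).
    rewrite inE /superlevel/= => /ltW lx; rewrite mulr1.
    by apply: ge0_ler_powR; rewrite ?nnegrE ?f0 ?(ltW l0).
  by rewrite mulr0 powR_ge0.
Qed.

End nonneg_integrals.

Lemma powRDpos (R : realType) (a x y : R) : 0 < a -> a `^ (x + y) = a `^ x * a `^ y.
Proof. by move=> a0; apply: powRD; rewrite (gt_eqF a0) implybT. Qed.

Lemma dyadic_powR (R : realType) (p s : R) (j : nat) :
  (2 ^+ j.+1) `^ p * (2 ^+ j) `^ (- s) = 2 `^ p * (2 `^ (p - s)) ^+ j.
Proof.
have t0 : 0 < 2 ^+ j :> R by exact: exprn_gt0.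
rewrite exprS powRM ?(ltW t0)// -[LHS]mulrA -(powRDpos _ _ t0); congr (_ * _).
rewrite -(powR_mulrn j (powR_ge0 _ _)) -powRrM mulrC powRrM.
by rewrite (powR_mulrn j (ler0n _ 2)).
Qed.

Lemma absorb (R : realType) (X C e : R) : 0 <= X -> C * e <= 2^-1 ->
  X <= e + C * (1 + X) * e -> X <= 2 * (1 + C) * e.
Proof. by move=> X0 Ce; have : 0 <= X * (2^-1 - C * e); [rewrite mulr_ge0 ?subr_ge0|nra]. Qed.

Section sobolev.
Context {R : realType} {N : nat}.
Local Notation E := 'rV[R]_N.
Local Notation mu := (@lebesgue_rV R N).
Implicit Types (f g : E -> R) (x y z h : E).

(** A function whose gradient has square integral at most [e] satisfies this with
    a multiple of [e]. The bound on increments stands in for the gradient below,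
    because it passes visibly to truncations, multiples and differences. *)
Definition transl_bound f (e : R) := forall (r : R) h, 0 <= r -> `|h| <= r ->
  (\int[mu]_x ((f (x + h) - f x) ^+ 2)%:E <= (r ^+ 2 * e)%:E)%E.

Hypothesis N_gt1 : (1 < N)%N.

Definition cube0 (r : R) : set E := ocbox 0 (const_mx r).

Lemma cube0_le (r : R) h : 0 <= r -> cube0 r h -> `|h| <= r.
Proof.
move=> r0 hr; apply: normr_rV_le => // i; have := hr i.
by rewrite in_itv/= !mxE => /andP[h0 ?]; rewrite ger0_norm// ltW.
Qed.

Lemma lebesgue_cube0 (r : R) : 0 <= r -> mu (cube0 r) = (r ^+ N)%:E.
Proof.
move=> r0; rewrite /cube0 lebesgue_ocbox => [|i]; last by rewrite !mxE.
congr (_%:E); rewrite -[in RHS](card_ord N) -prodr_const.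
by apply: eq_bigr => i _; rewrite !mxE subr0.
Qed.

Lemma measurable_add_pair f : measurable_fun setT f ->
  measurable_fun setT (fun z : E * E => f (z.1 + z.2)).
Proof.
move=> mf; apply: (measurableT_comp mf); apply: measurable_fun_rVP => i.
rewrite (_ : _ \o _ = fun z : E * E => (z.1 ord0 i : measurableTypeR R) + z.2 ord0 i); last first.
  by apply/funext => z /=; rewrite mxE.
by apply: measurable_funD; apply: (measurableT_comp (measurable_coor_rV i)).
Qed.

(** At a point where [f > l], at least half of the translations in the cube of
    side [r] lead to points where [f <= l / 2], and each of these contributes at
    least [l ^ 2 / 4] to the squared increments. *)
Lemma transl_bound_level f (e l r : R) : measurable_fun setT f -> 0 <= e -> transl_bound f e ->
  0 < l -> 0 < r -> (mu (superlevel f (l / 2)) <= (r ^+ N / 2)%:E)%E ->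
  (mu (superlevel f l) <= (8 * r ^+ 2 * e / l ^+ 2)%:E)%E.
Proof.
move=> mf e0 tb l0 r0 half.
have mQ : measurable (cube0 r) by exact: measurable_ocbox.
have mS := measurable_gt l mf.
pose F (z : E * E) : \bar R := ((f (z.1 + z.2) - f z.1) ^+ 2 * \1_(cube0 r) z.2)%:E.
have mF : measurable_fun setT F.
  apply/measurable_EFinP; apply: measurable_funM.
    apply: measurable_funX; apply: measurable_funB; first exact: measurable_add_pair.
    exact: (measurableT_comp mf).
  by apply: (measurableT_comp (measurable_indic mQ)).
have F0 (q : E * E) : (0 <= F q)%E by rewrite lee_fin mulr_ge0 ?sqr_ge0// indicE.
have rN0 : 0 < r ^+ N by exact: exprn_gt0.
(* Tonelli: bound the double integral of the squared increments in both orders *)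
have up : (\int[mu]_h \int[mu]_x F (x, h) <= (r ^+ N * (r ^+ 2 * e))%:E)%E.
  rewrite EFinM -lebesgue_cube0 ?(ltW r0)// muleC -nnint_indic//.
  rewrite -nnintZ //; last by rewrite mulr_ge0// sqr_ge0.
  apply: ge0_le_integral => //.
  - by move=> h _; apply: integral_ge0.
  - exact: (measurable_fun_fubini_tonelli_G F).
  - by apply/measurable_EFinP; apply: measurable_funM => //; exact: measurable_indic.
  - move=> h _; rewrite /F/= indicE; have [|hQ] := boolP (h \in cube0 r).
      rewrite inE => hQ; under eq_integral do rewrite mulr1.
      by rewrite mulr1; apply: tb; [exact: ltW|exact: cube0_le (ltW r0) _].
    by under eq_integral do rewrite mulr0; rewrite integral0 mulr0.
have low : ((l ^+ 2 * r ^+ N / 8)%:E * mu (superlevel f l) <= \int[mu]_x \int[mu]_h F (x, h))%E.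
  rewrite -nnint_indic// -nnintZ //; last by rewrite divr_ge0// mulr_ge0 ?sqr_ge0// ltW.
  apply: ge0_le_integral => //.
  - by move=> x _; rewrite lee_fin mulr_ge0 ?indicE// divr_ge0// mulr_ge0 ?sqr_ge0// ltW.
  - by apply/measurable_EFinP; apply: measurable_funM => //; exact: measurable_indic.
  - exact: (measurable_fun_fubini_tonelli_F F).
  move=> x _; rewrite indicE; have [|xS] := boolP (x \in superlevel f l); last first.
    by rewrite mulr0; apply: integral_ge0.
  rewrite inE /superlevel/= mulr1 => lx.
  pose A := [set h | superlevel f (l / 2) (h + x)].
  have mA : measurable A by apply: measurable_shift_preimage; exact: measurable_gt.
  have muA : mu A = mu (superlevel f (l / 2)).
    by apply: lebesgue_shift_preimage; exact: measurable_gt.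
  have mQA : measurable (cube0 r `\` A) by exact: measurableD.
  have QA : ((r ^+ N / 2)%:E <= mu (cube0 r `\` A))%E.
    have : (mu (cube0 r) <= mu (cube0 r `\` A) + mu A)%E.
      apply: le_trans (measureU2 _ mQA mA).
      by apply: le_measure; rewrite ?inE//; [exact: measurableU|move=> h hQ; have [hA|hA] := pselect (A h); [right|left]].
    rewrite lebesgue_cube0 ?(ltW r0)// => /le_trans -/(_ (mu (cube0 r `\` A) + (r ^+ N / 2)%:E)%E).
    rewrite leeD2l ?muA// => /(_ isT).
    case: (mu (cube0 r `\` A)) => [s| |] //; last by rewrite !leey.
    by rewrite !lee_fin; lra.
  apply: (@le_trans _ _ ((l ^+ 2 / 4)%:E * mu (cube0 r `\` A))%E).
    have -> : (l ^+ 2 * r ^+ N / 8)%:E = ((l ^+ 2 / 4)%:E * (r ^+ N / 2)%:E)%E.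
      by rewrite -EFinM; congr (_%:E); lra.
    by rewrite lee_pmul2l// lte_fin divr_gt0// exprn_gt0.
  rewrite -nnint_indic// -nnintZ //; last by rewrite divr_ge0// sqr_ge0.
  apply: nnint_le => /=.
  - by apply: measurable_funM => //; exact: measurable_indic.
  - apply: measurable_funM; last exact: measurable_indic.
    apply: measurable_funX; apply: measurable_funB; last exact: measurable_cst.
    by under eq_fun do rewrite addrC; exact: measurable_fun_shift.
  - by move=> h; rewrite mulr_ge0 ?indicE// divr_ge0// sqr_ge0.
  - move=> h; rewrite !indicE setDE in_setI in_setC /=; have [hQ|hQ] := boolP (h \in cube0 r).
      have [hA|hA] := boolP (h \in A); first by rewrite mulr0 mulr_ge0 ?sqr_ge0.
      rewrite !mulr1; move/negP : hA; rewrite inE /A /superlevel/= => /negP; rewrite -leNgt addrC.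
      move: lx; move: (f x) (f (x + h)) => a b la bl.
      have : l / 2 <= a - b by lra.
      have : 0 <= l / 2 by lra.
      nra.
    by rewrite mulr0 mulr0.
have : ((l ^+ 2 * r ^+ N / 8)%:E * mu (superlevel f l) <= (r ^+ N * (r ^+ 2 * e))%:E)%E.
  by apply: le_trans low _; rewrite (fubini_tonelli F mF F0).
have l20 : 0 < l ^+ 2 by exact: exprn_gt0.
case: (mu (superlevel f l)) => [s| |]; last by rewrite leNye.
  rewrite -EFinM !lee_fin => H; rewrite ler_pdivlMr// -(ler_pM2r rN0).
  by rewrite -(ler_pM2l (ltr0n R 8)) in H; lra.
by rewrite gt0_muley ?leye_eq// lte_fin divr_gt0// mulr_gt0.
Qed.

Lemma transl_bound_min f (e L : R) : measurable_fun setT f -> transl_bound f e ->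
  transl_bound (fun x => Num.min (f x) L) e.
Proof.
move=> mf tb r h r0 hr; apply: le_trans (tb r h r0 hr).
have mm : measurable_fun setT (fun x => Num.min (f x) L) by exact: measurable_minr.
apply: nnint_le.
- by apply: measurable_funX; apply: measurable_funB => //; exact: measurable_fun_shift mm.
- by apply: measurable_funX; apply: measurable_funB => //; exact: measurable_fun_shift mf.
- by move=> x; exact: sqr_ge0.
- move=> x; rewrite -[leLHS]real_normK ?num_real// -[leRHS]real_normK ?num_real//.
  rewrite lerXn2r ?nnegrE//; move: (f (x + h)) (f x) => a b.
  have [aL|aL] := leP a L; have [bL|bL] := leP b L; rewrite ?subrr ?normr0//.
  + by rewrite ler_norml; have := ler_norm (b - a); rewrite distrC => ?; apply/andP; split; lra.
  + by rewrite ler_norml; have := ler_norm (a - b) => ?; apply/andP; split; lra.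
Qed.

Let N0 : 0 < N%:R :> R. Proof. by rewrite ltr0n ltnW. Qed.

Lemma subcritical_ratio (p : R) : p * (N%:R - 2) < 2 * N%:R -> 2 `^ (p - 2 - 2 * p / N%:R) < 1 :> R.
Proof.
move=> pcrit; have E1 : p - 2 - 2 * p / N%:R < 0.
  have -> : p - 2 - 2 * p / N%:R = (p * (N%:R - 2) - 2 * N%:R) / N%:R.
    by field; rewrite gt_eqF.
  by rewrite pmulr_llt0 ?invr_gt0// subr_lt0.
rewrite -oppr_gt0 in E1; rewrite -(opprK (p - 2 - _)) powRN invf_lt1 ?powR_gt0//.
by have := @gt0_ltr_powR R _ E1 1 2; rewrite !nnegrE powR1 => -> //; rewrite ltr1n.
Qed.

(** The side [r] of the cube is chosen so that, by Markov's inequality for the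
    p-th power, the set [f > l / 2] has at most half of its volume. The exponent
    of [l] so obtained exceeds 2, and the excess makes the dyadic sum in the next
    estimate converge when [p] is subcritical. *)
Lemma transl_bound_weak (p : R) f (e l X : R) : 0 < p -> measurable_fun setT f -> (forall x, 0 <= f x) ->
  0 <= e -> transl_bound f e ->
  0 < l -> 0 <= X -> (\int[mu]_x (f x `^ p)%:E <= X%:E)%E ->
  (mu (superlevel f l) <= (8 * 2 `^ (p + 1) * (1 + X) * e * l `^ (- (2 + 2 * p / N%:R)))%:E)%E.
Proof.
move=> p0 mf f0 e0 tb l0 X0 fX.
pose B := 2 `^ (p + 1) * (1 + X).
have B1 : 1 <= B.
  have : 1 <= 2 `^ (p + 1) :> R by rewrite -[leLHS](powRr0 (2 : R)) ler_powR//; lra.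
  rewrite /B; nra.
pose r := B `^ (N%:R^-1) * l `^ (- (p / N%:R)).
have r0 : 0 < r by rewrite mulr_gt0 ?powR_gt0//; lra.
have rN : r ^+ N = B * l `^ (- p).
  rewrite exprMn -!powR_mulrn ?powR_ge0// -!powRrM mulVf ?gt_eqF// powRr1; last lra.
  by congr (_ * _ `^ _); field; rewrite gt_eqF.
have half : (mu (superlevel f (l / 2)) <= (r ^+ N / 2)%:E)%E.
  have l20 : 0 < l / 2 by lra.
  have := le_trans (powR_markov mf f0 l20 (ltW p0)) fX.
  have lp0 : 0 < (l / 2) `^ p by exact: powR_gt0.
  case: (mu _) => [s| |]; [|by rewrite gt0_muley ?leye_eq// lte_fin|by rewrite leNye].
  rewrite -EFinM !lee_fin mulrC -ler_pdivlMr// => /le_trans; apply.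
  rewrite rN /B powRD; last by apply/implyP => _; apply/eqP; lra.
  rewrite powRr1 ?ler0n//.
  have E2 : 2^-1 `^ p = (2 `^ p)^-1 :> R by rewrite -powR_inv1// -powRrM mulN1r powRN.
  rewrite powRM ?invr_ge0 ?(ltW l0)// E2 powRN invfM invrK.
  have := powR_gt0 p l0; have := powR_gt0 p (ltr0n R 2).
  move: (2 `^ p) (l `^ p) => T W T0 W0.
  have -> : T * 2 * (1 + X) / W / 2 = (1 + X) * (W^-1 * T) by field; rewrite gt_eqF.
  by rewrite mulrDl mul1r lerDr mulr_ge0 ?invr_ge0 ?ltW.
have := transl_bound_level mf e0 tb l0 r0 half; move/le_trans; apply; rewrite lee_fin.
have r2 : r ^+ 2 <= B * l `^ (- (2 * p / N%:R)).
  rewrite exprMn -!powR_mulrn ?powR_ge0// -!powRrM.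
  rewrite (_ : - (p / N%:R) * 2 = - (2 * p / N%:R)); last by ring.
  by rewrite ler_wpM2r ?powR_ge0// ler1_powR// ler_pdivrMl// mulr1 ler_nat.
have -> : l `^ (- (2 + 2 * p / N%:R)) = l ^- 2 * l `^ (- (2 * p / N%:R)).
  rewrite opprD powRDpos//.
  by congr (_ * _); rewrite powRN (powR_mulrn 2 (ltW l0)).
rewrite -/B.
have -> : 8 * 2 `^ (p + 1) * (1 + X) * e * (l ^- 2 * l `^ (- (2 * p / N%:R))) =
  8 * (B * l `^ (- (2 * p / N%:R))) * e / l ^+ 2 by rewrite /B; ring.
by rewrite ler_wpM2r ?invr_ge0 ?sqr_ge0// ler_wpM2r// ler_wpM2l.
Qed.

(** A layer-cake decomposition of [t ^ p] over dyadic levels; the term [t ^ 2]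
    takes care of the values at most 1. *)
Lemma dyadic_bound (p : R) (J : nat) (t : R) : 2 <= p -> 0 <= t -> t <= 2 ^+ J ->
  t `^ p <= t ^+ 2 + \sum_(j < J) (2 ^+ j.+1) `^ p * (2 ^+ j < t)%R%:R.
Proof.
move=> p2 t0; elim: J => [|J IH] tJ.
  rewrite big_ord0 addr0 -(powR_mulrn 2 t0); have [->|tn0] := eqVneq t 0.
    by rewrite powR0 ?powR_ge0//; apply/eqP; lra.
  by apply: ger_powR => //; rewrite lt_neqAle eq_sym tn0 t0 -[leRHS](expr0 (2 : R)).
rewrite big_ord_recr/=; have [tJ'|tJ'] := leP t (2 ^+ J).
  by rewrite mulr0 addr0; exact: IH.
have : t `^ p <= (2 ^+ J.+1) `^ p.
  by apply: ge0_ler_powR => //; rewrite ?nnegrE ?exprn_ge0//; lra.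
rewrite mulr1; move/le_trans; apply; rewrite addrA lerDr addr_ge0 ?sqr_ge0//.
by apply: sumr_ge0 => j _; rewrite mulr_ge0 ?powR_ge0.
Qed.

(** Summing the level set estimates bounds the p-th moment [X] by
    [e + C (1 + X) e], and [X] is absorbed on the left when [e] is small. This
    requires [X] to be finite beforehand, which boundedness of [f] ensures. *)
Lemma sobolev_bounded (p : R) : 2 < p -> p * (N%:R - 2) < 2 * N%:R ->
  exists2 C : R, 0 <= C & forall f e (J : nat), measurable_fun setT f -> (forall x, 0 <= f x) ->
    (forall x, f x <= 2 ^+ J) -> 0 <= e ->
    (\int[mu]_x (f x ^+ 2)%:E <= e%:E)%E -> transl_bound f e -> C * e <= 2^-1 ->
    (\int[mu]_x (f x `^ p)%:E <= (2 * (1 + C) * e)%:E)%E.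
Proof.
move=> p2 /subcritical_ratio; set q := 2 `^ _ => q1.
have q0 : 0 < q by exact: powR_gt0.
have p0 : 0 < p by exact: lt_trans p2.
have p2n0 : 2 <= p by exact: ltW.
pose C : R := 8 * 2 `^ (p + 1) * 2 `^ p / (1 - q).
have C0 : 0 <= C by rewrite divr_ge0 ?mulr_ge0 ?powR_ge0 ?subr_ge0// ltW.
exists C => // f e J mf f0 fJ e0 f2 tb Ce.
have mfp : measurable_fun setT (fun x => f x `^ p) by exact: measurable_fun_powR.
have fp0 x : 0 <= f x `^ p by exact: powR_ge0.
have Xfin : (\int[mu]_x (f x `^ p)%:E < +oo)%E.
  apply: (@le_lt_trans _ _ (((2 ^+ J) `^ (p - 2))%:E * \int[mu]_x (f x ^+ 2)%:E)%E); last first.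
    apply: (@le_lt_trans _ _ (((2 ^+ J) `^ (p - 2))%:E * e%:E)%E); last by rewrite -EFinM ltry.
    by apply: lee_wpmul2l => //; rewrite lee_fin powR_ge0.
  rewrite -nnintZ ?powR_ge0//; [|exact: measurable_funX|by move=> x; exact: sqr_ge0].
  apply: nnint_le => //; first by apply: measurable_funM => //; exact: measurable_funX.
  move=> x; have [->|fx0] := eqVneq (f x) 0.
    by rewrite powR0 ?gt_eqF// expr0n mulr0.
  rewrite -[X in X <= _](_ : f x `^ (p - 2) * f x ^+ 2 = _); last first.
    by rewrite -(powR_mulrn 2 (f0 x)) -powRDpos ?subrK// lt_neqAle eq_sym fx0 f0.
  rewrite ler_wpM2r ?sqr_ge0//; apply: ge0_ler_powR; rewrite ?nnegrE ?exprn_ge0//.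
  by rewrite subr_ge0.
have ip : intg (fun x => f x `^ p) by exact: ge0_intgP.
set X := \int[mu]_x (f x `^ p).
have XE : (\int[mu]_x (f x `^ p)%:E = X%:E)%E by rewrite EFin_Rint.
have X0 : 0 <= X by exact: Rint_ge0.
have level j : ((((2 ^+ j.+1) `^ p)%:E * mu (superlevel f (2 ^+ j))) <=
    (8 * 2 `^ (p + 1) * (1 + X) * e * (2 `^ p * q ^+ j))%:E)%E.
  have l0 : 0 < 2 ^+ j :> R by exact: exprn_gt0.
  have XX : (\int[mu]_x (f x `^ p)%:E <= X%:E)%E by rewrite XE.
  have H := transl_bound_weak p0 mf f0 e0 tb l0 X0 XX.
  apply: (le_trans (lee_wpmul2l _ H)); first by rewrite lee_fin powR_ge0.
  rewrite -EFinM lee_fin mulrCA le_eqVlt; apply/orP; left; apply/eqP; congr (_ * _).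
  by rewrite dyadic_powR opprD addrA.
have : (X%:E <= (e + C * (1 + X) * e)%:E)%E.
  rewrite -XE.
  apply: (@le_trans _ _ (\int[mu]_x (f x ^+ 2 + \sum_(j < J) (2 ^+ j.+1) `^ p * \1_(superlevel f (2 ^+ j)) x)%:E)%E).
    apply: nnint_le => //.
    - apply: measurable_funD; first exact: measurable_funX.
      apply: measurable_sum => j; apply: measurable_funM => //.
      by apply: measurable_indic; exact: measurable_gt.
    - move=> x; apply: le_trans (dyadic_bound p2n0 (f0 x) (fJ x)) _.
      rewrite lerD2l; apply: ler_sum => j _; rewrite indicE ler_wpM2l ?powR_ge0// ler_nat.
      by case: (boolP (2 ^+ j < f x)) => // H; rewrite mem_set.
  rewrite nnintD; last 4 first.
  - exact: measurable_funX.
  - apply: measurable_sum => j; apply: measurable_funM => //.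
    by apply: measurable_indic; exact: measurable_gt.
  - by move=> x; exact: sqr_ge0.
  - by move=> x; apply: sumr_ge0 => j _; rewrite mulr_ge0 ?powR_ge0.
  rewrite EFinD; apply: leeD => //.
  rewrite (@nnint_sum _ _ 'I_J _ (fun j x => (2 ^+ j.+1) `^ p * \1_(superlevel f (2 ^+ j)) x)); last 2 first.
  - by move=> j; apply: measurable_funM => //; apply: measurable_indic; exact: measurable_gt.
  - by move=> j x; rewrite mulr_ge0 ?powR_ge0.
  apply: (@le_trans _ _ (\sum_(j < J) (8 * 2 `^ (p + 1) * (1 + X) * e * (2 `^ p * q ^+ j))%:E)%E).
    apply: lee_sum => j _; rewrite nnintZ ?powR_ge0//.
      by rewrite nnint_indic//; exact: measurable_gt.
    by apply: measurable_indic; exact: measurable_gt.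
  rewrite sumEFin lee_fin -mulr_sumr -mulr_sumr.
  have geo : \sum_(j < J) q ^+ j <= (1 - q)^-1.
    rewrite -[leRHS]mul1r ler_pdivlMr ?subr_gt0// mulrC -opprB mulNr -subrX1 opprB.
    by rewrite gerBl exprn_ge0// ltW.
  have -> : C * (1 + X) * e = 8 * 2 `^ (p + 1) * (1 + X) * e * (2 `^ p * (1 - q)^-1).
    by rewrite /C; ring.
  rewrite ler_wpM2l ?mulr_ge0 ?powR_ge0 ?addr_ge0// ler_wpM2l ?powR_ge0//.
by rewrite XE !lee_fin; exact: absorb.
Qed.

(** A function of small H1 norm has a small p-th moment, when [p] is subcritical.
    The bounded case applies to the truncations of [f], which inherit the bound
    on increments, and monotone convergence concludes. *)
Lemma sobolev_small (p : R) : 2 < p -> p * (N%:R - 2) < 2 * N%:R ->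
  exists2 C : R, 0 <= C & forall f e, measurable_fun setT f -> (forall x, 0 <= f x) ->
    0 <= e -> (\int[mu]_x (f x ^+ 2)%:E <= e%:E)%E -> transl_bound f e -> C * e <= 2^-1 ->
    (\int[mu]_x (f x `^ p)%:E <= (2 * (1 + C) * e)%:E)%E.
Proof.
move=> p2 pcrit; have [C C0 H] := sobolev_bounded p2 pcrit.
exists C => // f e mf f0 e0 f2 tb Ce.
have p0 : 0 < p by exact: lt_trans p2.
pose F J x := Num.min (f x) (2 ^+ J).
have mF J : measurable_fun setT (F J) by exact: measurable_minr.
have F0 J x : 0 <= F J x by rewrite le_min f0 exprn_ge0.
have FH J : (\int[mu]_x (F J x `^ p)%:E <= (2 * (1 + C) * e)%:E)%E.
  apply: (H _ _ J) => //; first by move=> x; rewrite ge_min lexx orbT.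
    apply: le_trans f2; apply: nnint_le; [exact: measurable_funX|exact: measurable_funX|by move=> x; exact: sqr_ge0|].
    by move=> x; rewrite lerXn2r ?nnegrE// ge_min lexx.
  exact: transl_bound_min.
have Fcvg : (\int[mu]_x (F J x `^ p)%:E)%E @[J --> \oo] --> (\int[mu]_x (f x `^ p)%:E)%E.
  apply: nnint_monotone_cvg => [J|J x|x J K JK|x]; [exact: measurable_fun_powR|exact: powR_ge0| |].
    apply: ge0_ler_powR; rewrite ?nnegrE ?(ltW p0)//.
    by rewrite /F le_min ge_min lexx/= ge_min; apply/orP; right; rewrite ler_weXn2l// ler1n.
  exists (Num.bound (f x)) => // J /= xJ; congr (_ `^ _); apply: min_idPl.
  apply: le_trans (ltW (archi_boundP (f0 x))) _; apply: (@le_trans _ _ J%:R); first by rewrite ler_nat.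
  by rewrite -natrX ler_nat ltnW// ltn_expl.
apply: (cvge_to_le Fcvg); exact: nearW.
Qed.

End sobolev.

(** * Real and imaginary parts of Sobolev functions *)

Section translation_bounds.
Context {R : realType} {N : nat}.
Local Notation E := 'rV[R]_N.
Local Notation mu := (@lebesgue_rV R N).
Implicit Types (f g : E -> R) (x y z h : E).

Lemma nnint_sqrD f g (a b : R) : measurable_fun setT f -> measurable_fun setT g ->
  (\int[mu]_x (f x ^+ 2)%:E <= a%:E)%E -> (\int[mu]_x (g x ^+ 2)%:E <= b%:E)%E ->
  (\int[mu]_x ((f x + g x) ^+ 2)%:E <= (2 * (a + b))%:E)%E.
Proof.
move=> mf mg fa gb.
have mf2 : measurable_fun setT (fun x => f x ^+ 2) by exact: measurable_funX.
have mg2 : measurable_fun setT (fun x => g x ^+ 2) by exact: measurable_funX.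
apply: (@le_trans _ _ (\int[mu]_x (2 * (f x ^+ 2 + g x ^+ 2))%:E)%E).
  apply: nnint_le => [|||x]; first by apply: measurable_funX; exact: measurable_funD.
  - by apply: measurable_funM => //; exact: measurable_funD.
  - by move=> x; exact: sqr_ge0.
  - by have := sqr_ge0 (f x - g x); move: (f x) (g x) => s t; nra.
rewrite nnintZ => [||x|]//; first last.
- by rewrite addr_ge0 ?sqr_ge0.
- exact: measurable_funD.
rewrite EFinM lee_pmul2l// nnintD// => [|x|x]; try exact: sqr_ge0.
by rewrite EFinD leeD.
Qed.

Lemma sum_coordinates h : \sum_(i < N) h ord0 i *: e_ i = h.
Proof.
apply/rowP => j; rewrite summxE (bigD1 j)//= /e_ !mxE !eqxx mulr1.
by rewrite big1 ?addr0// => i /negPf ij; rewrite !mxE eqxx [j == i]eq_sym ij mulr0.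
Qed.

(** A translation is carried out one coordinate at a time, each step doubling the
    constant. *)
Lemma transl_bound_wderiv f (g : 'I_N -> E -> R) (a : 'I_N -> R) : measurable_fun setT f ->
  (forall i, wderiv i f (g i)) -> (forall i, 0 <= a i) ->
  (forall i, \int[mu]_x (g i x ^+ 2)%:E <= (a i)%:E)%E ->
  transl_bound f (2 ^+ N * \sum_i a i).
Proof.
move=> mf fg a0 ga r h r0 hr.
have hi i : h ord0 i ^+ 2 <= r ^+ 2.
  by rewrite -[leLHS]real_normK ?num_real// ler_pXn2r ?nnegrE// (le_trans (normr_coor _ _)).
have step i x' : (\int[mu]_x ((f (x + x' + h ord0 i *: e_ i) - f (x + x')) ^+ 2)%:E <= (r ^+ 2 * a i)%:E)%E.
  rewrite (nnint_shift x' (f := fun x => (f (x + h ord0 i *: e_ i) - f x) ^+ 2)).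
  - apply: le_trans (wderiv_translation _ (fg i)) _.
    rewrite [leRHS]EFinM; apply: lee_pmul; rewrite ?lee_fin ?sqr_ge0//.
    by apply: nnint_ge0 => x; exact: sqr_ge0.
  - by apply: measurable_funX; apply: measurable_funB => //; exact: measurable_fun_shift.
  - by move=> x; exact: sqr_ge0.
suff H (s : seq 'I_N) : (\int[mu]_x ((f (x + \sum_(i <- s) h ord0 i *: e_ i) - f x) ^+ 2)%:E <=
    (2 ^+ size s * (r ^+ 2 * \sum_(i <- s) a i))%:E)%E.
  have := H (enum 'I_N); rewrite !big_enum/= sum_coordinates size_enum_ord.
  by rewrite mulrCA.
elim: s => [|i s IH].
  rewrite !big_nil; under eq_integral do rewrite addr0 subrr expr0n/=.
  by rewrite integral0_eq// !mulr0.
rewrite !big_cons; set hs := \sum_(j <- s) _ in IH *.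
rewrite (_ : (fun x => _) = (fun x => (((f (x + hs + h ord0 i *: e_ i) - f (x + hs)) +
    (f (x + hs) - f x)) ^+ 2)%:E)); last first.
  by apply/funext => x; rewrite subrKA [h ord0 i *: _ + _]addrC addrA.
apply: le_trans (nnint_sqrD _ _ (step i hs) IH) _.
- by apply: measurable_funB; [under eq_fun do rewrite -addrA|]; exact: measurable_fun_shift.
- by apply: measurable_funB => //; exact: measurable_fun_shift.
rewrite lee_fin/= [2 ^+ _.+1]exprS -[leRHS]mulrA ler_pM2l// mulrDr mulrDr lerD2r.
by rewrite ler_peMl ?exprn_ege1 ?ler1n// mulr_ge0 ?sqr_ge0.
Qed.

End translation_bounds.

Section complex_functions.
Context {R : realType} {N : nat}.
Local Notation E := 'rV[R]_N.
Local Notation mu := (@lebesgue_rV R N).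
Local Notation Re := complex.Re.
Local Notation Im := complex.Im.
Implicit Types (u v w : E -> R[i]) (A B : E -> E) (D : set E) (x y z h : E).

Lemma reM (z w : R[i]) : Re (z * w) = Re z * Re w - Im z * Im w.
Proof. by case: z w => a b [c d]. Qed.

Lemma imM (z w : R[i]) : Im (z * w) = Re z * Im w + Im z * Re w.
Proof. by case: z w => a b [c d]. Qed.

Lemma reD (z w : R[i]) : Re (z + w) = Re z + Re w.
Proof. by case: z w => a b [c d]. Qed.

Lemma imD (z w : R[i]) : Im (z + w) = Im z + Im w.
Proof. by case: z w => a b [c d]. Qed.

Lemma cabs_sqr (z : R[i]) : cabs z ^+ 2 = Re z ^+ 2 + Im z ^+ 2.
Proof. by case: z => a b; rewrite /cabs/= sqr_sqrtr// addr_ge0 ?sqr_ge0. Qed.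

Lemma cabs_ge0 (z : R[i]) : 0 <= cabs z.
Proof. by case: z => a b; rewrite /cabs/= sqrtr_ge0. Qed.

Lemma normr_Re_le (z : R[i]) : `|Re z| <= cabs z.
Proof. by rewrite -ler_sqr ?nnegrE ?cabs_ge0// real_normK ?num_real// cabs_sqr lerDl sqr_ge0. Qed.

Lemma normr_Im_le (z : R[i]) : `|Im z| <= cabs z.
Proof. by rewrite -ler_sqr ?nnegrE ?cabs_ge0// real_normK ?num_real// cabs_sqr lerDr sqr_ge0. Qed.

Lemma cabsD (z w : R[i]) : cabs (z + w) <= cabs z + cabs w.
Proof. exact: le_normcD. Qed.

Lemma cabsM (z w : R[i]) : cabs (z * w) = cabs z * cabs w.
Proof. exact: ComplexField.Normc.normcM. Qed.

Lemma measurable_cabs u : cmeasurable u -> measurable_fun setT (fun x => cabs (u x)).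
Proof.
move=> [mr mi]; rewrite (_ : (fun x => _) = fun x => Num.sqrt (Re (u x) ^+ 2 + Im (u x) ^+ 2)); last first.
  by apply/funext => x; rewrite -cabs_sqr sqrtr_sqr ger0_norm// cabs_ge0.
apply: (measurableT_comp (@continuous_measurable_fun _ _ (@sqrt_continuous R))).
by apply: measurable_funD; exact: measurable_funX.
Qed.

Lemma normr_le_enorm x : `|x| <= enorm x.
Proof.
apply: normr_rV_le => [|i]; first exact: sqrtr_ge0.
rewrite -ler_sqr ?nnegrE ?sqrtr_ge0// real_normK ?num_real// sqr_sqrtr; last first.
  by apply: sumr_ge0 => j _; exact: sqr_ge0.
by rewrite (bigD1 i)//= lerDl sumr_ge0// => j _; exact: sqr_ge0.
Qed.

Lemma enorm_le x : enorm x <= N%:R * `|x|.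
Proof.
rewrite -[leRHS]ger0_norm ?mulr_ge0// -sqrtr_sqr ler_sqrt ?sqr_ge0//.
apply: (@le_trans _ _ (\sum_(i < N) `|x| ^+ 2)).
  apply: ler_sum => i _; rewrite -[leLHS]real_normK ?num_real//.
  by rewrite ler_pXn2r ?nnegrE// normr_coor.
rewrite sumr_const card_ord -[leLHS]mulr_natl exprMn ler_wpM2r ?sqr_ge0//.
by rewrite -natrX ler_nat; case: (N) => // n; rewrite leq_pmulr.
Qed.

Lemma cball_eball (r : R) : cball r `<=` eball (0 : E) (N%:R * r + 1).
Proof.
move=> x xr; rewrite /eball/= subr0; apply: le_lt_trans (enorm_le x) _.
by rewrite ltr_pwDr// ler_wpM2l.
Qed.

Lemma measurable_eball x (r : R) : measurable (eball x r).
Proof.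
have -> : eball x r = superlevel (fun z => - enorm (z - x)) (- r).
  by apply/seteqP; split => z; rewrite /eball/superlevel/= ltrN2.
apply: measurable_gt; apply: measurable_funN.
apply: (measurableT_comp (@continuous_measurable_fun _ _ (@sqrt_continuous R))).
apply: measurable_sum => i; apply: measurable_funX.
under eq_fun do rewrite !mxE.
by apply: measurable_funB => //; apply: continuous_measurable_rV; exact: coord_continuous.
Qed.

Lemma integral_in D (f : E -> R) : measurable D ->
  (\int[mu]_(x in D) (f x)%:E = \int[mu]_x (f x * \1_D x)%:E)%E.
Proof.
move=> mD; rewrite integral_mkcond; apply: eq_integral => x _.
by rewrite patchE indicE; case: ifP; rewrite ?mulr1 ?mulr0.
Qed.

Lemma measurable_mul_indic D (f : E -> R) : measurable D -> measurable_fun setT f ->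
  measurable_fun setT (fun x => f x * \1_D x).
Proof. by move=> mD mf; apply: measurable_funM => //; exact: measurable_indic. Qed.

Lemma nnint_in_le D D' (f g : E -> R) : measurable D -> measurable D' ->
  measurable_fun setT f -> measurable_fun setT g ->
  D `<=` D' -> (forall x, 0 <= f x) -> (forall x, f x <= g x) ->
  (\int[mu]_(x in D) (f x)%:E <= \int[mu]_(x in D') (g x)%:E)%E.
Proof.
move=> mD mD' mf mg DD' f0 fg; rewrite (integral_in f mD) (integral_in g mD').
apply: nnint_le => [||x|x]; [exact: measurable_mul_indic..| |].
  by rewrite mulr_ge0// indicE.
rewrite !indicE; have [xD|xD] := boolP (x \in D).
  by rewrite mem_set ?mulr1//; apply: DD'; exact: set_mem.
by rewrite mulr0 mulr_ge0// (le_trans (f0 x)).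
Qed.

Lemma loc_integrable_locint u : loc_integrable u -> locint (fun x => Re (u x)) /\ locint (fun x => Im (u x)).
Proof.
move=> [[mr mi] ui]; have mcu := measurable_cabs (conj mr mi).
have H r : intg (fun x => cabs (u x) * \1_(cball r) x).
  apply: ge0_intgP => [|x|]; first by apply: measurable_mul_indic => //; exact: measurable_cball.
    by rewrite mulr_ge0 ?cabs_ge0// indicE.
  apply: le_lt_trans (ui (N%:R * r + 1)); rewrite -integral_in; last exact: measurable_cball.
  apply: nnint_in_le => //; [exact: measurable_cball|exact: measurable_eball|exact: cball_eball|].
  by move=> x; exact: cabs_ge0.
by split; split => // r; (apply: intg_le (H r) => [|x];
  [apply: measurable_mul_indic => //; exact: measurable_cball
  |rewrite normrM [X in _ * X]ger0_norm ?indicE// ler_wpM2r// ?normr_Re_le ?normr_Im_le]).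
Qed.

(** Through this embedding real test functions probe real and imaginary parts
    separately. *)
Lemma test_Cc_infty (phi : E -> R) : test phi -> Cc_infty (fun x => (phi x)%:C%C).
Proof.
move=> [sp [r rP]]; split; first exact: sp.
split; first by move=> k; exact: smooth_cst.
apply: (@subclosed_compact _ _ (cball r)); [exact: closed_closure|exact: compact_cball|].
rewrite [X in _ `<=` X]((closure_id (cball r)).1 (closed_cball (r := r))).
apply: closureS.
move=> x /=; apply: contraPP; rewrite /cball/= => /negP; rewrite -ltNge => rx.
by rewrite rP// eqxx.

Qed.

Lemma wgradP u : has_wgrad u -> is_wgrad u (wgrad u).
Proof. by rewrite /wgrad => h; case: pselect => // h'; exact: (projT2 (cid h')). Qed.

Lemma is_wgrad_wderiv u G i : is_wgrad u G ->
  wderiv i (fun x => Re (u x)) (fun x => Re (G i x)) /\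
  wderiv i (fun x => Im (u x)) (fun x => Im (G i x)).
Proof.
move=> [lu lG uG]; have [lur lui] := loc_integrable_locint lu.
have [lGr lGi] := loc_integrable_locint (lG i).
suff H phi : test phi ->
   (\int[mu]_x (Re (u x) * partial i phi x) = - \int[mu]_x (Re (G i x) * phi x)) /\
   (\int[mu]_x (Im (u x) * partial i phi x) = - \int[mu]_x (Im (G i x) * phi x)).
  by split; split => // phi /H[].
move=> tp; have := uG _ (test_Cc_infty tp) i.
have p0 x : partial i (fun=> 0 : R) x = 0 by apply: partialE; exact: is_derive_cst.
rewrite /cintegral /cpartial/=.
under eq_Rintegral do rewrite reM /= p0 mulr0 subr0.
under [X in (_ +i* X)%C]eq_Rintegral do rewrite imM /= p0 mulr0 add0r.
under [X in - (X +i* _)%C]eq_Rintegral do rewrite reM /= mulr0 subr0.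
under [X in - (_ +i* X)%C]eq_Rintegral do rewrite imM /= mulr0 add0r.
by case.
Qed.

Lemma energy_has_wgrad D A u : (energy D A u < +oo)%E -> has_wgrad u.
Proof. by rewrite /energy; case: asboolP. Qed.

Lemma energyE D A u : has_wgrad u -> energy D A u =
  (\int[mu]_(x in D) (\sum_(i < N) cabs (mgrad A u i x) ^+ 2)%R%:E)%E.
Proof. by rewrite /energy; case: asboolP. Qed.

Lemma energy_ge0 D A u : (0 <= energy D A u)%E.
Proof.
rewrite /energy; case: asboolP => // _; apply: integral_ge0 => x _.
by rewrite lee_fin sumr_ge0// => i _; exact: sqr_ge0.
Qed.

Lemma sqL2_ge0 D u : (0 <= sqL2 D u)%E.
Proof. by apply: integral_ge0 => x _; rewrite lee_fin sqr_ge0. Qed.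

End complex_functions.

(** * Weak convergence against bounded functions of bounded support *)

Section weak_convergence.
Context {R : realType} {N : nat}.
Local Notation E := 'rV[R]_N.
Local Notation mu := (@lebesgue_rV R N).
Local Notation Re := complex.Re.
Local Notation Im := complex.Im.
Implicit Types (u v w : E -> R[i]) (A B : E -> E) (D : set E) (x y z h : E).

Lemma reB (z w : R[i]) : Re (z - w) = Re z - Re w.
Proof. by case: z w => a b [c d]. Qed.

Lemma imB (z w : R[i]) : Im (z - w) = Im z - Im w.
Proof. by case: z w => a b [c d]. Qed.

Lemma sqH1_has_wgrad D u : (sqH1 D u < +oo)%E -> has_wgrad u.
Proof.
move=> H; apply: (@energy_has_wgrad _ _ D (fun=> 0)); apply: le_lt_trans H.
by rewrite /sqH1 leeDl// sqL2_ge0.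
Qed.

Lemma H1loc_has_wgrad u : H1loc u -> has_wgrad u.
Proof. by case=> _ /(_ 0); exact: sqH1_has_wgrad. Qed.

Lemma has_wgrad_locint u : has_wgrad u -> locint (fun x => Re (u x)) /\ locint (fun x => Im (u x)).
Proof. by move=> /wgradP[lu _ _]; exact: loc_integrable_locint. Qed.

Lemma has_wgrad_cmeasurable u : has_wgrad u -> cmeasurable u.
Proof. by move=> /wgradP[[]]. Qed.

Lemma wgrad_locint u i : has_wgrad u ->
  locint (fun x => Re (wgrad u i x)) /\ locint (fun x => Im (wgrad u i x)).
Proof. by move=> /wgradP[_ lG _]; exact: loc_integrable_locint. Qed.

Lemma wgrad_wderiv u i : has_wgrad u ->
  wderiv i (fun x => Re (u x)) (fun x => Re (wgrad u i x)) /\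
  wderiv i (fun x => Im (u x)) (fun x => Im (wgrad u i x)).
Proof. by move=> /wgradP; exact: is_wgrad_wderiv. Qed.

Lemma measurable_cabs_sqr u : cmeasurable u -> measurable_fun setT (fun x => cabs (u x) ^+ 2).
Proof. by move=> mu_; apply: measurable_funX; exact: measurable_cabs. Qed.

Lemma sqH1_transl_bound u (e : R) : 0 <= e -> (sqH1 setT u <= e%:E)%E ->
  (\int[mu]_x (Re (u x) ^+ 2)%:E <= e%:E)%E /\
  transl_bound (fun x => Re (u x)) (2 ^+ N * \sum_(i < N) e).
Proof.
move=> e0 ue; have hu : has_wgrad u by apply: (@sqH1_has_wgrad setT); apply: le_lt_trans ue (ltry _).
have mu_ := has_wgrad_cmeasurable hu.
split.
  apply: le_trans ue; apply: (@le_trans _ _ (sqL2 setT u)); last by rewrite leeDr// energy_ge0.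
  apply: nnint_le => [||x|x]; [apply: measurable_funX; exact: mu_.1|exact: measurable_cabs_sqr|exact: sqr_ge0|].
  by rewrite cabs_sqr lerDl sqr_ge0.
apply: (transl_bound_wderiv _ (fun i => (wgrad_wderiv i hu).1)) => [|//|i]; first exact: mu_.1.
apply: le_trans ue; apply: (@le_trans _ _ (energy setT (fun=> 0) u)); last by rewrite leeDl// sqL2_ge0.
rewrite energyE//; apply: nnint_le => [|||x].
- by apply: measurable_funX; exact: (wgrad_locint i hu).1.1.
- apply: measurable_sum => j; apply: measurable_cabs_sqr.
  have [[mr _] [mi _]] := wgrad_locint j hu.
  by split; rewrite /mgrad; under eq_fun do rewrite mxE mul0r addr0.
- by move=> x; exact: sqr_ge0.
- rewrite (bigD1 i)//= /mgrad mxE mul0r addr0 cabs_sqr -addrA lerDl addr_ge0 ?sqr_ge0//.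
  by apply: sumr_ge0 => j _; exact: sqr_ge0.
Qed.

(** The Cauchy-Schwarz inequality, by the discriminant argument; [Q + 1] replaces
    [Q], the integral of [chi ^ 2], to avoid a division by 0. *)
Lemma sqr_Rint_le (f chi : E -> R) (r : R) : measurable_fun setT f -> bms chi ->
  (forall x, ~ eball 0 r x -> chi x = 0) ->
  (((\int[mu]_x (f x * chi x)) ^+ 2)%:E <=
    (\int[mu]_x (chi x ^+ 2) + 1)%:E * \int[mu]_(x in eball (0 : E) r) (f x ^+ 2)%:E)%E.
Proof.
move=> mf bc chi0; have mB := measurable_eball (0 : E) r.
have Q0 : 0 <= \int[mu]_x (chi x ^+ 2) by apply: Rint_ge0 => x; exact: sqr_ge0.
rewrite (integral_in _ mB).
have [Xy|] := ltP (\int[mu]_x (f x ^+ 2 * \1_(eball 0 r) x)%:E)%E +oo%E; last first.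
  by rewrite leye_eq => /eqP ->; rewrite gt0_muley ?leey// lte_fin ltr_wpDl.
have iX : intg (fun x => f x ^+ 2 * \1_(eball 0 r) x).
  apply: ge0_intgP => // [|x]; last by rewrite mulr_ge0 ?sqr_ge0// indicE.
  by apply: measurable_mul_indic => //; exact: measurable_funX.
have iQ : intg (fun x => chi x ^+ 2) by apply: bms_intg; exact: bms_sqr.
have fchi x : f x * chi x = f x * \1_(eball 0 r) x * chi x.
  rewrite indicE; have [_|/negP xr] := boolP (x \in _); first by rewrite mulr1.
  by rewrite chi0 ?mulr0//; apply: contra_not xr; exact: mem_set.
have ind2 x : (\1_(eball 0 r) x : R) ^+ 2 = \1_(eball 0 r) x.
  by rewrite indicE; case: (_ \in _); rewrite ?expr1n ?expr0n.
have sqf x : f x ^+ 2 * \1_(eball 0 r) x = (f x * \1_(eball 0 r) x) ^+ 2 by rewrite exprMn ind2.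
have mchi : measurable_fun setT chi by case: bc.
have iP : intg (fun x => f x * chi x).
  apply: (intg_le _ _ (intgD iX iQ)) => [|x]; first exact: measurable_funM.
  rewrite fchi sqf normrM -[X in X + _]real_normK ?num_real// -[X in _ + X]real_normK ?num_real//.
  have := sqr_ge0 (`|f x * \1_(eball 0 r) x| - `|chi x|).
  have := mulr_ge0 (normr_ge0 (f x * \1_(eball 0 r) x)) (normr_ge0 (chi x)).
  by move: (`|f x * _|) (`|chi x|) => s t; nra.
rewrite -EFin_Rint// -EFinM lee_fin.
set P := \int[mu]_x (f x * chi x); set Q := \int[mu]_x (chi x ^+ 2) in Q0 *.
set X := \int[mu]_x _.
have key l : 0 <= X - 2 * l * P + l ^+ 2 * Q.
  rewrite /X /P /Q -!RintZ// -RintB//; last exact: intgZ.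
  rewrite -RintD; [|apply: intgB => //; exact: intgZ|exact: intgZ].
  apply: Rint_ge0 => x; rewrite fchi sqf.
  set s := \1__ x; have -> : (f x * s) ^+ 2 - 2 * l * (f x * s * chi x) + l ^+ 2 * chi x ^+ 2
    = (f x * s - l * chi x) ^+ 2 by ring.
  exact: sqr_ge0.
have Q1 : 0 < Q + 1 by rewrite ltr_wpDl.
have := key (P / (Q + 1)).
have -> : X - 2 * (P / (Q + 1)) * P + (P / (Q + 1)) ^+ 2 * Q =
   X - P ^+ 2 * ((Q + 2) / (Q + 1) ^+ 2) by field; rewrite gt_eqF.
have H : P ^+ 2 * (Q + 1)^-1 <= P ^+ 2 * ((Q + 2) / (Q + 1) ^+ 2).
  rewrite ler_wpM2l ?sqr_ge0// -subr_ge0.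
  have -> : (Q + 2) / (Q + 1) ^+ 2 - (Q + 1)^-1 = ((Q + 1) ^+ 2)^-1 by field; rewrite gt_eqF.
  by rewrite invr_ge0 sqr_ge0.
by rewrite subr_ge0 => /(le_trans H); rewrite ler_pdivrMr// mulrC.
Qed.

(** Such pairings are bounded by the L2 norm on a ball, so they belong to the dual
    of H1loc and weak convergence applies to them. *)
Lemma dual_cintegral (chi : E -> R) : bms chi ->
  H1loc_dual (fun w => cintegral (fun x => w x * (chi x)%:C%C)).
Proof.
move=> bc; split.
  move=> a u v /H1loc_has_wgrad/has_wgrad_locint[ur ui] /H1loc_has_wgrad/has_wgrad_locint[vr vi].
  rewrite /cintegral.
  have iM (f : E -> R) : locint f -> intg (fun x => f x * chi x) by move=> lf; exact: locint_bms.
  have re w : (fun x => Re (w x * (chi x)%:C%C)) = (fun x => Re (w x) * chi x).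
    by apply/funext => x; rewrite reM/= mulr0 subr0.
  have im w : (fun x => Im (w x * (chi x)%:C%C)) = (fun x => Im (w x) * chi x).
    by apply/funext => x; rewrite imM/= mulr0 add0r.
  rewrite !re !im.
  rewrite (_ : (fun x => Re (a * u x + v x) * chi x) =
    fun x => Re a * (Re (u x) * chi x) - Im a * (Im (u x) * chi x) + Re (v x) * chi x); last first.
    by apply/funext => x; rewrite reD reM; ring.
  rewrite (_ : (fun x => Im (a * u x + v x) * chi x) =
    fun x => Re a * (Im (u x) * chi x) + Im a * (Re (u x) * chi x) + Im (v x) * chi x); last first.
    by apply/funext => x; rewrite imD imM; ring.
  have [iur iui ivr ivi] := And4 (iM _ ur) (iM _ ui) (iM _ vr) (iM _ vi).
  rewrite RintD//; last by apply: intgB; exact: intgZ.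
  rewrite RintB//; [|exact: intgZ..]; rewrite RintD//; last by apply: intgD; exact: intgZ.
  rewrite RintD//; [|exact: intgZ..]; rewrite !RintZ//.
  by case: a {iM re im} => a b /=.
have [s sP] := bms_supp bc; exists (N%:R * s + 1), (\int[mu]_x (chi x ^+ 2) + 1) => u hu.
have chi0 x : ~ eball 0 (N%:R * s + 1) x -> chi x = 0.
  move=> xr; apply: sP; rewrite ltNge; apply/negP => xs; apply: xr; exact: cball_eball.
have [mr mi] := hu.1.
have Q1 : 0 <= \int[mu]_x (chi x ^+ 2) + 1.
  by rewrite addr_ge0//; apply: Rint_ge0 => x; exact: sqr_ge0.
apply: (@le_trans _ _ ((\int[mu]_x (chi x ^+ 2) + 1)%:E * sqL2 (eball 0 (N%:R * s + 1)) u)%E); last first.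
  by rewrite lee_wpmul2l ?lee_fin// /sqH1 leeDr// energy_ge0.
have mB := measurable_eball (0 : E) (N%:R * s + 1).
rewrite /sqL2; under eq_integral do rewrite cabs_sqr EFinD.
rewrite ge0_integralD//; [|by move=> x _; rewrite lee_fin sqr_ge0| |by move=> x _; rewrite lee_fin sqr_ge0|]; first last.
- by apply/measurable_EFinP; apply: measurable_funTS; exact: measurable_funX.
- by apply/measurable_EFinP; apply: measurable_funTS; exact: measurable_funX.
rewrite ge0_muleDr ?integral_ge0//; [|by move=> x _; rewrite lee_fin sqr_ge0..].
rewrite cabs_sqr EFinD /cintegral/= leeD//.
- by under eq_Rintegral do rewrite reM/= mulr0 subr0; exact: sqr_Rint_le.
- by under eq_Rintegral do rewrite imM/= mulr0 add0r; exact: sqr_Rint_le.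
Qed.

Lemma weak_cvg_Rint (w : nat -> E -> R[i]) v (chi : E -> R) : weak_cvg_H1loc w v -> bms chi ->
  (\int[mu]_x (Re (w k x) * chi x) @[k --> \oo] --> \int[mu]_x (Re (v x) * chi x)) /\
  (\int[mu]_x (Im (w k x) * chi x) @[k --> \oo] --> \int[mu]_x (Im (v x) * chi x)).
Proof.
move=> [_ _ wv] bc; have := wv _ (dual_cintegral bc).
set d := fun k => _ => d0.
have cv (a : nat -> R) (l : R) : (forall k, `|a k - l| <= d k) -> a k @[k --> \oo] --> l.
  move=> ad; apply/cvgrPdist_lt => e e0; move/cvgrPdist_lt : d0 => /(_ e e0); apply: filterS => k.
  by rewrite sub0r normrN ger0_norm ?cabs_ge0// => dk; rewrite distrC; exact: le_lt_trans (ad k) dk.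
have E1 u : Re (cintegral (fun x => u x * (chi x)%:C%C)) = \int[mu]_x (Re (u x) * chi x).
  by rewrite /cintegral/=; apply: eq_Rintegral => x _; rewrite reM/= mulr0 subr0.
have E2 u : Im (cintegral (fun x => u x * (chi x)%:C%C)) = \int[mu]_x (Im (u x) * chi x).
  by rewrite /cintegral/=; apply: eq_Rintegral => x _; rewrite imM/= mulr0 add0r.
by split; apply: cv => k; rewrite -?E1 -?E2 -?reB -?imB ?normr_Re_le ?normr_Im_le.
Qed.

End weak_convergence.

(** * Integrals over oriented intervals *)

Section oriented_integrals.
Context {R : realType}.
Local Notation nu := (@lebesgue_measure R).
Implicit Types (f g : R -> R) (a b t : R).

(** The signed indicator of the interval from [a] to [b], in a form which makes
    additivity in the end points an identity. *)
Definition sgnI a b : R -> R := fun t => (t <= b)%R%:R - (t <= a)%R%:R.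

Lemma measurable_le_ind b : measurable_fun setT (fun t : R => (t <= b)%R%:R : R).
Proof.
rewrite (_ : (fun t => _) = \1_`]-oo, b]); first exact: measurable_indic.
by apply/funext => t; rewrite indicE mem_setE in_itv.
Qed.

Lemma measurable_sgnI a b : measurable_fun setT (sgnI a b).
Proof. by apply: measurable_funB; exact: measurable_le_ind. Qed.

Lemma sgnI_le1 a b t : `|sgnI a b t| <= \1_(`[Num.min a b, Num.max a b]) t.
Proof.
rewrite indicE mem_setE in_itv/= ge_min le_max /sgnI.
case: (leP t b) (leP t a) => [tb|tb] [ta|ta]; rewrite ?subrr ?normr0 ?ler0n//.
  by rewrite subr0 normr1 (ltW ta) orbT.
by rewrite sub0r normrN normr1 (ltW tb) orbT.
Qed.

Lemma sgnI_neq0 a b t : sgnI a b t != 0 -> Num.min a b <= t <= Num.max a b.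
Proof.
apply: contra_neqT => H; apply/eqP; rewrite -normr_le0 (le_trans (sgnI_le1 a b t))//.
by rewrite indicE mem_setE in_itv/= (negPf H).
Qed.

Lemma itv_ind_integrable a b (c : R) : nu.-integrable setT (EFin \o (fun t => c * \1_`[a, b] t)).
Proof.
have H : nu.-integrable setT (EFin \o \1_`[a, b]).
  apply/integrableP; split; first by apply/measurable_EFinP; exact: measurable_indic.
  under eq_integral do rewrite /= ger0_norm//.
  have : (nu `[a, b] < +oo)%E.
    by rewrite lebesgue_measure_itv/=; case: ifP => // _; rewrite -EFinB ltry.
  by rewrite integral_indic// setIT.
exact: (integrableZl measurableT c H).
Qed.

Definition between a b f (C : R) := forall t, Num.min a b <= t <= Num.max a b -> `|f t| <= C.

Lemma sgnI_bound a b f (C : R) t : between a b f C ->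
  `|sgnI a b t * f t| <= `|C| * \1_(`[Num.min a b, Num.max a b]) t.
Proof.
move=> fC; have [->|/sgnI_neq0 H] := eqVneq (sgnI a b t) 0.
  by rewrite mul0r normr0 mulr_ge0// indicE.
by rewrite normrM mulrC ler_pM ?sgnI_le1// (le_trans (fC _ H))// ler_norm.
Qed.

Lemma continuous_between a b f : continuous f -> exists C, between a b f C.
Proof.
move=> cf; have : compact (f @` `[Num.min a b, Num.max a b]).
  by apply: continuous_compact; [exact: continuous_subspaceT|exact: segment_compact].
move=> /compact_bounded [M [_ MP]]; exists (M + 1) => t tab.
by apply: (MP (M + 1)); [rewrite ltrDl|exists t => //=; rewrite in_itv].
Qed.

Lemma sgnI_integrable a b f : continuous f -> nu.-integrable setT (EFin \o (fun t => sgnI a b t * f t)).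
Proof.
move=> cf; have [C fC] := continuous_between a b cf.
apply: (le_integrable measurableT) (itv_ind_integrable (Num.min a b) (Num.max a b) `|C|) => [|t _].
  by apply/measurable_EFinP; apply: measurable_funM; [exact: measurable_sgnI|exact: continuous_measurable_fun].
by rewrite /= lee_fin (le_trans (sgnI_bound t fC))// ler_norm.
Qed.

Lemma oriented_integralE f a b : continuous f ->
  oriented_integral f a b = \int[nu]_t (sgnI a b t * f t).
Proof.
move=> cf; have H c d : c <= d -> \int[nu]_(t in `[c, d]) f t = \int[nu]_t (sgnI c d t * f t).
  move=> cd; rewrite -Rintegral_itv_obnd_cbnd; last first.
    have : nu.-integrable `[c, d] (EFin \o f).
      by apply: continuous_compact_integrable; [exact: segment_compact|exact: continuous_subspaceT].
    by apply: integrableS => //; exact: subset_itv_oc_cc.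
  rewrite Rintegral_mkcond; apply: eq_Rintegral => t _.
  rewrite patchE mem_setE in_itv/= /sgnI; have [tc|ct] := leP t c.
    by rewrite (le_trans tc cd) subrr mul0r.
  by case: (t <= d); rewrite ?subr0 ?mul1r ?mul0r.
rewrite /oriented_integral; have [ab|ba] := leP a b; first exact: H.
rewrite H ?(ltW ba)// -mulN1r -RintegralZl//; last exact: sgnI_integrable.
by apply: eq_Rintegral => t _; rewrite /sgnI; ring.
Qed.

Lemma oriented_integral_split f a b c : continuous f ->
  oriented_integral f a c = oriented_integral f a b + oriented_integral f b c.
Proof.
move=> cf; rewrite !oriented_integralE// -RintegralD//; [|exact: sgnI_integrable..].
by apply: eq_Rintegral => t _; rewrite /sgnI; ring.
Qed.

Lemma oriented_integral_cst (k : R) a b : oriented_integral (fun=> k) a b = k * (b - a).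
Proof.
have H c d : c <= d -> \int[nu]_(t in `[c, d]) k = k * (d - c).
  move=> cd; have E : nu `[c, d] = if c < d then (d - c)%:E else 0%E.
    by rewrite lebesgue_measure_itv/= lte_fin; case: ifP.
  transitivity (k * fine (nu `[c, d])); first by rewrite Rintegral_cst.
  rewrite E; case: ifPn => //.
  by rewrite -leNgt => dc; rewrite (@le_anti _ _ c d) ?subrr//; apply/andP.
rewrite /oriented_integral; have [ab|ba] := leP a b; first exact: H.
by rewrite H ?(ltW ba)// -mulrN opprB.
Qed.

Lemma oriented_integralB f g a b : continuous f -> continuous g ->
  oriented_integral (fun t => f t - g t) a b = oriented_integral f a b - oriented_integral g a b.
Proof.
move=> cf cg; rewrite !oriented_integralE//; last by move=> x; exact: (cvgB (cf x) (cg x)).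
rewrite -RintegralB//; [|exact: sgnI_integrable..].
by apply: eq_Rintegral => t _; ring.
Qed.

Lemma oriented_integralZ (k : R) f a b : continuous f ->
  oriented_integral (fun t => k * f t) a b = k * oriented_integral f a b.
Proof.
move=> cf; rewrite !oriented_integralE//; last by move=> x; exact: (cvgM (cvg_cst k) (cf x)).
rewrite -RintegralZl//; last exact: sgnI_integrable.
by apply: eq_Rintegral => t _; ring.
Qed.

Lemma oriented_integral_sym f a b : continuous f -> oriented_integral f b a = - oriented_integral f a b.
Proof.
move=> cf; rewrite !oriented_integralE// -mulN1r -RintegralZl//; last exact: sgnI_integrable.
by apply: eq_Rintegral => t _; rewrite /sgnI; ring.
Qed.

Lemma betweenC a b f (C : R) : between a b f C -> between b a f C.
Proof. by move=> fC t; rewrite minC maxC; exact: fC. Qed.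

Lemma oriented_integral_le f a b (C : R) : continuous f -> between a b f C ->
  `|oriented_integral f a b| <= C * `|b - a|.
Proof.
wlog ab : a b / a <= b.
  move=> H cf fC; have [|/ltW ba] := leP a b; first by move=> ab; exact: H.
  by rewrite oriented_integral_sym// normrN distrC; apply: H => //; exact: betweenC.
move=> cf fC; have cC : continuous (fun _ : R => C) by move=> x; exact: cvg_cst.
rewrite [ `|b - a|]ger0_norm ?subr_ge0// -oriented_integral_cst !oriented_integralE//.
apply: le_trans (le_normr_Rintegral _ (sgnI_integrable a b cf)) _ => //.
apply: le_Rintegral => //; [|exact: sgnI_integrable|].
  by have /integrable_norm := sgnI_integrable a b cf.
move=> t _; have s0 : 0 <= sgnI a b t.
  rewrite /sgnI; have [ta|ta] := leP t a; first by rewrite (le_trans ta ab) subrr.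
  by rewrite subr0.
rewrite normrM ger0_norm//; have [->|/sgnI_neq0 H] := eqVneq (sgnI a b t) 0; first by rewrite !mul0r.
by rewrite ler_wpM2l// fC.
Qed.

Lemma oriented_integral_cvg (F : nat -> R -> R) f a b (C : R) :
  (forall n, continuous (F n)) -> continuous f -> (forall t, F n t @[n --> \oo] --> f t) ->
  (forall n, between a b (F n) C) ->
  oriented_integral (F n) a b @[n --> \oo] --> oriented_integral f a b.
Proof.
move=> cF cf Ff FC; rewrite oriented_integralE//.
under eq_fun do rewrite oriented_integralE//.
have [||||_ H] := @Rdominated_cvg _ _ _ nu (fun n t => sgnI a b t * F n t)
  (fun t => sgnI a b t * f t) (fun t => `|C| * \1_(`[Num.min a b, Num.max a b]) t) => [n|t||n t|//].
- by apply: measurable_funM; [exact: measurable_sgnI|exact: continuous_measurable_fun].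
- exact: (cvgM (cvg_cst _) (Ff t)).
- exact: itv_ind_integrable.
- exact: sgnI_bound.
Qed.

(** The fundamental theorem of calculus, with no restriction on the order of the
    end points. *)
Lemma is_derive_oriented_integral f a b : continuous f ->
  is_derive b (1 : R) (fun b => oriented_integral f a b) (f b).
Proof.
move=> cf; apply: is_derive_seqP => h h0 hcvg.
apply/cvgrPdist_le => e e0.
have /nbhs_ballP[d /= d0 dP] : \forall t \near b, `|f b - f t| <= e by have /cvgrPdist_le := cf b; exact.
have := hcvg; move/cvgrPdist_lt => /(_ d d0); apply: filterS => n; rewrite sub0r normrN => hd.
have cd : continuous (fun t => f t - f b) by move=> x; exact: (cvgB (cf x) (cvg_cst _)).
have -> : f b - (h n)^-1 * (oriented_integral f a (h n *: 1 + b) - oriented_integral f a b) =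
    - ((h n)^-1 * oriented_integral (fun t => f t - f b) b (h n *: 1 + b)).
  rewrite (oriented_integral_split a b (h n *: 1 + b) cf) addrAC subrr add0r.
  rewrite oriented_integralB//; last by move=> x; exact: cvg_cst.
  by rewrite oriented_integral_cst addrK /GRing.scale/= mulr1; field.
rewrite normrN normrM normfV mulrC ler_pdivrMr ?normr_gt0//.
have -> : `|h n| = `|(h n *: 1 + b) - b| by rewrite addrK /GRing.scale/= mulr1.
apply: oriented_integral_le => // t H; rewrite distrC; apply: dP; rewrite /ball/=.
apply: le_lt_trans hd; move: H; rewrite /GRing.scale/= mulr1.
have := ler_norm (h n); have := ler_norm (- h n); rewrite normrN; move: `|h n| => l lh1 lh2.
by rewrite ge_min le_max ler_norml => /andP[/orP[?|?] /orP[?|?]]; apply/andP; split; lra.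
Qed.

End oriented_integrals.

(** * Integrals along coordinate segments *)

Section splice_integrals.
Context {R : realType} {N : nat}.
Local Notation E := 'rV[R]_N.
Implicit Types (b db : E -> R) (x y z : E) (n j : 'I_N) (t : R).

Lemma splice_lipschitz y x x' n t t' : `|splice y x n t - splice y x' n t'| <= `|x - x'| + `|t - t'|.
Proof.
apply: normr_rV_le => [|j]; first by rewrite addr_ge0.
rewrite !mxE; case: ifP => _; first by rewrite subrr normr0 addr_ge0.
case: eqP => _; first by rewrite lerDr.
by have := normr_coor (x - x') j; rewrite !mxE => /le_trans; apply; rewrite lerDl.
Qed.

Lemma normr_splice_le y x n t : `|splice y x n t| <= `|y| + `|x| + `|t|.
Proof.
apply: normr_rV_le => [|j]; first by rewrite !addr_ge0.
have := normr_coor y j; have := normr_coor x j.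
have := normr_ge0 x; have := normr_ge0 y; have := normr_ge0 t.
rewrite !mxE; case: ifP => _; [lra|case: eqP => _; lra].
Qed.

Lemma splice_cvg y x n t (u : nat -> E) (s : nat -> R) : u k @[k --> \oo] --> x ->
  s k @[k --> \oo] --> t -> splice y (u k) n (s k) @[k --> \oo] --> splice y x n t.
Proof.
move=> ux st; apply/cvgrPdist_le => e e0; have e2 : 0 < e / 2 by lra.
near=> k; apply: le_trans (splice_lipschitz _ _ _ _ _ _) _.
have h1 : `|x - u k| <= e / 2 by near: k; move/cvgrPdist_le : ux; exact.
have h2 : `|t - s k| <= e / 2 by near: k; move/cvgrPdist_le : st; exact.
by lra.
Unshelve. all: by end_near.
Qed.

Lemma continuous_splice b y x n : continuous b -> continuous (fun t => b (splice y x n t)).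
Proof.
move=> cb t; apply: continuous_seqP => s st.
have H := @splice_cvg y _ n _ (fun=> x) _ (cvg_cst x) st.
exact: (cvg_comp _ _ (H _) (cb _)).
Qed.

Lemma splice_line_lt y x n j (h t : R) : (j < n)%N -> splice y (h *: e_ j + x) n t = splice y x n t.
Proof.
move=> jn; apply/rowP => i; rewrite !mxE eqxx/=; case: ltnP => // ni; case: eqP => // _.
by case: eqP => [ij|_]; [move: jn; rewrite -ij ltnNge ni|rewrite mulr0 add0r].
Qed.

Lemma splice_line_eq y x n (h t : R) : splice y (h *: e_ n + x) n t = splice y x n t.
Proof.
apply/rowP => i; rewrite !mxE eqxx/=; case: ltnP => // ni; case: eqP => // _.
by rewrite mulr0 add0r.
Qed.

Lemma splice_line_gt y x n j (h t : R) : (n < j)%N ->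
  splice y (h *: e_ j + x) n t = h *: e_ j + splice y x n t.
Proof.
move=> nj; apply/rowP => i; rewrite !mxE eqxx/=; have [ij|ij] := eqVneq i j.
  by rewrite ij ltnNge (ltnW nj)/= -val_eqE/= gtn_eqF// mulr1.
by rewrite mulr0 !add0r.
Qed.

(** The [n]-th edge of the path from [y] to [x] that replaces one coordinate at a
    time; the phase is a sum of such integrals. *)
Definition path_integral b y n x := oriented_integral (fun t => b (splice y x n t)) (y ord0 n) (x ord0 n).

Lemma splice_bounded b y n (r : R) : continuous b -> exists C : R, forall x t,
  `|x| <= r -> `|t| <= r -> `|b (splice y x n t)| <= C.
Proof.
move=> cb; have [C CP] := continuous_bounded_cball (`|y| + r + r) cb.
by exists C => x t xr tr; apply: CP; apply: le_trans (normr_splice_le _ _ _ _) _; lra.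
Qed.

Lemma normr_between (a c t r : R) : `|a| <= r -> `|c| <= r -> Num.min a c <= t <= Num.max a c -> `|t| <= r.
Proof.
by rewrite !ler_norml ge_min le_max => /andP[? ?] /andP[? ?] /andP[/orP[?|?] /orP[?|?]]; apply/andP; split; lra.
Qed.

Lemma continuous_path_integral b y n : continuous b -> continuous (path_integral b y n).
Proof.
move=> cb x; apply: continuous_seqP => u ux.
have [B BP] := cvg_seq_norm_bounded ux.
pose r := `|y| + `|x| + B.
have B0 : 0 <= B by exact: le_trans (normr_ge0 _) (BP 0%N).
have yr : `|y ord0 n| <= r by apply: le_trans (normr_coor y n) _; rewrite /r -addrA lerDl addr_ge0.
have xr : `|x ord0 n| <= r.
  by apply: le_trans (normr_coor x n) _; rewrite /r addrAC lerDr addr_ge0.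
have ur k : `|u k| <= r by apply: le_trans (BP k) _; rewrite /r lerDr addr_ge0.
have ukr k : `|u k ord0 n| <= r by exact: le_trans (normr_coor _ _) (ur k).
have [C CP] := splice_bounded y n r cb.
have cs z : continuous (fun t => b (splice y z n t)) by exact: continuous_splice.
have un : u k ord0 n @[k --> \oo] --> x ord0 n.
  exact: (cvg_comp _ _ ux (@coord_continuous _ _ _ ord0 n x)).
have H1 : oriented_integral (fun t => b (splice y (u k) n t)) (y ord0 n) (x ord0 n) @[k --> \oo] -->
    path_integral b y n x.
  apply: (@oriented_integral_cvg _ _ _ _ _ C) => // [t|k t /(normr_between yr xr)]; last exact: CP.
  have H := @splice_cvg y _ n _ _ (fun=> t) ux (cvg_cst t).
  exact: (cvg_comp _ _ (H _) (cb _)).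
have H2 : oriented_integral (fun t => b (splice y (u k) n t)) (x ord0 n) (u k ord0 n) @[k --> \oo] --> (0 : R).
  apply/cvgrPdist_le => e e0; have C1 : 0 < `|C| + 1 by rewrite ltr_wpDl.
  near=> k; rewrite sub0r normrN.
  apply: le_trans (oriented_integral_le (C := `|C| + 1) (cs _) _) _.
    move=> t /(normr_between xr (ukr k)) tr; apply: le_trans (CP _ _ (ur k) tr) _.
    by rewrite (le_trans (ler_norm C))// lerDl.
  rewrite -ler_pdivlMl// distrC mulrC; near: k.
  by move/cvgrPdist_le : un; apply; rewrite divr_gt0.
have E k : path_integral b y n (u k) = oriented_integral (fun t => b (splice y (u k) n t)) (y ord0 n) (x ord0 n) +
    oriented_integral (fun t => b (splice y (u k) n t)) (x ord0 n) (u k ord0 n).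
  exact: oriented_integral_split.
rewrite [X in X @ _](funext E).
have H := cvgD H1 H2; rewrite addr0 in H; exact: H.
Unshelve. all: by end_near.
Qed.

(** The derivative of [path_integral] in direction [j]: for [j < n] the edge does
    not depend on [x_j], for [j = n] its end point moves along it, and for
    [n < j] it is translated sideways. *)
Definition dpath_integral b db y n j x : R :=
  if (j < n)%N then 0 else if j == n then b (splice y x n (x ord0 n)) else path_integral db y n x.

Lemma continuous_dpath_integral b db y n j : continuous b -> continuous db ->
  continuous (dpath_integral b db y n j).
Proof.
move=> cb cdb x; rewrite /dpath_integral; case: (j < n)%N; first exact: cst_continuous.
case: (j == n); last exact: continuous_path_integral.
apply: continuous_seqP => u ux.
have un : u k ord0 n @[k --> \oo] --> x ord0 n.
  exact: (cvg_comp _ _ ux (@coord_continuous _ _ _ ord0 n x)).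
have H := @splice_cvg y _ n _ _ _ ux un.
exact: (cvg_comp _ _ H (cb _)).
Qed.

Lemma is_derive_path_integral b db y n j x (L : R) : continuous b -> continuous db ->
  (forall z, is_derive z (e_ j) b (db z)) -> (forall z, `|db z| <= L) ->
  is_derive x (e_ j) (path_integral b y n) (dpath_integral b db y n j x).
Proof.
move=> cb cdb bd dbL; have cs (c : E -> R) z : continuous c -> continuous (fun t => c (splice y z n t)).
  exact: continuous_splice.
have coor h : (h *: e_ j + x) ord0 n = h * (n == j)%:R + x ord0 n by rewrite !mxE eqxx.
rewrite /dpath_integral; case: ltngtP => [jn|nj|jn].
- apply: is_derive_from_line; rewrite (_ : (fun t : R => _) = fun=> path_integral b y n x).
    exact: is_derive_cst.
  apply/funext => h; rewrite /path_integral coor -val_eqE/= gtn_eqF// mulr0 add0r.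
  by congr oriented_integral; apply/funext => t; rewrite splice_line_lt.
- rewrite -val_eqE/= gtn_eqF//; apply: is_derive_seqP => h h0 hcvg.
  have cb' k : continuous (fun z => b (h k *: e_ j + z)).
    rewrite (_ : (fun z => _) = fun z => b (z + h k *: e_ j)); last by apply/funext => z; rewrite addrC.
    by move=> z; apply: (@continuous_comp _ _ _ (fun z => z + h k *: e_ j) b); [exact: continuous_shift|exact: cb].
  have cB k : continuous (fun t => b (h k *: e_ j + splice y x n t) - b (splice y x n t)).
    by move=> t; exact: (cvgB (cs _ x (cb' k) t) (cs b x cb t)).
  rewrite (_ : (fun k => _) = fun k => oriented_integral
     (fun t => (h k)^-1 * (b (h k *: e_ j + splice y x n t) - b (splice y x n t))) (y ord0 n) (x ord0 n)); last first.
    apply/funext => k; rewrite oriented_integralZ//.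
    congr (_ * _); rewrite oriented_integralB; [|exact: (cs _ x (cb' k))|exact: cs].
    rewrite /path_integral coor -val_eqE/= ltn_eqF// mulr0 add0r.
    by congr (oriented_integral _ _ _ - _); apply/funext => t; rewrite splice_line_gt.
  apply: (@oriented_integral_cvg _ _ _ _ _ L) => [k||t|k t _].
  - by move=> t; exact: (cvgM (cvg_cst _) (cB k t)).
  - exact: cs.
  - exact: is_derive_seq.
  - rewrite normrM normfV mulrC ler_pdivrMr ?normr_gt0//.
    by apply: (@le_increment_line _ _ _ db).
- have {jn}jn : j = n by exact: val_inj.
  rewrite jn in coor *.
  rewrite eqxx; apply: is_derive_from_line.
  rewrite (_ : (fun t : R => _) = fun h : R => oriented_integral (fun t => b (splice y x n t)) (y ord0 n)
      (h + x ord0 n)); last first.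
    apply/funext => h; rewrite /path_integral coor eqxx mulr1.
    by congr oriented_integral; apply/funext => t; rewrite splice_line_eq.
  apply: (@is_derive_shift_rV _ _ (oriented_integral (fun t => b (splice y x n t)) (y ord0 n)) 0 1).
  by rewrite add0r; apply: is_derive_oriented_integral; exact: cs.
Qed.

End splice_integrals.

(** * Regularity of the phase and gauge covariance *)

Section phase_regularity.
Context {R : realType} {N : nat}.
Local Notation E := 'rV[R]_N.
Local Notation mu := (@lebesgue_rV R N).
Implicit Types (f g p q phi : E -> R) (x y z : E) (n i j : 'I_N).

Lemma continuous_sum_fun (I : Type) (s : seq I) (F : I -> E -> R) :
  (forall k, continuous (F k)) -> continuous (fun x => \sum_(k <- s) F k x).
Proof.
move=> cF; elim: s => [|k s IH].
  by under eq_fun do rewrite big_nil; exact: cst_continuous.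
by under eq_fun do rewrite big_cons; exact: continuous_add.
Qed.

Lemma is_derive_sum_fun (I : Type) (s : seq I) (F : I -> E -> R) (d : I -> R) x i :
  (forall k, is_derive x (e_ i) (F k) (d k)) ->
  is_derive x (e_ i) (fun x => \sum_(k <- s) F k x) (\sum_(k <- s) d k).
Proof.
move=> Fd; elim: s => [|k s IH].
  by under eq_fun do rewrite big_nil; rewrite big_nil; exact: is_derive_cst.
by under eq_fun do rewrite big_cons; rewrite big_cons; exact: is_deriveD.
Qed.

Variables (A : E -> E) (A_C1 : dotC1 A) (c : E -> R).

Lemma continuous_potential n : continuous (fun x => A x ord0 n).
Proof.
move=> x; have [dA _ _] := A_C1.
exact: (cvg_comp _ _ (differentiable_continuous (dA x)) (@coord_continuous _ _ _ ord0 n (A x))).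
Qed.

Lemma continuous_jacobian j n : continuous (fun x => 'J A x j n).
Proof.
move=> x; have [_ cJ _] := A_C1.
exact: (cvg_comp _ _ (cJ x) (@coord_continuous _ _ _ j n ('J A x))).
Qed.

Lemma is_derive_potential j n x : is_derive x (e_ j) (fun x => A x ord0 n) ('J A x j n).
Proof.
have [dA _ _] := A_C1; have Ad : derivable A x (e_ j) by exact: diff_derivable.
apply: DeriveDef; first exact: (derivable_mxP A x (e_ j)).1.
have := congr1 (fun M : E => M ord0 n) (derive_mx Ad); rewrite mxE => <-.
rewrite deriveEjacobian// mxE (bigD1 j)//= /e_ mxE !eqxx mul1r big1 ?addr0// => k /negPf kj.
by rewrite mxE kj andbF mul0r.
Qed.

Lemma jacobian_bounded : exists L : R, forall j n x, `|'J A x j n| <= L.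
Proof.
have [_ _ [L LP]] := A_C1; exists L => j n x; apply: le_trans (LP x).
rewrite [leRHS]mx_normrE.
exact: (@le_bigmax _ _ _ 0%R (fun ij : 'I_N * 'I_N => `|'J A x ij.1 ij.2|) (j, n)).
Qed.

Definition dphase y j x : R := if y == 0 then 0 else
  - \sum_(n < N) dpath_integral (fun z => A z ord0 n) (fun z => 'J A z j n) y n j x.

Lemma continuous_phase y : continuous (phase A c y).
Proof.
rewrite /phase; case: (y == 0); first exact: cst_continuous.
apply: continuous_sub; first exact: cst_continuous.
apply: continuous_sum_fun => n; apply: (@continuous_path_integral _ _ (fun z => A z ord0 n)).
exact: continuous_potential.
Qed.

Lemma continuous_dphase y j : continuous (dphase y j).
Proof.
rewrite /dphase; case: (y == 0); first exact: cst_continuous.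
under eq_fun do rewrite -sub0r.
apply: continuous_sub; [exact: cst_continuous|apply: continuous_sum_fun => n].
by apply: continuous_dpath_integral; [exact: continuous_potential|exact: continuous_jacobian].
Qed.

Lemma is_derive_phase y j x : is_derive x (e_ j) (phase A c y) (dphase y j x).
Proof.
rewrite /phase /dphase; case: (y == 0); first exact: is_derive_cst.
have [L LP] := jacobian_bounded.
have H : is_derive x (e_ j) (fun x => \sum_(n < N) path_integral (fun z => A z ord0 n) y n x)
    (\sum_(n < N) dpath_integral (fun z => A z ord0 n) (fun z => 'J A z j n) y n j x).
  apply: is_derive_sum_fun => n; apply: (@is_derive_path_integral _ _ _ _ _ _ _ _ L) => //.
  - exact: continuous_potential.
  - exact: continuous_jacobian.
  - by move=> z; exact: is_derive_potential.
have := is_deriveB (is_derive_cst (c y) x (e_ j)) H; rewrite sub0r; exact.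
Qed.

Lemma corrected_potentialE y x j : corrected_potential A c y x ord0 j = A x ord0 j + dphase y j x.
Proof. by rewrite /corrected_potential !mxE (partialE (is_derive_phase y j x)). Qed.

Lemma continuous_corrected_potential y j : continuous (fun x => corrected_potential A c y x ord0 j).
Proof.
under eq_fun do rewrite corrected_potentialE.
by apply: continuous_add; [exact: continuous_potential|exact: continuous_dphase].
Qed.

End phase_regularity.

Lemma wderivN (R : realType) (N : nat) (i : 'I_N) (f g : 'rV[R]_N -> R) : wderiv i f g ->
  wderiv i (fun x => - f x) (fun x => - g x).
Proof.
move=> [lf lg fg]; split; [exact: locintN..|move=> phi tphi].
under eq_Rintegral do rewrite mulNr.
under [in RHS]eq_Rintegral do rewrite mulNr.
have btp := test_bms (partial_test i tphi).
rewrite RintN ?fg ?RintN//; [apply: locint_bms => //; exact: test_bms|exact: locint_bms].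
Qed.

Section gauge.
Context {R : realType} {N : nat}.
Local Notation E := 'rV[R]_N.
Local Notation mu := (@lebesgue_rV R N).
Implicit Types (f g p q phi : E -> R) (x y z : E) (i j : 'I_N).

Lemma continuous_cvg_fun (h : R -> R) f : continuous h -> continuous f -> continuous (fun x => h (f x)).
Proof. by move=> ch cf x; exact: (cvg_comp _ _ (cf x) (ch (f x))). Qed.

Lemma continuous_mul_bms f g : continuous f -> bms g -> bms (fun x => f x * g x).
Proof.
move=> cf; apply: bmsM; first exact: continuous_measurable_rV.
by move=> r; exact: continuous_bounded_cball.
Qed.

(** The weak derivatives of [p] and [q] are tested against [cos phi * g] and
    [sin phi * g], which are continuously differentiable; differentiating the
    phase produces the term that turns [a] into [a + dphi]. *)
Lemma gauge_identity p p' q q' (a phi dphi g : E -> R) i :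
  wderiv i p p' -> wderiv i q q' -> continuous a -> continuous phi -> continuous dphi ->
  (forall x, is_derive x (e_ i) phi (dphi x)) -> test g ->
  intg (fun x => (a x + dphi x) * (cos (phi x) * q x - sin (phi x) * p x) * g x) /\
  \int[mu]_x ((cos (phi x) * (p' x - a x * q x) + sin (phi x) * (q' x + a x * p x)) * g x) =
  - (\int[mu]_x ((cos (phi x) * p x + sin (phi x) * q x) * partial i g x))
  - \int[mu]_x ((a x + dphi x) * (cos (phi x) * q x - sin (phi x) * p x) * g x).
Proof.
move=> pp qq ca cphi cdphi phid tg.
have [lp lp' _] := pp; have [lq lq' _] := qq.
have cc : continuous (fun x => cos (phi x)) by apply: continuous_cvg_fun => //; exact: continuous_cos.
have cs : continuous (fun x => sin (phi x)) by apply: continuous_cvg_fun => //; exact: continuous_sin.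
have cg : continuous g by apply: smooth_continuous; case: tg.
have tdg := partial_test i tg.
have cdg : continuous (partial i g) by apply: smooth_continuous; case: tdg.
pose psi1 x := cos (phi x) * g x; pose psi2 x := sin (phi x) * g x.
pose dpsi1 x := cos (phi x) * partial i g x - sin (phi x) * dphi x * g x.
pose dpsi2 x := sin (phi x) * partial i g x + cos (phi x) * dphi x * g x.
have gd x : is_derive x (e_ i) g (partial i g x) by apply: smooth_is_derive; case: tg.
have d1 x : is_derive x (e_ i) psi1 (dpsi1 x).
  have H := is_derive_comp_line (is_derive_cos (phi x)) (phid x).
  have := is_deriveM H (gd x); congr is_derive; rewrite /dpsi1 /GRing.scale/=; ring.
have d2 x : is_derive x (e_ i) psi2 (dpsi2 x).
  have H := is_derive_comp_line (is_derive_sin (phi x)) (phid x).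
  have := is_deriveM H (gd x); congr is_derive; rewrite /dpsi2 /GRing.scale/=; ring.
have sg : exists r : R, forall x, r < `|x| -> g x = 0 by case: tg.
have s1 : exists r : R, forall x, r < `|x| -> psi1 x = 0.
  by have [r rP] := sg; exists r => x xr; rewrite /psi1 rP// mulr0.
have s2 : exists r : R, forall x, r < `|x| -> psi2 x = 0.
  by have [r rP] := sg; exists r => x xr; rewrite /psi2 rP// mulr0.
have cd1 : continuous dpsi1.
  by apply: continuous_sub; apply: continuous_mul => //; exact: continuous_mul.
have cd2 : continuous dpsi2.
  by apply: continuous_add; apply: continuous_mul => //; exact: continuous_mul.
have I1 := wderiv_C1 pp (continuous_mul cc cg) cd1 d1 s1.
have I2 := wderiv_C1 qq (continuous_mul cs cg) cd2 d2 s2.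
have bg := test_bms tg; have bdg := test_bms tdg.
have b1 : bms psi1 by exact: continuous_mul_bms.
have b2 : bms psi2 by exact: continuous_mul_bms.
have ba1 : bms (fun x => a x * psi1 x) by exact: continuous_mul_bms.
have ba2 : bms (fun x => a x * psi2 x) by exact: continuous_mul_bms.
have bd1 : bms dpsi1.
  by apply: bmsB; apply: continuous_mul_bms => //; exact: continuous_mul.
have bd2 : bms dpsi2.
  by apply: bmsD; apply: continuous_mul_bms => //; exact: continuous_mul.
have i1 := locint_bms lp' b1; have i2 := locint_bms lq' b2.
have i3 := locint_bms lq ba1; have i4 := locint_bms lp ba2.
have i5 := locint_bms lp bd1; have i6 := locint_bms lq bd2.
have cad : continuous (fun x => a x + dphi x) by exact: continuous_add.
have i7 : intg (fun x => (a x + dphi x) * (cos (phi x) * q x - sin (phi x) * p x) * g x).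
  have := intgB (locint_bms lq (continuous_mul_bms cad b1)) (locint_bms lp (continuous_mul_bms cad b2)).
  by congr intg; apply/funext => x; rewrite /psi1 /psi2; ring.
split => //.
transitivity (\int[mu]_x (p' x * psi1 x) + \int[mu]_x (q' x * psi2 x) -
   \int[mu]_x (q x * (a x * psi1 x)) + \int[mu]_x (p x * (a x * psi2 x))).
  rewrite -RintD// -RintB//; last exact: intgD.
  rewrite -RintD//; last by apply: intgB => //; exact: intgD.
  by apply: eq_Rintegral => x _; rewrite /psi1 /psi2; ring.
rewrite -[\int[mu]_x (p' x * _)]opprK -I1 -[\int[mu]_x (q' x * _)]opprK -I2.
rewrite [in RHS](_ : \int[mu]_x ((cos (phi x) * p x + sin (phi x) * q x) * partial i g x) =
   \int[mu]_x (p x * dpsi1 x) + \int[mu]_x (q x * dpsi2 x) + \int[mu]_x (q x * (a x * psi1 x)) -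
   \int[mu]_x (p x * (a x * psi2 x)) -
   \int[mu]_x ((a x + dphi x) * (cos (phi x) * q x - sin (phi x) * p x) * g x)); first ring.
have i56 := intgD i5 i6; have i563 := intgD i56 i3; have i5634 := intgB i563 i4.
rewrite -RintD// -RintD// -RintB// -RintB//.
by apply: eq_Rintegral => x _; rewrite /dpsi1 /dpsi2 /psi1 /psi2; ring.
Qed.

End gauge.

Section magnetic_gauge.
Context {R : realType} {N : nat}.
Local Notation E := 'rV[R]_N.
Local Notation mu := (@lebesgue_rV R N).
Local Notation Re := complex.Re.
Local Notation Im := complex.Im.
Variables (A : E -> E) (A_C1 : dotC1 A) (c : E -> R).
Implicit Types (f : E -> R) (u : E -> R[i]) (x y : E) (i : 'I_N).

Lemma re_mshift_inv y u x : Re (mshift_inv A c y u x) =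
  cos (phase A c y (x + y)) * Re (u (x + y)) + sin (phase A c y (x + y)) * Im (u (x + y)).
Proof. by rewrite /mshift_inv reM /= cosN sinN mulNr opprK. Qed.

Lemma im_mshift_inv y u x : Im (mshift_inv A c y u x) =
  cos (phase A c y (x + y)) * Im (u (x + y)) - sin (phase A c y (x + y)) * Re (u (x + y)).
Proof. by rewrite /mshift_inv imM /= cosN sinN mulNr. Qed.

Lemma re_mgrad u i x : Re (mgrad A u i x) = Re (wgrad u i x) - A x ord0 i * Im (u x).
Proof. by rewrite /mgrad reD reM/= mul0r sub0r. Qed.

Lemma im_mgrad u i x : Im (mgrad A u i x) = Im (wgrad u i x) + A x ord0 i * Re (u x).
Proof. by rewrite /mgrad imD imM/= mul0r add0r. Qed.

Lemma cabs_mshift_inv y u x : cabs (mshift_inv A c y u x) = cabs (u (x + y)).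
Proof.
apply/eqP; rewrite -(eqrXn2 (n := 2))// ?cabs_ge0// !cabs_sqr re_mshift_inv im_mshift_inv; apply/eqP.
set C := cos _; set S := sin _; set a := Re _; set b := Im _.
transitivity ((C ^+ 2 + S ^+ 2) * (a ^+ 2 + b ^+ 2)); first ring.
by rewrite cos2Dsin2 mul1r.
Qed.

Lemma measurable_mgrad u i : has_wgrad u -> cmeasurable (mgrad A u i).
Proof.
move=> hu; have [mr mi] := has_wgrad_cmeasurable hu.
have [[gr _] [gi _]] := wgrad_locint i hu.
have mA := continuous_measurable_rV (continuous_potential A_C1 (n := i)).
split; [under eq_fun do rewrite re_mgrad|under eq_fun do rewrite im_mgrad].
- by apply: measurable_funB => //; exact: measurable_funM.
- by apply: measurable_funD => //; exact: measurable_funM.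
Qed.

(** Shifting the magnetic gradient of [u] gives the magnetic gradient of the
    shifted function for the corrected potential. In this weak form the right
    side passes to the limit when the shifted functions converge weakly. *)
Lemma gauge_covariance y u i f : has_wgrad u -> test f ->
  let w := mshift_inv A c y u in
  let B := corrected_potential A c y in
  (\int[mu]_x (Re (mshift_inv A c y (mgrad A u i) x) * f x) =
    - (\int[mu]_x (Re (w x) * partial i f x)) - \int[mu]_x (Im (w x) * (B (x + y) ord0 i * f x))) /\
  (\int[mu]_x (Im (mshift_inv A c y (mgrad A u i) x) * f x) =
    - (\int[mu]_x (Im (w x) * partial i f x)) + \int[mu]_x (Re (w x) * (B (x + y) ord0 i * f x))).
Proof.
move=> hu tf /=; have [dr di] := wgrad_wderiv i hu.
pose g := fun x => f (x - y); have tg : test g by exact: shift_test.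
have fg x : f x = g (x + y) by rewrite /g addrK.
have dfg x : partial i f x = partial i g (x + y).
  apply: partialE; rewrite (_ : f = fun x => g (x + y)); last exact/funext.
  by apply: is_derive_shift_rV; apply: smooth_is_derive; case: tg.
have cphi := continuous_phase A_C1 (c := c) (y := y).
have cdphi := continuous_dphase A_C1 (y := y) (j := i).
have cA := continuous_potential A_C1 (n := i).
have cc : continuous (fun x => cos (phase A c y x)) by apply: continuous_cvg_fun => //; exact: continuous_cos.
have cs : continuous (fun x => sin (phase A c y x)) by apply: continuous_cvg_fun => //; exact: continuous_sin.
have mc := continuous_measurable_rV cc; have ms := continuous_measurable_rV cs.
have mA := continuous_measurable_rV cA; have mdp := continuous_measurable_rV cdphi.
have mB := continuous_measurable_rV (continuous_corrected_potential A_C1 (c := c) (y := y) (j := i)).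
have [mr mi] := has_wgrad_cmeasurable hu; have [mmr mmi] := measurable_mgrad i hu.
have [mg _] := test_bms tg; have [mdg _] := test_bms (partial_test i tg).
have mwr : measurable_fun setT (fun x => cos (phase A c y x) * Re (u x) + sin (phase A c y x) * Im (u x)).
  by apply: measurable_funD; exact: measurable_funM.
have mwi : measurable_fun setT (fun x => cos (phase A c y x) * Im (u x) - sin (phase A c y x) * Re (u x)).
  by apply: measurable_funB; exact: measurable_funM.
have mgr : measurable_fun setT (fun x => cos (phase A c y x) * Re (mgrad A u i x) + sin (phase A c y x) * Im (mgrad A u i x)).
  by apply: measurable_funD; exact: measurable_funM.
have mgi : measurable_fun setT (fun x => cos (phase A c y x) * Im (mgrad A u i x) - sin (phase A c y x) * Re (mgrad A u i x)).
  by apply: measurable_funB; exact: measurable_funM.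
have sh (h k : E -> R) : measurable_fun setT h ->
    (fun x => h (x + y)) =1 k -> \int[mu]_x k x = \int[mu]_x h x.
  by move=> mh hk; rewrite -(Rint_shift y mh); apply: eq_Rintegral => x _; rewrite hk.
have [_ P] := gauge_identity dr di cA cphi cdphi (is_derive_phase A_C1 c y i) tg.
(* multiplication by [- i] exchanges the roles of the real and imaginary parts *)
have [iQ Q] := gauge_identity di (wderivN dr) cA cphi cdphi (is_derive_phase A_C1 c y i) tg.
split.
- rewrite (sh _ (fun x => Re (mshift_inv A c y (mgrad A u i) x) * f x) (measurable_funM mgr mg)); last by move=> x; rewrite re_mshift_inv fg.
  rewrite (sh _ (fun x => Re (mshift_inv A c y u x) * partial i f x) (measurable_funM mwr mdg)); last by move=> x; rewrite re_mshift_inv dfg.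
  rewrite (sh _ (fun x => Im (mshift_inv A c y u x) * (corrected_potential A c y (x + y) ord0 i * f x)) (measurable_funM mwi (measurable_funM mB mg))); last by move=> x; rewrite im_mshift_inv fg.
  transitivity (- (\int[mu]_x ((cos (phase A c y x) * Re (u x) + sin (phase A c y x) * Im (u x)) * partial i g x)) -
     \int[mu]_x ((A x ord0 i + dphase A y i x) *
      (cos (phase A c y x) * Im (u x) - sin (phase A c y x) * Re (u x)) * g x)).
    by rewrite -P; apply: eq_Rintegral => x _; rewrite /= re_mgrad im_mgrad; ring.
  congr (_ - _); apply: eq_Rintegral => x _; rewrite /=.
  by rewrite (corrected_potentialE A_C1); ring.
- rewrite (sh _ (fun x => Im (mshift_inv A c y (mgrad A u i) x) * f x) (measurable_funM mgi mg)); last by move=> x; rewrite im_mshift_inv fg.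
  rewrite (sh _ (fun x => Im (mshift_inv A c y u x) * partial i f x) (measurable_funM mwi mdg)); last by move=> x; rewrite im_mshift_inv dfg.
  rewrite (sh _ (fun x => Re (mshift_inv A c y u x) * (corrected_potential A c y (x + y) ord0 i * f x)) (measurable_funM mwr (measurable_funM mB mg))); last by move=> x; rewrite re_mshift_inv fg.
  transitivity (- (\int[mu]_x ((cos (phase A c y x) * Im (u x) + sin (phase A c y x) * - Re (u x)) * partial i g x)) -
     \int[mu]_x ((A x ord0 i + dphase A y i x) *
      (cos (phase A c y x) * - Re (u x) - sin (phase A c y x) * Im (u x)) * g x)).
    by rewrite -Q; apply: eq_Rintegral => x _; rewrite /= re_mgrad im_mgrad; ring.
  rewrite -(RintN iQ); congr (- _ + _); apply: eq_Rintegral => x _; rewrite /=; first by ring.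
  by rewrite (corrected_potentialE A_C1); ring.
Qed.

End magnetic_gauge.

(** * Lower semicontinuity along separating centres *)

Section local_lower_bounds.
Context {R : realType}.
Implicit Types (a b : \bar R) (F : nat -> R -> \bar R) (c r : R).

Lemma le_limn_einf (u : nat -> \bar R) a : (\forall k \near \oo, (a <= u k)%E) -> (a <= limn_einf u)%E.
Proof.
move=> [K _ KP]; rewrite limn_einf_lim; apply: lime_ge; first exact: is_cvg_einfs.
exists K => // n /= Kn; apply: le_ereal_inf_tmp => _ [k /= nk <-].
by apply: KP; exact: leq_trans nk.
Qed.

(** The quantities [F k r], increasing in [r], eventually exceed any number below
    [a] for a suitable fixed radius; [a] may be infinite. *)
Definition local_lower a F := forall c, (c%:E < a)%E ->
  exists r, \forall k \near \oo, (c%:E <= F k r)%E.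

Definition radius_mono F := forall k r s, r <= s -> (F k r <= F k s)%E.

Lemma split_lte a b c : (0 <= a)%E -> (0 <= b)%E -> (c%:E < a + b)%E ->
  exists c1 c2, [/\ c = c1 + c2, (c1%:E < a)%E & (c2%:E < b)%E].
Proof.
case: a b => [a| |] [b| |]//; rewrite ?lee_fin => a0 b0.
- rewrite lte_fin => cab; exists (a - (a + b - c) / 2), (b - (a + b - c) / 2).
  by rewrite !lte_fin; split; lra.
- by move=> _; exists (a - 1), (c - a + 1); split; [lra|rewrite lte_fin; lra|exact: ltry].
- by move=> _; exists (c - b + 1), (b - 1); split; [lra|exact: ltry|rewrite lte_fin; lra].
- by move=> _; exists (c - 1), 1; split; [lra|exact: ltry..].
Qed.

Lemma local_lowerD a b F G : (0 <= a)%E -> (0 <= b)%E -> radius_mono F -> radius_mono G ->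
  local_lower a F -> local_lower b G -> local_lower (a + b)%E (fun k r => F k r + G k r)%E.
Proof.
move=> a0 b0 mF mG aF bG c /(split_lte a0 b0)[c1 [c2 [-> /aF[r rP] /bG[s sP]]]].
exists (Num.max r s); near=> k; rewrite EFinD leeD//.
- by apply: (@le_trans _ _ (F k r)); [near: k|apply: mF; rewrite le_max lexx].
- by apply: (@le_trans _ _ (G k s)); [near: k|apply: mG; rewrite le_max lexx orbT].
Unshelve. all: by end_near.
Qed.

Lemma local_lower_sum (I : Type) (s : seq I) (a : I -> \bar R) (F : I -> nat -> R -> \bar R) :
  (forall i, (0 <= a i)%E) -> (forall i, radius_mono (F i)) ->
  (forall i, local_lower (a i) (F i)) ->
  local_lower (\sum_(i <- s) a i)%E (fun k r => \sum_(i <- s) F i k r)%E.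
Proof.
move=> a0 mF aF; elim: s => [|i s IH].
  rewrite big_nil => c c0; exists 0; apply: nearW => k; rewrite big_nil ltW//.
rewrite big_cons (_ : (fun k r => _) = fun k r => F i k r + \sum_(i <- s) F i k r)%E; last first.
  by apply/funext => k; apply/funext => r; rewrite big_cons.
apply: local_lowerD => //; first by apply: sume_ge0.
by move=> k r t rt; apply: lee_sum => j _; exact: mF.
Qed.

End local_lower_bounds.

Section lower_semicontinuity.
Context {R : realType} {N : nat}.
Local Notation E := 'rV[R]_N.
Local Notation mu := (@lebesgue_rV R N).
Local Notation Re := complex.Re.
Local Notation Im := complex.Im.
Implicit Types (f g : E -> R) (x y : E) (r c : R).

Lemma locint_test g f : locint g -> test f -> intg (fun x => g x * f x).
Proof. by move=> lg tf; apply: locint_bms => //; exact: test_bms. Qed.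

(** A number below the integral of [g ^ 2] is already exceeded in the dual formula
    by a single test function; its pairing with [G k] converges and its support
    provides the radius. *)
Lemma local_lower_test (G : nat -> E -> R) g : (forall k, locint (G k)) -> locint g ->
  (forall f, test f -> \int[mu]_x (G k x * f x) @[k --> \oo] --> \int[mu]_x (g x * f x)) ->
  local_lower (\int[mu]_x (g x ^+ 2)%:E)%E (fun k r => \int[mu]_x (G k x ^+ 2 * \1_(cball r) x)%:E)%E.
Proof.
move=> lG lg Gg c /(sqr_dual_test lg)[f tf cf]; have [_ [r rP]] := tf; exists r.
have bf2 : intg (fun x => f x ^+ 2) by apply: bms_intg; apply: bms_sqr; exact: test_bms.
have E h : locint h -> \int[mu]_x (2 * (h x * f x) - f x ^+ 2) = 2 * (\int[mu]_x (h x * f x)) - \int[mu]_x (f x ^+ 2).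
  by move=> lh; have ih := locint_test lh tf; rewrite RintB ?RintZ//; exact: intgZ.
have H : \int[mu]_x (2 * (G k x * f x) - f x ^+ 2) @[k --> \oo] --> \int[mu]_x (2 * (g x * f x) - f x ^+ 2).
  rewrite E//; under eq_fun do rewrite E//.
  by apply: cvgB; [apply: cvgM; [exact: cvg_cst|exact: Gg]|exact: cvg_cst].
near=> k; have ck : c < \int[mu]_x (2 * (G k x * f x) - f x ^+ 2).
  by near: k; move/cvgr_gt : H; exact.
have ik : intg (fun x => 2 * (G k x * f x) - f x ^+ 2).
  by apply: intgB => //; apply: intgZ; exact: locint_test.
have mG : measurable_fun setT (fun x => G k x ^+ 2 * \1_(cball r) x).
  apply: measurable_mul_indic; [exact: measurable_cball|apply: measurable_funX].
  by case: (lG k).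
apply: (@le_trans _ _ (\int[mu]_x (2 * (G k x * f x) - f x ^+ 2))%:E); first by rewrite lee_fin ltW.
have [y|] := ltP (\int[mu]_x (G k x ^+ 2 * \1_(cball r) x)%:E)%E +oo%E; last first.
  by rewrite leye_eq => /eqP ->; rewrite leey.
have iG : intg (fun x => G k x ^+ 2 * \1_(cball r) x).
  by apply: ge0_intgP => // x; rewrite mulr_ge0 ?sqr_ge0// indicE.
rewrite -EFin_Rint// lee_fin; apply: le_Rint => // x.
rewrite indicE; have [xr|xr] := leP `|x| r.
  by rewrite mem_set// mulr1; have := sqr_ge0 (G k x - f x); move: (G k x) (f x) => s t; nra.
by rewrite rP// mulr0 mulr0 expr0n/= subr0 mulr_ge0 ?sqr_ge0.
Unshelve. all: by end_near.
Qed.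

Lemma radius_mono_integral (e : nat -> E -> R) :
  (forall k, measurable_fun setT (e k)) -> (forall k x, 0 <= e k x) ->
  radius_mono (fun k r => \int[mu]_x (e k x * \1_(cball r) x)%:E)%E.
Proof.
move=> me e0 k r s rs; apply: nnint_le => [||x|x].
- by apply: measurable_mul_indic => //; exact: measurable_cball.
- by apply: measurable_mul_indic => //; exact: measurable_cball.
- by rewrite mulr_ge0// indicE.
- rewrite ler_wpM2l// !indicE; have [xr|] := boolP (x \in cball r); last by rewrite ler0n.
  by rewrite mem_set// /cball/=; apply: le_trans rs; exact: set_mem xr.
Qed.

Lemma sum_disjoint_balls (m : nat) (y : 'I_m -> E) r x :
  (forall i j, i != j -> 2 * r < `|y i - y j|) -> \sum_(i < m) \1_(cball r) (x - y i) <= 1 :> R.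
Proof.
move=> yr; have [[i xi]|xn] := pselect (exists i, cball r (x - y i)); last first.
  rewrite big1 => [|i _]; first exact: ler01.
  by rewrite indicE memNset// => xi; apply: xn; exists i.
rewrite (bigD1 i)//= big1 ?addr0; first by rewrite indicE; case: (_ \in _); rewrite ?lexx ?ler01.
move=> j ji; rewrite indicE memNset// /cball/= => xj; move: (yr _ _ ji); apply/negP; rewrite -leNgt.
rewrite (_ : y j - y i = (x - y i) - (x - y j)); last by apply/rowP => k; rewrite !mxE; ring.
apply: le_trans (ler_normB _ _) _; move: xi; rewrite /cball/=; lra.
Qed.

(** Finitely many lower bounds involve a common radius, and the balls of that
    radius around the centres are eventually disjoint. *)
Lemma lsc_disjoint_balls (e : nat -> E -> R) (a : nat -> \bar R) (y : nat -> nat -> E) :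
  (forall k, measurable_fun setT (e k)) -> (forall k x, 0 <= e k x) -> (forall n, (0 <= a n)%E) ->
  (forall n m, n <> m -> forall r, \forall k \near \oo, r < `|y n k - y m k|) ->
  (forall n, local_lower (a n) (fun k r => \int[mu]_x (e k (x + y n k) * \1_(cball r) x)%:E)%E) ->
  (\sum_(0 <= n <oo) a n <= limn_einf (fun k => \int[mu]_x (e k x)%:E))%E.
Proof.
move=> me e0 a0 sep low; apply: (lime_le (is_cvg_nneseries (fun n _ _ => a0 n))).
apply: nearW => m; rewrite big_mkord.
set L := limn_einf _.
have e0' k : (0 <= \int[mu]_x (e k x)%:E)%E by exact: nnint_ge0.
have L0 : (0 <= L)%E by apply: le_limn_einf; exact: nearW.
suff H c : (c%:E < \sum_(i < m) a i)%E -> (c%:E <= L)%E.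
  have A0 : (0 <= \sum_(i < m) a i)%E by exact: sume_ge0.
  move: L0 A0 H; case: L => [l| |]; case: (\sum_(i < m) a i)%E => [s| |]//; rewrite ?leey//.
  - rewrite !lee_fin => l0 s0 H; rewrite leNgt; apply/negP => ls.
    by have := H ((l + s) / 2); rewrite lte_fin lee_fin => /(_ ltac:(lra)); lra.
  - by move=> _ _ /(_ (l + 1)); rewrite ltry lee_fin gerDl ler10 => /(_ isT).
have me' n k : measurable_fun setT (fun x => e k (x + y n k)) by exact: measurable_fun_shift.
have := @local_lower_sum _ _ (index_enum 'I_m) (fun i => a i)
  (fun i k r => \int[mu]_x (e k (x + y i k) * \1_(cball r) x)%:E)%E (fun i => a0 i)
  (fun i => radius_mono_integral (me' i) (fun k x => e0 k _)) (fun i => low i) c.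
move=> H /H[r rP]; apply: le_limn_einf; near=> k.
have sepk i j : i != j -> 2 * r < `|y (i : 'I_m) k - y (j : 'I_m) k|.
  move: i j; near: k; apply: filter_forall => i; apply: filter_forall => j.
  have [->|ij] := eqVneq i j; first exact: nearW.
  have /sep/(_ (2 * r)) : (i : nat) <> j by move=> /val_inj/eqP; exact/negP.
  by apply: filterS => k + _.
apply: (@le_trans _ _ (\sum_(i < m) \int[mu]_x (e k (x + y i k) * \1_(cball r) x)%:E)%E).
  by near: k.
have mcb : measurable_fun setT (\1_(cball r) : E -> R).
  by apply: measurable_indic; exact: measurable_cball.
have mi i : measurable_fun setT (fun x => e k x * \1_(cball r) (x - y i k) : R).
  by apply: measurable_funM => //; exact: (measurable_fun_shift _ mcb).
have ind0 z : 0 <= \1_(cball r) z :> R by rewrite indicE.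
rewrite (eq_bigr (fun i : 'I_m => \int[mu]_x (e k x * \1_(cball r) (x - y i k))%:E)%E); last first.
  move=> i _; rewrite -(nnint_shift (y i k) (mi i)); last by move=> x; rewrite mulr_ge0.
  by apply: eq_integral => x _; rewrite addrK.
rewrite -nnint_sum//; last by move=> i x; rewrite mulr_ge0.
apply: nnint_le => [||x|x] //; first exact: measurable_sum.
  by rewrite sumr_ge0// => i _; rewrite mulr_ge0.
by rewrite -mulr_sumr ler_piMr// sum_disjoint_balls.
Unshelve. all: by end_near.
Qed.

(** The index [i] lets the same statement serve for functions and for gradients.
    Since [mshift_inv] does not change the modulus up to translation, the limits
    may be tested after the gauge transformation. *)
Lemma lsc_profiles (A : E -> E) (c : E -> R) (m : nat) (G V : nat -> 'I_m -> E -> R[i]) (y : nat -> nat -> E) :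
  (forall k i, cmeasurable (G k i)) ->
  (forall n k i, let w := mshift_inv A c (y n k) (G k i) in
    locint (fun x => Re (w x)) /\ locint (fun x => Im (w x))) ->
  (forall n i, locint (fun x => Re (V n i x)) /\ locint (fun x => Im (V n i x))) ->
  (forall n i f, test f -> let w k := mshift_inv A c (y n k) (G k i) in
    (\int[mu]_x (Re (w k x) * f x) @[k --> \oo] --> \int[mu]_x (Re (V n i x) * f x)) /\
    (\int[mu]_x (Im (w k x) * f x) @[k --> \oo] --> \int[mu]_x (Im (V n i x) * f x))) ->
  (forall n m, n <> m -> forall r, \forall k \near \oo, r < `|y n k - y m k|) ->
  (\sum_(0 <= n <oo) (\int[mu]_x (\sum_(i < m) cabs (V n i x) ^+ 2)%:E) <=
    limn_einf (fun k => \int[mu]_x (\sum_(i < m) cabs (G k i x) ^+ 2)%:E))%E.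
Proof.
move=> mG lG lV GV sep.
have mcG k i : measurable_fun setT (fun x => cabs (G k i x) ^+ 2) by exact: measurable_cabs_sqr.
apply: (lsc_disjoint_balls (y := y)) => // [k|k x|n|n].
- exact: measurable_sum.
- by apply: sumr_ge0 => i _; exact: sqr_ge0.
- by apply: nnint_ge0 => x; apply: sumr_ge0 => i _; exact: sqr_ge0.
have mV i : measurable_fun setT (fun x => Re (V n i x) ^+ 2) /\ measurable_fun setT (fun x => Im (V n i x) ^+ 2).
  by have [[mr _] [mi _]] := lV n i; split; exact: measurable_funX.
rewrite (_ : (\int[mu]_x _)%E = \sum_(i < m) (\int[mu]_x (Re (V n i x) ^+ 2)%:E + \int[mu]_x (Im (V n i x) ^+ 2)%:E))%E; last first.
  under eq_integral do under eq_bigr do rewrite cabs_sqr.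
  rewrite nnint_sum => [|i|i x]; [|by apply: measurable_funD; case: (mV i)|by rewrite addr_ge0 ?sqr_ge0].
  by apply: eq_bigr => i _; have [? ?] := mV i; rewrite nnintD// => x; exact: sqr_ge0.
pose Fr i k r := (\int[mu]_x (Re (mshift_inv A c (y n k) (G k i) x) ^+ 2 * \1_(cball r) x)%:E)%E.
pose Fi i k r := (\int[mu]_x (Im (mshift_inv A c (y n k) (G k i) x) ^+ 2 * \1_(cball r) x)%:E)%E.
have mw i k : measurable_fun setT (fun x => Re (mshift_inv A c (y n k) (G k i) x) ^+ 2) /\
    measurable_fun setT (fun x => Im (mshift_inv A c (y n k) (G k i) x) ^+ 2).
  by have [[mr _] [mi _]] := lG n k i; split; exact: measurable_funX.
rewrite (_ : (fun k r => _) = fun k r => \sum_(i < m) (Fr i k r + Fi i k r))%E; last first.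
  apply/funext => k; apply/funext => r.
  have mc := measurable_cball (N := N) r; have c0 (x : E) : 0 <= \1_(cball r) x :> R by rewrite indicE.
  have m1 i := measurable_mul_indic mc (mw i k).1.
  have m2 i := measurable_mul_indic mc (mw i k).2.
  rewrite (eq_bigr (fun i => \int[mu]_x (Re (mshift_inv A c (y n k) (G k i) x) ^+ 2 * \1_(cball r) x +
     Im (mshift_inv A c (y n k) (G k i) x) ^+ 2 * \1_(cball r) x)%:E)%E); last first.
    by move=> i _; rewrite nnintD//; move=> x; rewrite mulr_ge0 ?sqr_ge0.
  rewrite -nnint_sum => [|i|i x]; [|exact: measurable_funD|by apply: addr_ge0; apply: mulr_ge0 => //; exact: sqr_ge0].
  apply: eq_integral => x _; congr (_%:E); rewrite mulr_suml; apply: eq_bigr => i _.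
  by rewrite -(cabs_mshift_inv A c) cabs_sqr mulrDl.
have rr i : radius_mono (Fr i) by apply: radius_mono_integral => [k|k x]; [case: (mw i k)|exact: sqr_ge0].
have ri i : radius_mono (Fi i) by apply: radius_mono_integral => [k|k x]; [case: (mw i k)|exact: sqr_ge0].
apply: local_lower_sum => [i|i|i].
- by rewrite adde_ge0//; apply: nnint_ge0 => x; exact: sqr_ge0.
- by move=> k r s rs; apply: leeD; [exact: rr|exact: ri].
- apply: local_lowerD => //; try by apply: nnint_ge0 => x; exact: sqr_ge0.
  + apply: local_lower_test => [k||f tf]; [by case: (lG n k i)|by case: (lV n i)|by case: (GV n i f tf)].
  + apply: local_lower_test => [k||f tf]; [by case: (lG n k i)|by case: (lV n i)|by case: (GV n i f tf)].
Qed.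

End lower_semicontinuity.

(** * Lower semicontinuity of the mass and of the energy *)

Lemma cvg_sub0 (R : realType) (a b : nat -> R) (l : R) :
  a k - b k @[k --> \oo] --> (0 : R) -> b k @[k --> \oo] --> l -> a k @[k --> \oo] --> l.
Proof.
move=> ab bl; have H := cvgD ab bl; rewrite add0r in H.
have E : (fun k => a k - b k + b k) = a by apply/funext => k; rewrite subrK.
by rewrite -E; exact: H.
Qed.

Section semicontinuity_statements.
Context {R : realType} {N : nat}.
Local Notation E := 'rV[R]_N.
Local Notation mu := (@lebesgue_rV R N).
Local Notation Re := complex.Re.
Local Notation Im := complex.Im.
Variables (N_gt0 : (0 < N)%N) (A : E -> E) (A_C1 : dotC1 A) (c : E -> R).
Variables (u : nat -> E -> R[i]) (v : nat -> E -> R[i]) (y : nat -> nat -> E).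
Hypothesis uvy : profile_decomposition A c u v y.
Hypothesis u_wgrad : forall k, has_wgrad (u k).

Lemma enorm_cvg_separated (a b : nat -> E) : enorm (a k - b k) @[k --> \oo] --> +oo ->
  forall r : R, \forall k \near \oo, r < `|a k - b k|.
Proof.
move=> /cvgryPgt H r; apply: filterS (H (N%:R * r)) => k /lt_le_trans/(_ (enorm_le _)).
by rewrite ltr_pM2l// ltr0n.
Qed.

Lemma profiles_separated n m : n <> m -> forall r : R, \forall k \near \oo, r < `|y n k - y m k|.
Proof. by move=> nm; apply: enorm_cvg_separated; exact: (pd_separation uvy). Qed.

Lemma locint_mshift_inv (z : E) (w : E -> R[i]) :
  locint (fun x => Re (w x)) -> locint (fun x => Im (w x)) ->
  locint (fun x => Re (mshift_inv A c z w x)) /\ locint (fun x => Im (mshift_inv A c z w x)).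
Proof.
move=> lr li; have cphi := continuous_phase A_C1 (c := c) (y := z).
have cc : continuous (fun x => cos (phase A c z x)) by apply: continuous_cvg_fun => //; exact: continuous_cos.
have cs : continuous (fun x => sin (phase A c z x)) by apply: continuous_cvg_fun => //; exact: continuous_sin.
have lM (h f : E -> R) : continuous h -> locint f -> locint (fun x => h x * f x).
  move=> ch; apply: locintM; first exact: continuous_measurable_rV.
  by move=> r; exact: continuous_bounded_cball.
split.
- under eq_fun do rewrite re_mshift_inv.
  exact: (locint_shift z (locintD (lM _ _ cc lr) (lM _ _ cs li))).
- under eq_fun do rewrite im_mshift_inv.
  exact: (locint_shift z (locintD (lM _ _ cc li) (locintN (lM _ _ cs lr)))).
Qed.

Lemma locint_mgrad (B : E -> E) (w : E -> R[i]) (i : 'I_N) : continuous (fun x => B x ord0 i) -> has_wgrad w ->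
  locint (fun x => Re (mgrad B w i x)) /\ locint (fun x => Im (mgrad B w i x)).
Proof.
move=> cB hw; have [gr gi] := wgrad_locint i hw; have [wr wi] := has_wgrad_locint hw.
have lM (f : E -> R) : locint f -> locint (fun x => B x ord0 i * f x).
  apply: locintM; first exact: continuous_measurable_rV.
  by move=> r; exact: continuous_bounded_cball.
split; [under eq_fun do rewrite re_mgrad|under eq_fun do rewrite im_mgrad].
- by apply: locintD => //; apply: locintN; exact: lM.
- by apply: locintD => //; exact: lM.
Qed.

Lemma lsc_L2 : (\sum_(0 <= n <oo) sqL2 setT (v n) <= limn_einf (fun k => sqL2 setT (u k)))%E.
Proof.
have H := @lsc_profiles R N A c 1 (fun k _ => u k) (fun n _ => v n) y.
have E1 w : sqL2 setT w = (\int[mu]_x (\sum_(i < 1) cabs (w x) ^+ 2)%:E)%E.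
  by apply: eq_integral => x _; rewrite big_ord1.
under eq_eseriesr do rewrite E1; rewrite [X in limn_einf X](funext (fun k => E1 (u k))).
apply: H => [k _|n k _|n _|n _ f tf|].
- exact: has_wgrad_cmeasurable.
- by have [? ?] := has_wgrad_locint (u_wgrad k); exact: locint_mshift_inv.
- by have [_ /H1loc_has_wgrad/has_wgrad_locint] := pd_weak_limits uvy n.
- by apply: weak_cvg_Rint (test_bms tf); exact: (pd_weak_limits uvy).
- exact: profiles_separated.
Qed.

Variables (M : R) (u_bounded : forall k, (sqL2 setT (u k) <= M%:E)%E).
Variable Ainf : nat -> E -> E.
Hypothesis Ainf_continuous : forall n i, continuous (fun x => Ainf n x ord0 i).
Hypothesis Ainf_cvg : forall n r (eps : R), 0 < eps -> \forall k \near \oo, forall x, `|x| <= r ->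
  forall i, `|corrected_potential A c (y n k) (x + y n k) ord0 i - Ainf n x ord0 i| <= eps.

(** In [gauge_covariance] the corrected potential is first replaced by its limit;
    as [u k] is bounded in L2, this costs at most a multiple of the uniform
    distance on the support of the test function. *)
Lemma lsc_energy : (\sum_(0 <= n <oo) energy setT (Ainf n) (v n) <=
  limn_einf (fun k => energy setT A (u k)))%E.
Proof.
have hv n : has_wgrad (v n) by have [_ /H1loc_has_wgrad] := pd_weak_limits uvy n.
have H := @lsc_profiles R N A c N (fun k => mgrad A (u k)) (fun n => mgrad (Ainf n) (v n)) y.
rewrite (_ : (fun k => energy _ _ _) = fun k => (\int[mu]_x (\sum_(i < N) cabs (mgrad A (u k) i x) ^+ 2)%:E)%E); last first.
  by apply/funext => k; rewrite energyE.
under eq_eseriesr do rewrite energyE//.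
have cA i : continuous (fun x => A x ord0 i) by exact: continuous_potential.
apply: H => [k i|n k i|n i|n i f tf|].
- exact: measurable_mgrad.
- by have [? ?] := locint_mgrad (cA i) (u_wgrad k); exact: locint_mshift_inv.
- exact: locint_mgrad.
- move=> w.
  pose B (k : nat) (x : E) : R := corrected_potential A c (y n k) (x + y n k) ord0 i.
  pose w0 k := mshift_inv A c (y n k) (u k).
  have bf := test_bms tf; have bdf := test_bms (partial_test i tf).
  have cB k : continuous (B k).
    have cB0 := continuous_corrected_potential A_C1 (c := c) (y := y n k) (j := i).
    by move=> x; exact: (cvg_comp _ _ (@continuous_shift _ _ (y n k) x) (cB0 (x + y n k))).
  have bBf k : bms (fun x => B k x * f x) by exact: continuous_mul_bms.
  have bAf : bms (fun x => Ainf n x ord0 i * f x) by exact: continuous_mul_bms.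
  have lw k : locint (fun x => Re (w0 k x)) /\ locint (fun x => Im (w0 k x)).
    by have [? ?] := has_wgrad_locint (u_wgrad k); exact: locint_mshift_inv.
  have [dr di] := weak_cvg_Rint (pd_weak_limits uvy n) bdf.
  have [Ar Ai] := weak_cvg_Rint (pd_weak_limits uvy n) bAf.
  have key (p : nat -> E -> R) : (forall k, locint (p k)) ->
      (forall k, \int[mu]_x (p k x ^+ 2)%:E <= M%:E)%E ->
      \int[mu]_x (p k x * (B k x * f x)) - \int[mu]_x (p k x * (Ainf n x ord0 i * f x)) @[k --> \oo] --> (0 : R).
    move=> lp pM; have [_ [r rP]] := tf.
    have iF : intg (fun x => f x ^+ 2) by apply: bms_intg; exact: bms_sqr.
    have ip k : intg (fun x => p k x ^+ 2).
      apply: ge0_intgP => [|x|]; [by apply: measurable_funX; case: (lp k)|exact: sqr_ge0|].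
      by apply: le_lt_trans (pM k) (ltry _).
    have M0 : 0 <= M by rewrite -lee_fin; apply: le_trans (pM 0%N); apply: nnint_ge0 => x; exact: sqr_ge0.
    have F0 : 0 <= \int[mu]_x (f x ^+ 2) by apply: Rint_ge0 => x; exact: sqr_ge0.
    apply/cvgrPdist_le => e e0.
    pose d := e / (M + \int[mu]_x (f x ^+ 2) + 1).
    have d0 : 0 < d by rewrite divr_gt0// ltr_wpDl// addr_ge0.
    have := Ainf_cvg n r d0; apply: filterS => k kd.
    have i1 : intg (fun x => p k x * (B k x * f x)) by exact: locint_bms.
    have i2 : intg (fun x => p k x * (Ainf n x ord0 i * f x)) by exact: locint_bms.
    rewrite sub0r normrN -RintB//; have i12 := intgB i1 i2.
    apply: le_trans (normr_Rint i12) _.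
    apply: (@le_trans _ _ (\int[mu]_x (d * (p k x ^+ 2 + f x ^+ 2)))).
      apply: le_Rint => [||x]; [exact: intg_norm|by apply: intgZ; exact: intgD|].
      rewrite -mulrBr -mulrBl mulrCA normrM; have [xr|xr] := leP `|x| r; last first.
        by rewrite rP// !mulr0 normr0 mulr0 mulr_ge0 ?(ltW d0)// addr_ge0 ?sqr_ge0.
      apply: ler_pM => //; first exact: kd.
      rewrite normrM -[X in _ <= X + _]real_normK ?num_real// -[X in _ <= _ + X]real_normK ?num_real//.
      have := sqr_ge0 (`|p k x| - `|f x|); have := mulr_ge0 (normr_ge0 (p k x)) (normr_ge0 (f x)).
      by move: (`|p k x|) (`|f x|) => s t; nra.
    rewrite RintZ ?RintD//; last exact: intgD.
    have pM' : \int[mu]_x (p k x ^+ 2) <= M by rewrite -lee_fin EFin_Rint.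
    rewrite /d mulrAC ler_pdivrMr ?ltr_wpDl ?addr_ge0// ler_wpM2l ?(ltW e0)//.
    by move: pM'; lra.
  have mu2 k : measurable_fun setT (fun x => cabs (u k x) ^+ 2).
    by apply: measurable_cabs_sqr; exact: has_wgrad_cmeasurable.
  have w0M k : (\int[mu]_x (cabs (w0 k x) ^+ 2)%:E <= M%:E)%E.
    apply: le_trans (u_bounded k); under eq_integral do rewrite cabs_mshift_inv.
    by rewrite (nnint_shift (y n k) (mu2 k))// => x; exact: sqr_ge0.
  have mw2 k : measurable_fun setT (fun x => cabs (w0 k x) ^+ 2).
    by have [[mr _] [mi _]] := lw k; apply: measurable_cabs_sqr.
  have kr : \int[mu]_x (Re (w0 k x) * (B k x * f x)) -
      \int[mu]_x (Re (w0 k x) * (Ainf n x ord0 i * f x)) @[k --> \oo] --> (0 : R).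
    apply: key => k; first by case: (lw k).
    apply: le_trans (w0M k); apply: nnint_le => [|//|x|x]; [|exact: sqr_ge0|by rewrite cabs_sqr lerDl sqr_ge0].
    by apply: measurable_funX; case: (lw k) => -[].
  have ki : \int[mu]_x (Im (w0 k x) * (B k x * f x)) -
      \int[mu]_x (Im (w0 k x) * (Ainf n x ord0 i * f x)) @[k --> \oo] --> (0 : R).
    apply: key => k; first by case: (lw k).
    apply: le_trans (w0M k); apply: nnint_le => [|//|x|x]; [|exact: sqr_ge0|by rewrite cabs_sqr lerDr sqr_ge0].
    by apply: measurable_funX; case: (lw k) => _ [].
  have [dvr dvi] := wgrad_wderiv i (hv n); have [lvr lvi] := has_wgrad_locint (hv n).
  have [lgr lgi] := wgrad_locint i (hv n).
  split.
  + rewrite (_ : (fun k => _) = fun k => - (\int[mu]_x (Re (w0 k x) * partial i f x)) -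
        \int[mu]_x (Im (w0 k x) * (B k x * f x))); last first.
      by apply/funext => k; exact: (gauge_covariance A_C1 c (y n k) i (u_wgrad k) tf).1.
    rewrite (_ : (\int[mu]_x _) = - (\int[mu]_x (Re (v n x) * partial i f x)) -
        (\int[mu]_x (Im (v n x) * (Ainf n x ord0 i * f x)))); last first.
      case: dvr => _ _ /(_ _ tf) ->; rewrite opprK -RintB; [|exact: locint_bms..].
      by apply: eq_Rintegral => x _; rewrite re_mgrad; ring.
    apply: cvgB; first exact: cvgN.
    exact: cvg_sub0 ki Ai.
  + rewrite (_ : (fun k => _) = fun k => - (\int[mu]_x (Im (w0 k x) * partial i f x)) +
        \int[mu]_x (Re (w0 k x) * (B k x * f x))); last first.
      by apply/funext => k; exact: (gauge_covariance A_C1 c (y n k) i (u_wgrad k) tf).2.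
    rewrite (_ : (\int[mu]_x _) = - (\int[mu]_x (Im (v n x) * partial i f x)) +
        (\int[mu]_x (Re (v n x) * (Ainf n x ord0 i * f x)))); last first.
      case: dvi => _ _ /(_ _ tf) ->; rewrite opprK -RintD; [|exact: locint_bms..].
      by apply: eq_Rintegral => x _; rewrite im_mgrad; ring.
    apply: cvgD; first exact: cvgN.
    exact: cvg_sub0 kr Ar.
- exact: profiles_separated.
Qed.

End semicontinuity_statements.

(** * Moments of order p *)

Section power_inequalities.
Context {R : realType}.
Variables (p : R) (p_gt2 : 2 < p).
Implicit Types (a b t : R).

Let p0 : 0 < p. Proof. by apply: lt_trans p_gt2. Qed.

Lemma ler_powRp a b : 0 <= a -> a <= b -> a `^ p <= b `^ p.
Proof. by move=> a0 ab; apply: ge0_ler_powR; rewrite ?nnegrE ?(ltW p0)// (le_trans a0). Qed.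

Lemma powRp0 : 0 `^ p = 0 :> R.
Proof. by rewrite powR0// gt_eqF. Qed.

(** Either [b] is at most [d a], and [(1 + d) ^ p = 1 + t], or [a] is at most
    [b / d]. This replaces Minkowski's inequality and keeps all estimates at the
    level of p-th powers. *)
Lemma powRD_almost t : 0 < t -> exists2 C, 0 <= C & forall a b, 0 <= a -> 0 <= b ->
  (a + b) `^ p <= (1 + t) * a `^ p + C * b `^ p.
Proof.
move=> t0; pose d := (1 + t) `^ p^-1 - 1.
have d1 : 0 < 1 + d by rewrite addrC subrK powR_gt0// addr_gt0.
have dp : (1 + d) `^ p = 1 + t.
  by rewrite /d addrC subrK -powRrM mulVf ?gt_eqF// powRr1// addr_ge0// ltW.
have d0 : 0 < d.
  rewrite ltNge; apply/negP => d0; have : (1 + d) `^ p <= 1 `^ p by apply: ler_powRp; lra.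
  by rewrite dp powR1; lra.
exists ((1 + d^-1) `^ p) => [|a b a0 b0]; first exact: powR_ge0.
have di0 : 0 <= d^-1 by rewrite invr_ge0 ltW.
have [ba|ba] := leP b (d * a).
  apply: (@le_trans _ _ ((1 + t) * a `^ p)); last by rewrite lerDl mulr_ge0 ?powR_ge0.
  by rewrite -dp -powRM ?(ltW d1)//; apply: ler_powRp; [exact: addr_ge0|lra].
apply: (@le_trans _ _ ((1 + d^-1) `^ p * b `^ p)); last by rewrite lerDr mulr_ge0 ?powR_ge0// addr_ge0// ltW.
rewrite -powRM//; last exact: addr_ge0.
apply: ler_powRp; first exact: addr_ge0.
have : a <= d^-1 * b by rewrite ler_pdivlMl// ltW.
lra.
Qed.

Lemma powRD_le2 a b : 0 <= a -> 0 <= b -> (a + b) `^ p <= 2 `^ p * (a `^ p + b `^ p).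
Proof.
move=> a0 b0; wlog ab : a b a0 b0 / a <= b.
  by move=> H; have [/H->//|/ltW/H] := leP a b; rewrite addrC [X in _ * X]addrC; exact.
apply: (@le_trans _ _ (2 `^ p * b `^ p)); last by rewrite ler_wpM2l ?powR_ge0// lerDr powR_ge0.
by rewrite -powRM//; apply: ler_powRp; [exact: addr_ge0|lra].
Qed.

Lemma powR_sum_le (I : Type) (s : seq I) (f : I -> R) : (forall i, 0 <= f i) ->
  (\sum_(i <- s) f i) `^ p <= (2 `^ p) ^+ size s * \sum_(i <- s) f i `^ p.
Proof.
move=> f0; elim: s => [|i s IH]; first by rewrite !big_nil powRp0 mulr0.
have q1 : 1 <= 2 `^ p :> R.
  by have : 1 `^ p <= 2 `^ p :> R; [apply: ler_powRp; lra|rewrite powR1].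
have S0 : 0 <= \sum_(j <- s) f j by exact: sumr_ge0.
rewrite !big_cons; apply: le_trans (powRD_le2 (f0 i) S0) _.
rewrite exprS -mulrA ler_wpM2l ?powR_ge0// mulrDr lerD//.
by rewrite ler_peMl ?powR_ge0// exprn_ege1.
Qed.

Lemma powR_split a : 0 <= a -> a `^ p = a * a `^ (p - 1).
Proof.
rewrite le_eqVlt => /predU1P[<-|a0]; first by rewrite powRp0 mul0r.
by rewrite -{2}(powRr1 (ltW a0)) -powRDpos//; congr (_ `^ _); ring.
Qed.

Lemma powRD_super a b : 0 <= a -> 0 <= b -> a `^ p + b `^ p <= (a + b) `^ p.
Proof.
move=> a0 b0; rewrite (powR_split a0) (powR_split b0) (powR_split (addr_ge0 a0 b0)) mulrDl.
have p1 : 0 <= p - 1 by rewrite subr_ge0; apply: le_trans (ltW p_gt2); rewrite ler1n.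
by apply: lerD; apply: ler_wpM2l => //; apply: (ge0_ler_powR p1); rewrite ?nnegrE ?addr_ge0// ?lerDl ?lerDr.
Qed.

Lemma powR_sum_super (I : Type) (s : seq I) (f : I -> R) : (forall i, 0 <= f i) ->
  \sum_(i <- s) f i `^ p <= (\sum_(i <- s) f i) `^ p.
Proof.
move=> f0; elim: s => [|i s IH]; first by rewrite !big_nil powRp0.
rewrite !big_cons; apply: le_trans (powRD_super (f0 i) (sumr_ge0 _ (fun i _ => f0 i))).
by rewrite lerD2l.
Qed.

(** Truncation in height turns L2 smallness into smallness of p-th powers. *)
Lemma powR_min_le a (L : R) : 0 <= a -> 0 <= L -> Num.min a L `^ p <= L `^ (p - 2) * a ^+ 2.
Proof.
move=> a0 L0; have m0 : 0 <= Num.min a L by rewrite le_min a0.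
have [->|mn0] := eqVneq (Num.min a L) 0; first by rewrite powRp0 mulr_ge0 ?powR_ge0 ?sqr_ge0.
have mp : 0 < Num.min a L by rewrite lt_def mn0.
rewrite (_ : p = (p - 2) + 2); last by ring.
rewrite powRDpos// addrK (powR_mulrn 2 m0) ler_pM ?powR_ge0 ?exprn_ge0//.
- by apply: ge0_ler_powR; rewrite ?nnegrE// ?ge_min ?lexx ?orbT// subr_ge0 ltW.
- by rewrite lerXn2r ?nnegrE// ge_min lexx.
Qed.

End power_inequalities.

Section moments.
Context {R : realType} {N : nat}.
Local Notation E := 'rV[R]_N.
Local Notation mu := (@lebesgue_rV R N).
Implicit Types (f g : E -> R) (x y : E).

Variables (p : R) (p_gt2 : 2 < p).
Let p0 : 0 < p. Proof. by apply: lt_trans p_gt2. Qed.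

Definition moment f : \bar R := (\int[mu]_x (f x `^ p)%:E)%E.

Lemma moment_ge0 f : (0 <= moment f)%E.
Proof. by apply: nnint_ge0 => x; exact: powR_ge0. Qed.

Lemma moment_le f g : measurable_fun setT f -> measurable_fun setT g ->
  (forall x, 0 <= f x) -> (forall x, f x <= g x) -> (moment f <= moment g)%E.
Proof.
move=> mf mg f0 fg; apply: nnint_le => [||x|x]; [exact: measurable_fun_powR..|exact: powR_ge0|].
exact: ler_powRp.
Qed.

Lemma moment_almost (t : R) : 0 < t -> exists2 C : R, 0 <= C & forall f g (h : E -> R),
  measurable_fun setT f -> measurable_fun setT g -> measurable_fun setT h ->
  (forall x, 0 <= f x) -> (forall x, 0 <= g x) -> (forall x, 0 <= h x) ->
  (forall x, f x <= g x + h x) ->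
  (moment f <= (1 + t)%:E * moment g + C%:E * moment h)%E.
Proof.
move=> t0; have [C C0 CP] := powRD_almost p_gt2 t0; exists C => // f g h mf mg mh f0 g0 h0 fgh.
have t1 : 0 <= 1 + t by rewrite addr_ge0// ltW.
have mgp := measurable_fun_powR p mg; have mhp := measurable_fun_powR p mh.
rewrite /moment -nnintZ//; [|by move=> x; exact: powR_ge0].
rewrite -nnintZ//; [|by move=> x; exact: powR_ge0].
rewrite -nnintD; [|exact: measurable_funM|exact: measurable_funM|
  by move=> x; rewrite mulr_ge0 ?powR_ge0|by move=> x; rewrite mulr_ge0 ?powR_ge0].
apply: nnint_le => [||x|x]; [exact: measurable_fun_powR| |exact: powR_ge0|].
  by apply: measurable_funD; exact: measurable_funM.
by apply: le_trans (ler_powRp p_gt2 (f0 x) (fgh x)) _; exact: CP.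
Qed.

Lemma momentD_le f g : measurable_fun setT f -> measurable_fun setT g ->
  (forall x, 0 <= f x) -> (forall x, 0 <= g x) ->
  (moment (fun x => f x + g x)%R <= (2 `^ p)%:E * (moment f + moment g))%E.
Proof.
move=> mf mg f0 g0; have mfp := measurable_fun_powR p mf; have mgp := measurable_fun_powR p mg.
rewrite /moment -nnintD// => [|x|x]; [|exact: powR_ge0..].
rewrite -nnintZ ?powR_ge0//; [|exact: measurable_funD|by move=> x; rewrite addr_ge0 ?powR_ge0].
apply: nnint_le => [||x|x]; [|by apply: measurable_funM => //; exact: measurable_funD|exact: powR_ge0|exact: powRD_le2].
by apply: measurable_fun_powR; exact: measurable_funD.
Qed.

Lemma moment_sum_le (I : Type) (s : seq I) (F : I -> E -> R) :
  (forall i, measurable_fun setT (F i)) -> (forall i x, 0 <= F i x) ->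
  (moment (fun x => \sum_(i <- s) F i x)%R <= ((2 `^ p) ^+ size s)%:E * \sum_(i <- s) moment (F i))%E.
Proof.
move=> mF F0; have mFp i := measurable_fun_powR p (mF i).
rewrite /moment -nnint_sum => [|//|i x]; last exact: powR_ge0.
rewrite -nnintZ ?exprn_ge0 ?powR_ge0//; [|exact: measurable_sum|by move=> x; apply: sumr_ge0 => i _; exact: powR_ge0].
apply: nnint_le => [||x|x]; [|by apply: measurable_funM => //; exact: measurable_sum|exact: powR_ge0|by apply: powR_sum_le].
by apply: measurable_fun_powR; exact: measurable_sum.
Qed.

Lemma moment_sum_super (I : Type) (s : seq I) (F : I -> E -> R) :
  (forall i, measurable_fun setT (F i)) -> (forall i x, 0 <= F i x) ->
  (\sum_(i <- s) moment (F i) <= moment (fun x => \sum_(i <- s) F i x)%R)%E.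
Proof.
move=> mF F0; have mFp i := measurable_fun_powR p (mF i).
rewrite /moment -nnint_sum => [|//|i x]; last exact: powR_ge0.
apply: nnint_le => [||x|x]; [exact: measurable_sum| |by apply: sumr_ge0 => i _; exact: powR_ge0|by apply: powR_sum_super].
by apply: measurable_fun_powR; exact: measurable_sum.
Qed.

Lemma moment_shift f y : measurable_fun setT f -> moment (fun x => f (x + y)) = moment f.
Proof.
by move=> mf; apply: (nnint_shift y (measurable_fun_powR p mf)) => x; exact: powR_ge0.
Qed.

Hypotheses (N_gt1 : (1 < N)%N) (p_crit : p * (N%:R - 2) < 2 * N%:R).

(** A small multiple of [f] falls under [sobolev_small]. *)
Lemma moment_fin f (e : R) : measurable_fun setT f -> (forall x, 0 <= f x) -> 0 <= e ->
  (\int[mu]_x (f x ^+ 2)%:E <= e%:E)%E -> transl_bound f e -> (moment f < +oo)%E.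
Proof.
move=> mf f0 e0 f2 tf; have [C C0 CP] := sobolev_small N_gt1 p_gt2 p_crit.
have Ce0 : 0 <= C * e by exact: mulr_ge0.
pose t := (2 * (C * e + 1))^-1.
have t0 : 0 < t by rewrite invr_gt0 mulr_gt0// ltr_wpDl.
have t1 : t <= 1 by rewrite invf_le1 ?mulr_gt0 ?ltr_wpDl//; lra.
have te : C * (t ^+ 2 * e) <= 2^-1.
  have -> : C * (t ^+ 2 * e) = t * (t * (C * e)) by ring.
  have h : t * (C * e) <= 2^-1.
    by rewrite /t mulrC ler_pdivrMr ?mulr_gt0 ?ltr_wpDl// mulrA mulVf ?mul1r ?lerDl.
  by apply: le_trans h; rewrite ler_piMl// mulr_ge0// ltW.
have mf2 : measurable_fun setT (fun x => f x ^+ 2) by exact: measurable_funX.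
have := CP (fun x => t * f x) (t ^+ 2 * e).
have t20 : 0 <= t ^+ 2 by exact: sqr_ge0.
have sc (g : E -> R) (d : R) : measurable_fun setT g ->
    (\int[mu]_x (g x ^+ 2)%:E <= d%:E)%E -> (\int[mu]_x ((t * g x) ^+ 2)%:E <= (t ^+ 2 * d)%:E)%E.
  move=> mg gd; under eq_integral do rewrite exprMn.
  rewrite nnintZ//; [|exact: measurable_funX|by move=> x; exact: sqr_ge0].
  by rewrite [leRHS]EFinM lee_wpmul2l.
have h1 : transl_bound (fun x => t * f x) (t ^+ 2 * e).
  move=> r h r0 hr; rewrite mulrCA; under eq_integral do rewrite -mulrBr.
  apply: (sc (fun x => f (x + h) - f x)); last exact: tf.
  by apply: measurable_funB => //; exact: measurable_fun_shift.
move=> /(_ (measurable_funM (measurable_cst t) mf) (fun x => mulr_ge0 (ltW t0) (f0 x))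
  (mulr_ge0 t20 e0) (sc _ _ mf f2) h1 te) H.
have tp : 0 < t `^ p by exact: powR_gt0.
have : (moment (fun x => t * f x)%R < +oo)%E by apply: le_lt_trans H (ltry _).
rewrite /moment (_ : (fun x => _) = fun x => (t `^ p * f x `^ p)%:E); last first.
  by apply/funext => x; rewrite powRM// ltW.
rewrite nnintZ ?powR_ge0//; [|exact: measurable_fun_powR|by move=> x; exact: powR_ge0].
rewrite !ltey; apply: contra_neqN => /eqP ->.
by rewrite gt0_muley.
Qed.

End moments.

(** * Tails of the series of moduli *)

Section profile_sums.
Context {R : realType} {N : nat}.
Local Notation E := 'rV[R]_N.
Local Notation mu := (@lebesgue_rV R N).
Local Notation Re := complex.Re.
Local Notation Im := complex.Im.
Implicit Types (f g : E -> R) (x z : E) (s : seq nat).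

Lemma transl_bound_le f (a b : R) : a <= b -> transl_bound f a -> transl_bound f b.
Proof.
move=> ab fa r h r0 hr; apply: le_trans (fa r h r0 hr) _.
by rewrite lee_fin ler_wpM2l ?sqr_ge0.
Qed.

Lemma nnint_sqrB f g (a b : R) : measurable_fun setT f -> measurable_fun setT g ->
  (\int[mu]_x (f x ^+ 2)%:E <= a%:E)%E -> (\int[mu]_x (g x ^+ 2)%:E <= b%:E)%E ->
  (\int[mu]_x ((f x - g x) ^+ 2)%:E <= (2 * (a + b))%:E)%E.
Proof.
move=> mf mg fa gb; apply: (nnint_sqrD mf (measurable_funN mg) fa).
by under eq_integral do rewrite sqrrN.
Qed.

Lemma transl_boundB f g (a b : R) : measurable_fun setT f -> measurable_fun setT g ->
  transl_bound f a -> transl_bound g b -> transl_bound (fun x => f x - g x) (2 * (a + b)).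
Proof.
move=> mf mg fa gb r h r0 hr.
have -> : r ^+ 2 * (2 * (a + b)) = 2 * (r ^+ 2 * a + r ^+ 2 * b) by ring.
rewrite (_ : (fun x => _) = fun x => (((f (x + h) - f x) - (g (x + h) - g x)) ^+ 2)%:E); last first.
  by apply/funext => x; congr ((_ ^+ 2)%:E); ring.
by apply: nnint_sqrB; rewrite ?fa ?gb//; apply: measurable_funB => //; exact: measurable_fun_shift.
Qed.

Lemma re_sum (I : Type) (s : seq I) (F : I -> R[i]) : Re (\sum_(i <- s) F i) = \sum_(i <- s) Re (F i).
Proof. by elim: s => [|i s IH]; rewrite ?big_nil// !big_cons reD IH. Qed.

Lemma cabs0 : cabs (0 : R[i]) = 0.
Proof. by rewrite /cabs/= expr0n/= addr0 sqrtr0. Qed.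

Lemma cabsN (z : R[i]) : cabs (- z) = cabs z.
Proof. exact: normcN. Qed.

Lemma cabs_real (a : R) : 0 <= a -> cabs (a%:C)%C = a.
Proof. by move=> a0; rewrite /cabs/= expr0n/= addr0 sqrtr_sqr ger0_norm. Qed.

Lemma cabs_sum (I : Type) (s : seq I) (F : I -> R[i]) : cabs (\sum_(i <- s) F i) <= \sum_(i <- s) cabs (F i).
Proof.
elim: s => [|i s IH]; first by rewrite !big_nil cabs0.
by rewrite !big_cons; apply: le_trans (cabsD _ _) _; rewrite lerD2l.
Qed.

Lemma cabs_cis t : cabs (cis t : R[i]) = 1.
Proof. by rewrite /cabs/= cos2Dsin2 sqrtr1. Qed.

Lemma cmeasurableB (a b : E -> R[i]) : cmeasurable a -> cmeasurable b -> cmeasurable (fun x => a x - b x).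
Proof.
move=> [ar ai] [br bi]; split; [under eq_fun do rewrite reB|under eq_fun do rewrite imB]; exact: measurable_funB.
Qed.

Lemma cmeasurable_sum (I : Type) (s : seq I) (F : I -> E -> R[i]) : (forall i, cmeasurable (F i)) ->
  cmeasurable (fun x => \sum_(i <- s) F i x).
Proof.
move=> mF; elim: s => [|i s [mr mi]].
  by under eq_fun do rewrite big_nil; split; exact: measurable_cst.
have [fr fi] := mF i; under eq_fun do rewrite big_cons.
by split; [under eq_fun do rewrite reD|under eq_fun do rewrite imD]; exact: measurable_funD.
Qed.

Lemma cabs_sum_disjoint (p : R) (m : nat) (F : 'I_m -> R[i]) : 0 < p ->
  (forall i j, i != j -> F i = 0 \/ F j = 0) ->
  cabs (\sum_i F i) `^ p = \sum_i cabs (F i) `^ p.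
Proof.
move=> p0 F0; have z : 0 `^ p = 0 :> R by rewrite powR0// gt_eqF.
have [[i Fi]|nF] := pselect (exists i, F i <> 0); last first.
  have Fz i : F i = 0 by apply: contrapT => Fi; apply: nF; exists i.
  rewrite !big1 ?cabs0 ?z// => i _; rewrite Fz ?cabs0//.
have Fj j : j != i -> F j = 0 by move=> /F0[].
rewrite (bigD1 i)//= (bigD1 (F := fun i => cabs (F i) `^ p) i)//= !big1 ?addr0// => j ji; rewrite Fj//.
by rewrite cabs0 z.
Qed.

Variables (N_gt1 : (1 < N)%N) (p : R) (p_gt2 : 2 < p) (p_crit : p * (N%:R - 2) < 2 * N%:R).
Let p0 : 0 < p. Proof. by apply: lt_trans p_gt2. Qed.

Variables (A : E -> E) (c : E -> R) (u v : nat -> E -> R[i]) (y : nat -> nat -> E).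
Hypothesis uvy : profile_decomposition A c u v y.
Hypothesis u_meas : forall k, cmeasurable (u k).

Definition modulus n x : R := cabs (v n x).

Lemma modulus_ge0 n x : 0 <= modulus n x. Proof. exact: cabs_ge0. Qed.

Lemma measurable_modulus n : measurable_fun setT (modulus n).
Proof. by apply: measurable_cabs; have [_ []] := pd_weak_limits uvy n. Qed.

Lemma measurable_modulus_shift n z : measurable_fun setT (fun x => modulus n (x - z)).
Proof. exact: measurable_fun_shift (measurable_modulus n). Qed.

Lemma moment_profile_lty n : (moment p (modulus n) < +oo)%E.
Proof.
have [S [/(_ n 0%N)[mf fy] _ _]] := pd_abs_series uvy.
set f := fun x => _ in mf fy.
have f0 : (0 <= sqH1 setT f)%E by rewrite adde_ge0 ?energy_ge0 ?sqL2_ge0.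
have fe : (sqH1 setT f <= (fine (sqH1 setT f))%:E)%E by rewrite fineK// ge0_fin_numE.
have e0 := fine_ge0 f0; set e := fine _ in fe e0.
have [h2 ht] := sqH1_transl_bound e0 fe.
have s0 : 0 <= 2 ^+ N * \sum_(i < N) e by rewrite mulr_ge0 ?exprn_ge0// sumr_ge0.
rewrite -(moment_shift p (- y n 0%N) (measurable_modulus n)).
apply: (@moment_fin _ _ p p_gt2 N_gt1 p_crit _ (e + 2 ^+ N * \sum_(i < N) e)).
- exact: measurable_modulus_shift.
- by move=> x; exact: modulus_ge0.
- exact: addr_ge0.
- by apply: le_trans h2 _; rewrite lee_fin lerDl.
- by apply: transl_bound_le ht; rewrite lerDr.
Qed.

Definition tail_bound (F0 : {fset nat}) (eps : R) := forall s, uniq s ->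
  (forall n, n \in s -> n \notin F0) -> forall k,
  (moment p (fun x => \sum_(n <- s) modulus n (x - y n k))%R <= eps%:E)%E.

(** The sum of the moduli over [s] is the difference of the partial sums over
    [F0] together with [s] and over [F0]; both are close to the limit in H1,
    uniformly in [k], so [sobolev_small] applies to it. *)
Lemma profile_tail (eps : R) : 0 < eps -> exists F0, tail_bound F0 eps.
Proof.
move=> eps0; have [C C0 CP] := sobolev_small N_gt1 p_gt2 p_crit.
pose q : R := 1 + 2 ^+ N * \sum_(i < N) 1.
have q1 : 1 <= q by rewrite lerDl mulr_ge0 ?exprn_ge0// sumr_ge0.
have q0 : 0 < q by exact: lt_le_trans q1.
have C1 : 0 < 1 + C by rewrite ltr_pwDl.
(* with [q * e] as bound on the increments of each partial sum, [d] bounds those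
   of their difference *)
pose d : R := Num.min (2^-1) (eps / 2) / (1 + C).
have d0 : 0 < d by rewrite divr_gt0// lt_min invr_gt0 ltr0n/= divr_gt0.
have d1 : (1 + C) * d <= 2^-1 by rewrite /d mulrC mulfVK ?gt_eqF// ge_min lexx.
have d2 : (1 + C) * d <= eps / 2 by rewrite /d mulrC mulfVK ?gt_eqF// ge_min lexx orbT.
pose e : R := d / (4 * q).
have e0 : 0 < e by apply: divr_gt0 => //; apply: mulr_gt0.
have eq4 : 4 * (q * e) = d by rewrite /e; field; rewrite gt_eqF.
have [S [mf mS /(_ e e0)[F0 F0P]]] := pd_abs_series uvy.
exists F0 => s us sF0 k.
pose U (F : seq nat) x := \sum_(n <- F) modulus n (x - y n k) - Re (S k x).
have bnd (F : {fset nat}) : (F0 `<=` F)%fset ->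
    (\int[mu]_x (U F x ^+ 2)%:E <= e%:E)%E /\ transl_bound (U F) (q * e).
  move=> /F0P/(_ k)/ltW/(sqH1_transl_bound (ltW e0)).
  have ReE x : Re (\sum_(n <- F) (cabs (v n (x - y n k)))%:C%C - S k x) =
      U F x by rewrite reB re_sum.
  rewrite (funext ReE); under eq_integral do rewrite ReE.
  move=> [h2 ht]; split => //; apply: transl_bound_le ht.
  by rewrite /q mulrDl mul1r -mulrA mulr_suml; under [X in _ <= _ + _ * X]eq_bigr do rewrite mul1r; rewrite lerDr ltW.
have mSr : measurable_fun setT (fun x => Re (S k x)) by have [[]] := mS k.
have mU (F : seq nat) : measurable_fun setT (U F).
  by apply: measurable_funB => //; apply: measurable_sum => n; exact: measurable_modulus_shift.
pose F1 := (F0 `|` [fset n in s])%fset.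
have [a2 at_] := bnd F1 (fsubsetUl _ _).
have [b2 bt] := bnd F0 (fsubset_refl _).
have E1 x : U F1 x - U F0 x = \sum_(n <- s) modulus n (x - y n k).
  rewrite /U (perm_big (F0 ++ s)); last first.
    apply: uniq_perm; rewrite ?fset_uniq// ?cat_uniq ?fset_uniq ?us ?andbT//=.
      by apply/hasPn => n /sF0.
    by move=> n; rewrite mem_cat !inE.
  by rewrite big_cat/=; ring.
have g2 := nnint_sqrB (mU _) (mU _) a2 b2.
have gt := transl_boundB (mU _) (mU _) at_ bt.
rewrite (funext E1) in gt.
have g2' : (\int[mu]_x ((\sum_(n <- s) modulus n (x - y n k)) ^+ 2)%:E <= (2 * (e + e))%:E)%E.
  by under eq_integral do rewrite -E1.
have eqe : e <= q * e by rewrite ler_peMl// ltW.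
apply: le_trans (CP _ d _ _ (ltW d0) _ _ _) _.
- by apply: measurable_sum => n; exact: measurable_modulus_shift.
- by move=> x; apply: sumr_ge0 => n _; exact: modulus_ge0.
- by apply: le_trans g2' _; rewrite lee_fin -eq4; lra.
- by apply: transl_bound_le gt; rewrite -eq4; lra.
- by apply: le_trans d1; rewrite ler_pM2r// lerDr.
- by rewrite lee_fin -mulrA; lra.
Qed.

End profile_sums.

(** * Truncation of the profiles *)

Section profile_moments.
Context {R : realType} {N : nat}.
Local Notation E := 'rV[R]_N.
Local Notation mu := (@lebesgue_rV R N).
Implicit Types (f g : E -> R) (x z : E) (s : seq nat).
Variables (p : R) (p_gt2 : 2 < p).
Let p0 : 0 < p. Proof. by apply: lt_trans p_gt2. Qed.
Let p2 : 0 <= p - 2. Proof. by rewrite subr_ge0 ltW. Qed.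

Variables (A : E -> E) (c : E -> R) (u v : nat -> E -> R[i]) (y : nat -> nat -> E).
Hypothesis uvy : profile_decomposition A c u v y.
Hypothesis u_meas : forall k, cmeasurable (u k).

Local Notation V := (modulus v).
Local Notation shifted n k := (mshift A c (y n k) (v n)).

Lemma cabs_mshift n k x : cabs (shifted n k x) = V n (x - y n k).
Proof. by rewrite /mshift cabsM cabs_cis mul1r. Qed.

Lemma eball_mono (r s : R) : r <= s -> eball (0 : E) r `<=` eball 0 s.
Proof. by move=> rs x; rewrite /eball/= => /lt_le_trans; apply. Qed.

(** The series of profiles converges only locally and in L2, so its remainder [D]
    is cut off at height [J] and to a ball. There it is bounded by a finite tail,
    small by assumption, plus a function [q] that is small in L2 on the ball. *)
Lemma series_remainder (S : nat -> E -> R[i]) (F0 : {fset nat}) (eps : R) (m k : nat) :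
  unif_uncond_cvg_H1loc (fun n k => shifted n k) S -> tail_bound p v y F0 eps ->
  (forall n, n \in F0 -> (n < m)%N) ->
  (moment p (fun x => cabs (S k x - \sum_(n < m) shifted n k x))%R <= (2 `^ p * eps)%:E)%E.
Proof.
move=> [mf mS cvgS] tail F0m.
set D := fun x => cabs (S k x - \sum_(n < m) shifted n k x).
have mD : measurable_fun setT D.
  apply: measurable_cabs; apply: cmeasurableB; first by case: (mS k).
  by apply: cmeasurable_sum => n; case: (mf n k).
have D0 x : 0 <= D x by exact: cabs_ge0.
pose B (J : nat) := eball (0 : E) J%:R.
have mB J : measurable (B J) by exact: measurable_eball.
pose F J x := (Num.min (D x) J%:R `^ p) * \1_(B J) x.
have mmin J : measurable_fun setT (fun x => Num.min (D x) J%:R) by exact: measurable_minr.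
have min0 J x : 0 <= Num.min (D x) J%:R by rewrite le_min D0 ler0n.
have H : (\int[mu]_x (F J x)%:E)%E @[J --> \oo] --> (\int[mu]_x (D x `^ p)%:E)%E.
  apply: nnint_monotone_cvg => [J|J x|x J K JK|x].
  - by apply: measurable_mul_indic => //; exact: measurable_fun_powR.
  - by rewrite mulr_ge0 ?powR_ge0// indicE.
  - apply: ler_pM; rewrite ?powR_ge0 ?indicE ?ler0n//.
      apply: (ler_powRp p_gt2) => //; rewrite le_min ge_min lexx/= ge_min ler_nat JK orbT//.
    rewrite ler_nat; case: (boolP (x \in B J)) => // xJ; rewrite mem_set//.
    by apply: eball_mono (set_mem xJ); rewrite ler_nat.
  - have [K1 K1P] : exists K1 : nat, D x < K1%:R.
      by exists (Num.bound (D x)); apply: archi_boundP; exact: D0.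
    have [K2 K2P] : exists K2 : nat, enorm x < K2%:R.
      by exists (Num.bound (enorm x)); apply: archi_boundP; exact: sqrtr_ge0.
    exists (maxn K1 K2) => // J /=; rewrite geq_max => /andP[K1J K2J].
    rewrite /F (min_idPl _); last by rewrite (le_trans (ltW K1P))// ler_nat.
    rewrite indicE mem_set ?mulr1// /B/eball/= subr0 (lt_le_trans K2P)// ler_nat//.
apply: (cvge_to_le H); apply: nearW => J; apply/lee_addgt0Pr => d d0.
pose Q : R := 2 `^ p * J%:R `^ (p - 2).
have Q0 : 0 <= Q by rewrite mulr_ge0 ?powR_ge0.
have [F1 F1P] := cvgS J%:R (d / (Q + 1)) (divr_gt0 d0 (ltr_wpDl Q0 ltr01)).
pose G := (F1 `|` [fset n in iota 0 m])%fset.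
have := F1P G (fsubsetUl _ _) k; set q := fun x => _ => qd.
have qL2 : (sqL2 (B J) q <= (d / (Q + 1))%:E)%E.
  by apply: le_trans (ltW qd); rewrite /sqH1 leeDr// energy_ge0.
pose s := [seq n <- G | ~~ (n < m)%N].
have us : uniq s by rewrite filter_uniq// fset_uniq.
have sF0 n : n \in s -> n \notin F0 by rewrite mem_filter => /andP[nm _]; apply: contra nm; exact: F0m.
have GE x : \sum_(n <- G) shifted n k x = \sum_(n < m) shifted n k x + \sum_(n <- s) shifted n k x.
  rewrite (bigID (fun n => (n < m)%N))/= -[X in X + _]big_filter -[X in _ + X]big_filter; congr (_ + _).
  rewrite -(big_mkord xpredT (fun n => shifted n k x)) /index_iota subn0.
  apply: perm_big; apply: uniq_perm; rewrite ?filter_uniq ?fset_uniq ?iota_uniq// => n.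
  by rewrite mem_filter !inE mem_iota add0n; case: (n < m)%N; rewrite ?orbT.
pose W x := \sum_(n <- s) V n (x - y n k).
have W0 x : 0 <= W x by apply: sumr_ge0 => n _; exact: modulus_ge0.
have mW : measurable_fun setT W by apply: measurable_sum => n; exact: (measurable_modulus_shift uvy).
have mq : cmeasurable q.
  by apply: cmeasurableB; [apply: cmeasurable_sum => n; case: (mf n k)|case: (mS k)].
have mcq := measurable_cabs mq; have mcq2 := measurable_cabs_sqr mq.
have DW x : D x <= W x + cabs (q x).
  have -> : D x = cabs (\sum_(n <- s) shifted n k x - q x).
    by rewrite /D /q GE; congr cabs; ring.
  apply: le_trans (cabsD _ _) _; rewrite cabsN lerD2r; apply: le_trans (cabs_sum _ _) _.
  by apply: ler_sum => n _; rewrite cabs_mshift.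
have FW x : F J x <= 2 `^ p * W x `^ p + Q * (cabs (q x) ^+ 2 * \1_(B J) x).
  rewrite /F indicE; case: (x \in B J); last first.
    by rewrite !mulr0 addr0 mulr_ge0 ?powR_ge0.
  rewrite !mulr1; have q0 := cabs_ge0 (q x).
  have mq0 : 0 <= Num.min (cabs (q x)) J%:R by rewrite le_min q0 ler0n.
  apply: (@le_trans _ _ ((W x + Num.min (cabs (q x)) J%:R) `^ p)).
    apply: (ler_powRp p_gt2) => //.
    by rewrite ge_min; have [_|Jq] := leP (cabs (q x)) J%:R; rewrite ?DW// lerDr W0 orbT.
  apply: le_trans (powRD_le2 p_gt2 (W0 x) mq0) _.
  by rewrite mulrDr lerD2l /Q -mulrA ler_wpM2l ?powR_ge0//; exact: (powR_min_le p_gt2).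
have ind0 x : 0 <= \1_(B J) x :> R by rewrite indicE.
have mWp : measurable_fun setT (fun x => W x `^ p) by exact: measurable_fun_powR.
have mqB := measurable_mul_indic (mB J) mcq2.
apply: (@le_trans _ _ (\int[mu]_x (2 `^ p * W x `^ p + Q * (cabs (q x) ^+ 2 * \1_(B J) x))%:E)%E).
  apply: nnint_le => [||x|//].
  - by apply: measurable_mul_indic => //; exact: measurable_fun_powR.
  - by apply: measurable_funD; exact: measurable_funM.
  - by rewrite mulr_ge0 ?powR_ge0.
rewrite nnintD; last 4 first.
- exact: measurable_funM.
- exact: measurable_funM.
- by move=> x; rewrite mulr_ge0 ?powR_ge0.
- by move=> x; apply: mulr_ge0 => //; apply: mulr_ge0; [exact: sqr_ge0|exact: ind0].
rewrite EFinM nnintZ ?powR_ge0//; last by move=> x; exact: powR_ge0.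
rewrite nnintZ//; last by move=> x; apply: mulr_ge0; [exact: sqr_ge0|exact: ind0].
apply: leeD; first by rewrite lee_wpmul2l ?lee_fin ?powR_ge0//; exact: tail.
rewrite -(integral_in (fun x => cabs (q x) ^+ 2) (mB J)).
apply: (@le_trans _ _ (Q%:E * (d / (Q + 1))%:E)%E); first by rewrite lee_wpmul2l ?lee_fin.
rewrite -EFinM lee_fin mulrCA ler_piMr ?(ltW d0)// ler_pdivrMr ?ltr_wpDl// mul1r lerDl//.
Qed.

Definition inside (r : R) n x : R := V n x * \1_(cball r) x.
Definition outside (r : R) n x : R := V n x * \1_(~` cball r) x.

Lemma measurable_inside r n : measurable_fun setT (inside r n).
Proof. by apply: measurable_mul_indic; [exact: measurable_cball|exact: (measurable_modulus uvy)]. Qed.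

Lemma measurable_outside r n : measurable_fun setT (outside r n).
Proof.
apply: measurable_mul_indic; [apply: measurableC; exact: measurable_cball|exact: (measurable_modulus uvy)].
Qed.

Lemma inside_ge0 r n x : 0 <= inside r n x.
Proof. by rewrite mulr_ge0 ?modulus_ge0// indicE. Qed.

Lemma outside_ge0 r n x : 0 <= outside r n x.
Proof. by rewrite mulr_ge0 ?modulus_ge0// indicE. Qed.

Lemma moment_inside_outside r n : (moment p (V n) = moment p (inside r n) + moment p (outside r n))%E.
Proof.
have m1 := measurable_inside r n; have m2 := measurable_outside r n.
rewrite /moment -nnintD; [|exact: measurable_fun_powR..|by move=> x; exact: powR_ge0|by move=> x; exact: powR_ge0].
apply: eq_integral => x _; congr (_%:E); rewrite /inside /outside !indicE in_setC.
have z : 0 `^ p = 0 :> R by rewrite powR0// gt_eqF.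
by case: (x \in _); rewrite /= ?mulr1 ?mulr0 z ?addr0 ?add0r.
Qed.

Lemma moment_inside_cvg n : moment p (inside J%:R n) @[J --> \oo] --> moment p (V n).
Proof.
apply: nnint_monotone_cvg => [J|J x|x J K JK|x].
- by apply: measurable_fun_powR; exact: measurable_inside.
- exact: powR_ge0.
- apply: (ler_powRp p_gt2); first exact: inside_ge0.
  rewrite ler_wpM2l ?modulus_ge0// !indicE ler_nat.
  case: (boolP (x \in cball J%:R)) => // xJ; rewrite mem_set// /cball/=.
  by apply: le_trans (set_mem xJ) _; rewrite ler_nat.
- exists (Num.bound `|x|) => // J /= xJ; rewrite /inside indicE mem_set ?mulr1// /cball/=.
  by apply: le_trans (ltW (archi_boundP (normr_ge0 x))) _; rewrite ler_nat.
Qed.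

Definition truncated_sum (r : R) (m k : nat) x : R[i] :=
  \sum_(n < m) shifted n k x * (\1_(cball r) (x - y n k))%:C%C.

Lemma truncation_error (r : R) (m k : nat) x :
  cabs (\sum_(n < m) shifted n k x - truncated_sum r m k x) <= \sum_(n < m) outside r n (x - y n k).
Proof.
rewrite /truncated_sum -sumrB; apply: le_trans (cabs_sum _ _) _.
apply: ler_sum => n _; rewrite /outside -cabs_mshift !indicE in_setC.
by case: (_ \in _); rewrite /= ?mulr1 ?mulr0 ?subrr ?subr0 ?cabs0.
Qed.

(** At each point at most one summand is nonzero. *)
Lemma moment_truncated_sum (r : R) (m k : nat) :
  (forall i j : 'I_m, i != j -> 2 * r < `|y i k - y j k|) ->
  moment p (fun x => cabs (truncated_sum r m k x)) = (\sum_(n < m) moment p (inside r n))%E.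
Proof.
move=> sep; have me (n : 'I_m) : measurable_fun setT (fun x => inside r n (x - y n k)).
  by apply: measurable_fun_shift; exact: measurable_inside.
transitivity (\sum_(n < m) moment p (fun x => inside r n (x - y n k)))%E; last first.
  by apply: eq_bigr => n _; rewrite (moment_shift p (- y n k) (measurable_inside r n)).
rewrite /moment -nnint_sum => [|n|n x]; [|exact: measurable_fun_powR|exact: powR_ge0].
apply: eq_integral => x _; congr (_%:E).
rewrite /truncated_sum cabs_sum_disjoint => [|//|i j ij].
  apply: eq_bigr => n _; rewrite cabsM cabs_mshift cabs_real ?indicE ?ler0n//.
have [xi|xi] := boolP (x - y i k \in cball r); last by left; rewrite indicE (negPf xi) mulr0.
right; rewrite indicE memNset ?mulr0//= /cball/= => xj; move: (sep _ _ ij); apply/negP; rewrite -leNgt.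
rewrite (_ : y i k - y j k = (x - y j k) - (x - y i k)); last by apply/rowP => l; rewrite !mxE; ring.
apply: le_trans (ler_normB _ _) _; move: (set_mem xi); rewrite /cball/=; lra.
Qed.

Lemma cmeasurable_truncated_sum r m k : cmeasurable (truncated_sum r m k).
Proof.
have [S [[mf _ _] _]] := pd_series uvy.
apply: cmeasurable_sum => n; have [[mr mi] _] := mf n k.
have mI : measurable_fun setT (fun x => \1_(cball r) (x - y n k) : R).
  have mcb : measurable_fun setT (\1_(cball r) : E -> R).
    by apply: measurable_indic; exact: measurable_cball.
  exact: (measurable_fun_shift _ mcb).
split.
- by under eq_fun do rewrite reM /= mulr0 subr0; exact: measurable_funM.
- by under eq_fun do rewrite imM /= mulr0 add0r; exact: measurable_funM.
Qed.

End profile_moments.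

(** * Convergence of the moments *)

Section moment_convergence.
Context {R : realType} {N : nat}.
Local Notation E := 'rV[R]_N.
Local Notation mu := (@lebesgue_rV R N).
Implicit Types (x z : E) (s : seq nat).
Variables (N_gt1 : (1 < N)%N) (p : R) (p_gt2 : 2 < p) (p_crit : p * (N%:R - 2) < 2 * N%:R).
Hypothesis p_lt_crit : p < crit_exp (R := R) (N := N).
Let p0 : 0 < p. Proof. by apply: lt_trans p_gt2. Qed.

Variables (A : E -> E) (c : E -> R) (u v : nat -> E -> R[i]) (y : nat -> nat -> E).
Hypothesis uvy : profile_decomposition A c u v y.
Hypothesis u_meas : forall k, cmeasurable (u k).

Local Notation V := (modulus v).
Local Notation shifted n k := (mshift A c (y n k) (v n)).

Lemma cvge0_le (X : nat -> \bar R) (e : R) : X k @[k --> \oo] --> 0%E -> 0 < e ->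
  \forall k \near \oo, (X k <= e%:E)%E.
Proof.
move=> /fine_cvgP[fX /cvgrPdist_le X0] e0; near=> k.
have kf : X k \is a fin_num by near: k.
rewrite -(fineK kf) lee_fin; apply: le_trans (ler_norm _) _.
by rewrite -normrN -sub0r; near: k; exact: X0.
Unshelve. all: by end_near.
Qed.

Lemma outside_small (m : nat) (d : R) : 0 < d ->
  exists J : nat, (\sum_(n < m) moment p (outside v J%:R n) <= d%:E)%E.
Proof.
move=> d0; pose d1 : R := d / m.+1%:R.
have d10 : 0 < d1 by rewrite divr_gt0.
have fin n : moment p (V n) \is a fin_num.
  by rewrite ge0_fin_numE ?moment_ge0// (moment_profile_lty N_gt1 p_gt2 p_crit uvy).
have : \forall J \near \oo, forall n : 'I_m, (moment p (outside v J%:R n) <= d1%:E)%E.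
  apply: filter_forall => n.
  have H : moment p (inside v J%:R n) @[J --> \oo] --> (fine (moment p (V n)))%:E.
    by rewrite fineK//; exact: (moment_inside_cvg p_gt2 uvy).
  have [fX /cvgrPdist_le/(_ _ d10) X] := (fine_cvgP _ _).1 H.
  near=> J; have fJ : moment p (inside v J%:R n) \is a fin_num by near: J.
  have := moment_inside_outside p_gt2 uvy J%:R n.
  have : `|fine (moment p (V n)) - fine (moment p (inside v J%:R n))| <= d1 by near: J.
  rewrite -{2}(fineK (fin n)) -(fineK fJ).
  case: (moment p (outside v J%:R n)) => [w| |]//.
  by rewrite -EFinD => H1 [H2]; rewrite lee_fin; move: H1; rewrite H2 /= addrAC subrr add0r; apply: le_trans; exact: ler_norm.
move=> [J _ /(_ J (leqnn J)) JP]; exists J.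
apply: (@le_trans _ _ (\sum_(n < m) d1%:E)%E); first by apply: lee_sum => n _; exact: JP.
rewrite sumEFin lee_fin sumr_const card_ord -[leLHS]mulr_natr /d1 -mulrA ler_piMr ?(ltW d0)//.
by rewrite mulrC ler_pdivrMr// mul1r ler_nat.
Unshelve. all: by end_near.
Qed.

(** In L^p and up to [eps], [u k] is eventually a sum of finitely many truncated
    profiles with disjoint supports: [m] is dictated by the smallness of the
    tails, and the radius by the finitely many moments left. *)
Lemma profile_approximation (eps : R) : 0 < eps -> exists m (r L : R),
  [/\ (\sum_(n < m) moment p (inside v r n) = L%:E)%E,
      \forall k \near \oo, (moment p (fun x => cabs (u k x - truncated_sum A c v y r m k x))%R <= eps%:E)%E,
      \forall k \near \oo, moment p (fun x => cabs (truncated_sum A c v y r m k x)) = L%:E &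
      forall M, (\sum_(0 <= n < M) moment p (V n) <= (L + eps)%:E)%E].
Proof.
move=> eps0; pose K : R := 2 `^ p.
have K1 : 1 <= K by have : 1 `^ p <= 2 `^ p :> R; [apply: (ler_powRp p_gt2) => //; rewrite ler1n|rewrite powR1].
have K0 : 0 < K by exact: lt_le_trans K1.
have K31 : 1 <= K ^+ 3 by exact: exprn_ege1.
have K30 : 0 < K ^+ 3 by exact: exprn_gt0.
(* [K] is the constant in the quasi-triangle inequality for p-th powers, applied
   to a sum of three errors; [K ^+ m] below is the one for [m] summands *)
pose e : R := eps / (3 * K ^+ 3).
have e0 : 0 < e by apply: divr_gt0 => //; apply: mulr_gt0.
have eE : 3 * K ^+ 3 * e = eps by rewrite /e; field; rewrite gt_eqF.
have [F0 tail] := profile_tail N_gt1 p_gt2 p_crit uvy e0.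
pose m := (\max_(n <- F0) n).+1.
have F0m n : n \in F0 -> (n < m)%N by move=> nF; rewrite ltnS; apply: leq_bigmax_seq.
have Km1 : 1 <= K ^+ m by exact: exprn_ege1.
have Km0 : 0 < K ^+ m by exact: lt_le_trans Km1.
have [J JP] := outside_small m (divr_gt0 e0 Km0).
have fin n : (moment p (V n) < +oo)%E by exact: (moment_profile_lty N_gt1 p_gt2 p_crit uvy).
have Lfin : (\sum_(n < m) moment p (inside v J%:R n))%E \is a fin_num.
  rewrite ge0_fin_numE; last by apply: sume_ge0 => n _; exact: moment_ge0.
  apply: lte_sum_pinfty => n _; apply: le_lt_trans (fin n).
  by rewrite (moment_inside_outside p_gt2 uvy J%:R) leeDl ?moment_ge0.
exists m, J%:R, (fine (\sum_(n < m) moment p (inside v J%:R n))%E); split; first by rewrite fineK.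
- have [S [Sc Sp]] := pd_series uvy.
  have [mf mS _] := Sc.
  have := cvge0_le (Sp p p_gt2 p_lt_crit) e0; apply: filterS => k uS.
  have rem := series_remainder p_gt2 uvy k Sc tail F0m.
  have mshifted : cmeasurable (fun x => \sum_(n < m) shifted n k x).
    by apply: cmeasurable_sum => n; case: (mf n k).
  have mtr := cmeasurable_truncated_sum uvy J%:R m k.
  have mSk : cmeasurable (S k) by case: (mS k).
  pose a x := cabs (u k x - S k x).
  pose b x := cabs (S k x - \sum_(n < m) shifted n k x).
  pose t x := \sum_(n < m) outside v J%:R n (x - y n k).
  have ma : measurable_fun setT a by apply: measurable_cabs; exact: cmeasurableB.
  have mb : measurable_fun setT b by apply: measurable_cabs; exact: cmeasurableB.
  have mt' n : measurable_fun setT (fun x => outside v J%:R n (x - y n k)).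
    by apply: measurable_fun_shift; exact: (measurable_outside uvy).
  have mt : measurable_fun setT t by exact: measurable_sum.
  have t0 x : 0 <= t x by apply: sumr_ge0 => n _; exact: outside_ge0.
  have b0 x : 0 <= b x by exact: cabs_ge0.
  have a0 x : 0 <= a x by exact: cabs_ge0.
  have mbt : measurable_fun setT (fun x => b x + t x) by exact: measurable_funD.
  apply: (@le_trans _ _ (moment p (fun x => a x + (b x + t x))%R)).
    apply: (moment_le p_gt2) => [|||x]; [by apply: measurable_cabs; exact: cmeasurableB|exact: measurable_funD|by move=> x; exact: cabs_ge0|].
    rewrite (_ : u k x - _ = (u k x - S k x) + ((S k x - \sum_(n < m) shifted n k x) +
      (\sum_(n < m) shifted n k x - truncated_sum A c v y J%:R m k x))); last by ring.
    apply: le_trans (cabsD _ _) _; rewrite lerD2l; apply: le_trans (cabsD _ _) _; rewrite lerD2l.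
    exact: truncation_error.
  have tP : (moment p t <= e%:E)%E.
    apply: le_trans (moment_sum_le p_gt2 _ _ _) _ => [//|n x|]; first exact: outside_ge0.
    rewrite (eq_bigr (fun n : 'I_m => moment p (outside v J%:R n))); last first.
      by move=> n _; exact: (moment_shift p (- y n k) (measurable_outside uvy J%:R n)).
    have -> : size (index_enum 'I_m) = m by rewrite -[RHS]card_ord cardE enumT.
    apply: le_trans (lee_wpmul2l _ JP) _; first by rewrite lee_fin exprn_ge0// ltW.
    by rewrite -EFinM lee_fin mulrC divfK// gt_eqF.
  apply: le_trans (momentD_le p_gt2 ma mbt a0 (fun x => addr_ge0 (b0 x) (t0 x))) _.
  apply: (@le_trans _ _ (K%:E * (e%:E + K%:E * ((K * e)%:E + e%:E)))%E).
    rewrite lee_wpmul2l ?lee_fin ?(ltW K0)//; apply: leeD => //.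
    apply: le_trans (momentD_le p_gt2 mb mt b0 t0) _.
    by rewrite lee_wpmul2l ?lee_fin ?(ltW K0)//; apply: leeD.
  rewrite -!(EFinD, EFinM) lee_fin -eE.
  have -> : K * (e + K * (K * e + e)) = (K + K ^+ 3 + K ^+ 2) * e by ring.
  rewrite ler_pM2r//.
  have := ler_weXn2l K1 (isT : (1 <= 3)%N); have := ler_weXn2l K1 (isT : (2 <= 3)%N).
  by rewrite expr1; move: (K ^+ 3) (K ^+ 2) => k3 k2; lra.
- have sepk : \forall k \near \oo, forall i j : 'I_m, i != j -> 2 * J%:R < `|y i k - y j k| :> R.
    apply: filter_forall => i; apply: filter_forall => j.
    have [->|ij] := eqVneq i j; first exact: nearW.
    have /(profiles_separated (ltnW N_gt1) uvy)/(_ (2 * J%:R)) : (i : nat) <> j by move=> /val_inj/eqP; exact/negP.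
    by apply: filterS => k + _.
  apply: filterS sepk => k sepk; rewrite fineK//; exact: (moment_truncated_sum p_gt2 uvy).
- move=> M; rewrite EFinD fineK//.
  have m0 n : (0 <= moment p (V n))%E by exact: moment_ge0.
  apply: (@le_trans _ _ (\sum_(0 <= n < m + M) moment p (V n))%E).
    by rewrite (big_cat_nat (leq0n M) (leq_addl m M))/= leeDl// sume_ge0.
  rewrite (big_cat_nat (leq0n m) (leq_addr M m))/= big_mkord.
  have -> : (\sum_(n < m) moment p (V n) =
      \sum_(n < m) moment p (inside v J%:R n) + \sum_(n < m) moment p (outside v J%:R n))%E.
    by rewrite -big_split; apply: eq_bigr => n _; rewrite (moment_inside_outside p_gt2 uvy J%:R).
  rewrite -addeA leeD2l//.
  apply: (@le_trans _ _ (e%:E + e%:E)%E); last first.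
    rewrite -EFinD lee_fin -eE -mulr2n -[leLHS]mulr_natl ler_pM2r//.
    by move: (K ^+ 3) K31 => k3; lra.
  apply: leeD.
    by apply: le_trans JP _; rewrite lee_fin ler_pdivrMr// ler_peMr// ltW.
  rewrite (eq_bigr (fun n => moment p (fun x => V n (x - y n 0%N)))); last first.
    by move=> n _; rewrite (moment_shift p (- y n 0%N) (measurable_modulus uvy n)).
  apply: le_trans (moment_sum_super p_gt2 _ _ _) _ => [n|n x|].
  + exact: (measurable_modulus_shift uvy).
  + exact: modulus_ge0.
  + apply: tail; first exact: iota_uniq.
    move=> n; rewrite mem_index_iota => /andP[mn _]; apply/negP => /F0m; rewrite ltnNge mn//.
Qed.

(** The approximation compares the moment of [u k] with a number [L] close to the
    sum of the series, in both directions and up to a factor [1 + q]. *)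
Lemma moment_cvg : moment p (fun x => cabs (u k x)) @[k --> \oo] -->
  (\sum_(0 <= n <oo) moment p (V n))%E.
Proof.
set T := (\sum_(0 <= n <oo) _)%E.
have m0 n : (0 <= moment p (V n))%E by exact: moment_ge0.
have T0 : (0 <= T)%E by apply: nneseries_ge0 => n _ _; exact: m0.
have Tle (b : R) : (forall M, (\sum_(0 <= n < M) moment p (V n) <= b%:E)%E) -> (T <= b%:E)%E.
  move=> H; apply: (lime_le (is_cvg_nneseries (fun n _ _ => m0 n))); exact: nearW.
have Tfin : T \is a fin_num.
  have [m [r [L [_ _ _ /Tle TL]]]] := profile_approximation ltr01.
  by rewrite ge0_fin_numE// (le_lt_trans TL)// ltry.
have t0 := fine_ge0 T0; set t := fine T in t0.
have Tt : T = t%:E by rewrite fineK.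
clearbody t.
pose X k := moment p (fun x => cabs (u k x)).
have X0 k : (0 <= X k)%E by exact: moment_ge0.
have key (h : R) : 0 < h -> \forall k \near \oo, ((t - h)%:E <= X k)%E /\ (X k <= (t + h)%:E)%E.
  (* [q] and [e] are chosen so that each of the errors is at most [h / 4] *)
  move=> h0; pose q := h / (4 * (t + h + 1)).
  have th : 0 < t + h + 1 by rewrite ltr_wpDl// addr_ge0// ltW.
  have q0 : 0 < q by apply: divr_gt0 => //; apply: mulr_gt0.
  have qE : q * (t + h + 1) = h / 4 by rewrite /q; field; rewrite gt_eqF.
  have [C C0 CP] := moment_almost (N := N) p_gt2 q0.
  pose e := h / (4 * (C + 1)).
  have C1 : 0 < C + 1 by rewrite ltr_wpDl.
  have e0 : 0 < e by apply: divr_gt0 => //; apply: mulr_gt0.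
  have eE : (C + 1) * e = h / 4 by rewrite /e; field; rewrite gt_eqF.
  have [m [r [L [L1 uw wL /Tle TL]]]] := profile_approximation e0.
  have Lt : L <= t.
    rewrite -lee_fin -L1 -Tt; apply: (@le_trans _ _ (\sum_(0 <= n < m) moment p (V n))%E); last first.
      by apply: nneseries_lim_ge => n _ _.
    rewrite big_mkord; apply: lee_sum => n _.
    by rewrite (moment_inside_outside p_gt2 uvy r) leeDl ?moment_ge0.
  move: TL; rewrite Tt lee_fin => tL.
  have L0 : 0 <= L by rewrite -lee_fin -L1; apply: sume_ge0 => n _; exact: moment_ge0.
  near=> k.
  have uwk : (moment p (fun x => cabs (u k x - truncated_sum A c v y r m k x))%R <= e%:E)%E by near: k.
  have wLk : moment p (fun x => cabs (truncated_sum A c v y r m k x)) = L%:E by near: k.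
  have mw := cmeasurable_truncated_sum uvy r m k.
  have mcu := measurable_cabs (u_meas k); have mcw := measurable_cabs mw.
  have mcd := measurable_cabs (cmeasurableB (u_meas k) mw).
  have X1 : (X k <= (1 + q)%:E * L%:E + C%:E * e%:E)%E.
    apply: (@le_trans _ _ ((1 + q)%:E * L%:E + C%:E * moment p (fun x => cabs (u k x - truncated_sum A c v y r m k x))%R)%E); last first.
      by rewrite leeD2l// lee_wpmul2l// lee_fin.
    rewrite -wLk; apply: CP => // x; rewrite ?cabs_ge0//.
    by rewrite -[X in cabs X <= _](subrK (truncated_sum A c v y r m k x)) addrC [leRHS]addrC; rewrite addrC cabsD.
  have X2 : (L%:E <= (1 + q)%:E * X k + C%:E * e%:E)%E.
    apply: (@le_trans _ _ ((1 + q)%:E * X k + C%:E * moment p (fun x => cabs (u k x - truncated_sum A c v y r m k x))%R)%E); last first.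
      by rewrite leeD2l// lee_wpmul2l// lee_fin.
    rewrite -wLk; apply: CP => // x; rewrite ?cabs_ge0//.
    by rewrite -[X in _ + X]cabsN; apply: le_trans (cabsD _ _); rewrite opprB addrC subrK.
  have Xf : X k \is a fin_num.
    by rewrite ge0_fin_numE// (le_lt_trans X1)// -!(EFinM, EFinD) ltry.
  have x0 := fine_ge0 (X0 k).
  move: X1 X2; rewrite -(fineK Xf) -!(EFinM, EFinD) !lee_fin.
  move: (fine (X k)) x0 => xk x0 X1 X2.
  have Cet : C * e <= h / 4 by rewrite -eE mulrDl mul1r lerDl ltW.
  have et : e <= h / 4 by rewrite -eE mulrDl mul1r lerDr mulr_ge0// ltW.
  have qL : q * L <= h / 4 by rewrite -qE ler_pM2l//; lra.
  have xh : xk <= t + h by move: X1; rewrite mulrDl mul1r; lra.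
  have qx : q * xk <= h / 4 by rewrite -qE ler_pM2l//; lra.
  by split; [move: X2; rewrite mulrDl mul1r; lra|].
rewrite Tt; apply/fine_cvgP; split.
  apply: filterS (key 1 ltr01) => k [_ Xk].
  by rewrite -/(X k) ge0_fin_numE// (le_lt_trans Xk)// ltry.
apply/cvgrPdist_le => h h0; apply: filterS (key h h0) => k [].
have := X0 k; rewrite /= -/(X k); case: (X k) => [xk| |]//.
by rewrite !lee_fin => _ H1 H2; rewrite ler_norml /=; apply/andP; split; lra.
Unshelve. all: by end_near.
Qed.

End moment_convergence.

(** * The splitting of moments, masses and energies *)

Lemma lipschitz_coor_continuous (R : realType) (N : nat) (B : 'rV[R]_N -> 'rV[R]_N) (i : 'I_N) :
  lipschitz B -> continuous (fun x => B x ord0 i).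
Proof.
move=> [M [_ MP]] x; have {}MP := MP (M + 1) (ltr_pwDr ltr01 (lexx _)).
have BM z w : `|B z - B w| <= (M + 1) * `|z - w| by have := MP (z, w) (conj I I).
apply: continuous_seqP => u ux; apply/cvgrPdist_le => e e0; have L0 : 0 < `|M + 1| + 1 by rewrite ltr_wpDl.
near=> n; have := normr_coor (B x - B (u n)) i; rewrite !mxE => /le_trans; apply.
apply: le_trans (BM _ _) _; apply: (@le_trans _ _ ((`|M + 1| + 1) * `|x - u n|)).
  by rewrite ler_wpM2r// (le_trans (ler_norm _))// lerDl.
rewrite -ler_pdivlMl// mulrC; near: n.
by move/cvgrPdist_le : ux; apply; rewrite divr_gt0.
Unshelve. all: by end_near.
Qed.

Theorem theorem5p2 (R : realType) (N : nat) (N_ge3 : (3 <= N)%N)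
    (Xi : set 'rV[R]_N) (XiP : discretization Xi)
    (A : 'rV[R]_N -> 'rV[R]_N) (A_C1 : dotC1 A) (c : 'rV[R]_N -> R)
    (u : nat -> 'rV[R]_N -> R[i]) (u_HA : forall k, HA A (u k))
    (u_bounded : exists M : R, forall k, (sqHA A (u k) <= M%:E)%E)
    (v : nat -> 'rV[R]_N -> R[i]) (v_H1loc : forall n, H1loc (v n))
    (v0_HA : HA A (v 0%N))
    (y : nat -> nat -> 'rV[R]_N) (y_Xi : forall n k, Xi (y n k))
    (y0 : forall k, y 0%N k = 0)
    (uvy : profile_decomposition A c u v y)
    (Ainf : nat -> 'rV[R]_N -> 'rV[R]_N) (Ainf0 : Ainf 0%N = A)
    (AinfP : forall n, (1 <= n)%N ->
      potential_at_infinity A c (y n) (Ainf n)) :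
  [/\ forall p : R, 2 < p -> p < 2 * N%:R / (N%:R - 2) ->
        intpow p (u k) @[k --> \oo] -->
          (\sum_(0 <= n <oo) intpow p (v n))%E,
      (\sum_(0 <= n <oo) sqL2 setT (v n) <=
         limn_einf (fun k => sqL2 setT (u k)))%E &
      (\sum_(0 <= n <oo) energy setT (Ainf n) (v n) <=
         limn_einf (fun k => energy setT A (u k)))%E].

Proof.
have N_gt1 : (1 < N)%N by exact: ltnW.
have N_gt0 : (0 < N)%N by exact: ltnW.
have [M uM] := u_bounded.
have sq0 k : (0 <= energy setT A (u k))%E by exact: energy_ge0.
have u_wgrad k : has_wgrad (u k).
  apply: (@energy_has_wgrad _ _ setT A); apply: le_lt_trans (ltry M); apply: le_trans (uM k).
  by rewrite /sqHA leeDl// sqL2_ge0.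
have u_L2 k : (sqL2 setT (u k) <= M%:E)%E.
  by apply: le_trans (uM k); rewrite /sqHA leeDr.
split.
- move=> p p_gt2 pc; have N2 : 0 < N%:R - 2 :> R by rewrite subr_gt0 ltr_nat.
  have p_crit : p * (N%:R - 2) < 2 * N%:R by rewrite -ltr_pdivlMr.
  apply: (moment_cvg N_gt1 p_gt2 p_crit pc uvy) => k.
  exact: has_wgrad_cmeasurable.
- exact: (lsc_L2 N_gt0 A_C1 uvy u_wgrad).
- apply: (lsc_energy N_gt0 A_C1 uvy u_wgrad u_L2) => [n i|n r e e0].
    case: n => [|n]; first by rewrite Ainf0; exact: continuous_potential.
    by have [+ _] := AinfP n.+1 isT; exact: lipschitz_coor_continuous.
  case: n => [|n].
    apply: nearW => k x _ i; rewrite y0 addr0 Ainf0 (corrected_potentialE A_C1) /dphase eqxx addr0.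
    by rewrite subrr normr0 ltW.
  have [_ /(_ (N%:R * r) e e0)] := AinfP n.+1 isT.
  apply: filterS => k H x xr i.
  have /H/ltW : enorm x <= N%:R * r by apply: le_trans (enorm_le x) _; rewrite ler_wpM2l.
  apply: le_trans; apply: le_trans (normr_le_enorm _).
  by have := normr_coor (corrected_potential A c (y n.+1 k) (x + y n.+1 k) - Ainf n.+1 x) i; rewrite !mxE.
Qed.
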